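(* Let $\mathfrak a_k$ be the species of $k$-trees and let $\tilde{\mathfrak a}_k(x)$ be the ordinary generating function whose coefficient of $x^n$ is the number of unlabeled $k$-trees with $n$ hedra. Let $\widetilde{\mathcal{CT}_k^{Y}}$ and $\widetilde{\mathcal{CT}_k^{XY}}$ be the $\mathfrak S_k$- and $\mathfrak S_{k+1}$-ordinary generating functions of $Y$-rooted and of edge-rooted $k$-coding trees respectively, regarded as functions of cycle type. Then $$\tilde{\mathfrak a}_k(x)=\sum_{\lambda\vdash k+1}\frac1{z_\lambda}\widetilde{\mathcal{CT}_k^{XY}}(\lambda)(x)+\sum_{\lambda\vdash k}\frac1{z_\lambda}\widetilde{\mathcal{CT}_k^{Y}}(\lambda)(x)-\sum_{\lambda\vdash k}\frac{1}{z_\lambda}\widetilde{\mathcal{CT}_k^{XY}}(\lambda\cup\{1\})(x).$$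
   Context: $k$-trees ($k\ge1$): the complete graph $K_k$ is a $k$-tree, and any graph obtained from a $k$-tree by adding a new vertex joined by edges to the vertices of some existing $k$-clique is a $k$-tree. A hedron is a $(k+1)$-clique. Partitions are multisets of positive integers; $\lambda\cup\{1\}$ adds one part equal to $1$. $z_\lambda=\prod_i i^{m_i}m_i!$ where $m_i$ is the multiplicity of $i$ in $\lambda$. A $k$-coding tree on a pair of finite sets $(U,V)$ is a tree with black vertex set $U$ ($X$-labels) and white vertex set $V$ ($Y$-labels), every edge joining a black and a white vertex, each black vertex having exactly $k+1$ neighbors and a cyclic order on them. $\mathcal{CT}_k^{Y}$ is the two-sort species of $k$-coding trees rooted at a white vertex, $\mathcal{CT}_k^{XY}$ that of $k$-coding trees rooted at an edge. Let $\Delta:\mathfrak S_k\to\mathfrak S_{k+1}$ embed $\mathfrak S_k$ as the permutations fixing $k+1$. For $\sigma\in\mathfrak S_{k+1}$ and $i\in\{1,\dots,k+1\}$ let $\rho_i(\sigma):a\mapsto\sigma(i+a)-\sigma(i)$, arithmetic modulo $k+1$ with representatives in $\{1,\dots,k+1\}$. Actions. Given a rooted tree, linearize the cyclic order at each non-root black vertex so that its parent white neighbor (on the path to the root) is in position $k+1$. Applying $\pi\in\mathfrak S_{k+1}$ at a black vertex means moving the white neighbor in position $a$ to position $\pi(a)$ and taking the resulting cyclic order. The underlying tree and labels never change. (1) $\sigma\in\mathfrak S_k$ acts on a $Y$-rooted tree by applying at each black vertex $v$ a permutation $\sigma_v$: $\sigma_v=\Delta\sigma$ if $v$ is adjacent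 to the root, and $\sigma_{v'}=\rho_i(\sigma_v)$ if the parent of the black vertex $v'$ is the white neighbor in (original) position $i$ of $v$, $v$ being the next black vertex on the path from $v'$ to the root. The root is unchanged. (2) $\sigma\in\mathfrak S_{k+1}$ acts on an edge-rooted tree with root edge $\{v_0,w_0\}$ ($v_0$ black): linearize at $v_0$ with $w_0$ last, regard $v_0$ as the root for the purpose of parents, set $\sigma_{v_0}=\sigma$, define $\sigma_{v'}=\rho_i(\sigma_v)$ recursively as in (1) (including black vertices attached through $w_0$, with $i=k+1$), apply all $\sigma_v$, and let the new root edge join $v_0$ to the white neighbor now in position $k+1$. For a two-sort species $F$ with a label-independent action of a group $\Gamma$ and $\gamma\in\Gamma$, put $Z^\Gamma_F(\gamma)=\sum_{m,n\ge0}\frac1{m!n!}\sum_{(\pi,\tau)\in\mathfrak S_m\times\mathfrak S_n}\operatorname{fix}(\gamma\cdot F[\pi,\tau])\prod_jp_j[x]^{\pi_j}p_j[y]^{\tau_j}$, where $\pi_j,\tau_j$ are the numbers of $j$-cycles and $\operatorname{fix}$ counts fixed points. The $\Gamma$-ordinary generating function $\widetilde F(\gamma)(x)$ is obtained from $Z^\Gamma_F(\gamma)$ by substituting $p_j[x]=x^j$ and $p_j[y]=1$ for all $j$; it counts unlabeled $\gamma$-invariant $F$-structures by number of black vertices. The functions $\widetilde{\mathcal{CT}_k^{Y}}(\sigma)(x)$ ($\sigma\in\mathfrak S_k$) and $\widetilde{\mathcal{CT}_k^{XY}}(\sigma)(x)$ ($\sigma\in\mathfrak S_{k+1}$) depend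 only on the cycle type of $\sigma$; for a partition $\lambda$, $\widetilde F(\lambda)(x)$ denotes the value of $\widetilde F(\sigma)(x)$ for every $\sigma$ of cycle type $\lambda$. *)

(* Defs.v *)
From HB Require Import structures.
From mathcomp Require Import all_boot all_order all_algebra all_fingroup.
From mathcomp Require Import finmap multiset.
From mathcomp Require Import boolp classical_sets fsbigop.

Set Implicit Arguments.
Unset Strict Implicit.
Unset Printing Implicit Defensive.

Import GRing.Theory.
Local Open Scope mset_scope.
Local Open Scope ring_scope.

(* Formal power series in x over rat are represented by their coefficient
   functions nat -> rat.  Sums \sum_(i \in A) are finitely supported sums; all
   those below have finite support. *)

Definition is_partition (n : nat) (la : {mset nat}) : Prop :=
  0%N \notin la /\ (\sum_(i <- la) i)%N = n.

Definition partitions (n : nat) : set {mset nat} :=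
  [set la | is_partition n la]%classic.

Definition z_part (la : {mset nat}) : nat :=
  (\prod_(i <- finsupp la) (i ^ la i * (la i)`!))%N.

Definition cycle_type (n : nat) (s : 'S_n) : {mset nat} :=
  seq_mset [seq #|C| | C : {set 'I_n} <- enum (porbits s)].

Definition ncycles (n : nat) (s : 'S_n) (j : nat) : nat :=
  #|[set C in porbits s | #|C| == j]|.

Section KTrees.
Variables (k : nat) (T : finType) (e : rel T).

Definition clique (Q : {set T}) : bool :=
  [forall x in Q, forall y in Q, (x != y) ==> e x y].

(* [ktree_on S]: the subgraph of e induced on S is a k-tree. *)
Inductive ktree_on : {set T} -> Prop :=
| ktree_base (S : {set T}) : #|S| = k -> clique S -> ktree_on S
| ktree_step (S Q : {set T}) (x : T) :
    ktree_on S -> x \notin S ->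
    Q \subset S -> #|Q| = k -> clique Q ->
    {in S, forall y, e x y = (y \in Q)} ->
    ktree_on (x |: S).

Definition is_ktree : Prop :=
  [/\ symmetric e, irreflexive e & ktree_on [set: T]].

Definition hedra : {set {set T}} := [set Q | clique Q & #|Q| == k.+1].

End KTrees.

(* A graph on 'I_m is the set of its (ordered) adjacent pairs. *)
Definition edge_rel (m : nat) (g : {set 'I_m * 'I_m}) : rel 'I_m :=
  fun x y => (x, y) \in g.

Definition graph_iso (m : nat) (g h : {set 'I_m * 'I_m}) : Prop :=
  exists s : 'S_m, forall x y, edge_rel h (s x) (s y) = edge_rel g x y.

Definition unlabeled_ktrees_on (k m n : nat) : nat :=
  #|equivalence_partition (fun g h => `[< @graph_iso m g h >])
      [set g | `[< is_ktree k (edge_rel g) >] & #|hedra k (edge_rel g)| == n]|.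

Definition ktree_ogf (k : nat) : nat -> rat := fun n =>
  \sum_(m \in [set: nat]%classic) ((unlabeled_ktrees_on k m n)%:R : rat).

(* The data of a two-sort G-species that its cycle index depends on: the
   F-structures on (U, V) are the elements of [gs_carrier U V] satisfying
   [gs_mem]; the values of [gs_transport] (relabelling) and [gs_act] elsewhere
   are irrelevant. *)
Record gspecies (G : Type) := GSpecies {
  gs_carrier : finType -> finType -> finType;
  gs_mem : forall U V : finType, gs_carrier U V -> Prop;
  gs_transport : forall U V : finType,
    {perm U} -> {perm V} -> gs_carrier U V -> gs_carrier U V;
  gs_act : forall U V : finType, G -> gs_carrier U V -> gs_carrier U V
}.

Section CycleIndex.
Variables (G : Type) (F : gspecies G).

Definition gs_fix (g : G) (m n : nat) (s : 'S_m) (t : 'S_n) : nat :=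
  #|[set T : gs_carrier F 'I_m 'I_n |
      `[< gs_mem T >] & gs_act g (gs_transport s t T) == T]|.

(* The part of Z^G_F(g) coming from m labels of the first sort and n labels of
   the second one, with px j and py j in place of p_j[x] and p_j[y]. *)
Definition cycle_index_part (A : comAlgType rat) (px py : nat -> A)
    (g : G) (m n : nat) : A :=
  ((m`! * n`!)%N%:R^-1 : rat) *:
  \sum_(s : 'S_m) \sum_(t : 'S_n)
    (gs_fix g s t)%:R * (\prod_(1 <= j < m.+1) px j ^+ ncycles s j)
                      * (\prod_(1 <= j < n.+1) py j ^+ ncycles t j).

Definition gs_ogf (g : G) : nat -> rat := fun N =>
  \sum_(mn \in [set: nat * nat]%classic)
    (cycle_index_part (fun j => 'X^j : {poly rat}) (fun=> 1) g mn.1 mn.2)`_N.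

End CycleIndex.

(* The value of gs_ogf F at some permutation of cycle type la; gs_ogf is a class
   function for the species considered below, so the choice is immaterial. *)
Definition gs_ogf_type (n : nat) (F : gspecies 'S_n) (la : {mset nat}) :
    nat -> rat :=
  if [pick s : 'S_n | cycle_type s == la] is Some s then gs_ogf F s
  else fun=> 0.

Definition is_tree (T : finType) (e : rel T) : Prop :=
  [/\ (0 < #|T|)%N, forall x y, connect e x y
    & forall c : seq T, ucycle e c -> (size c <= 2)%N].

(* The neighbor of x on the simple path from x to r (None if x = r). *)
Definition parent (T : finType) (e : rel T) (r x : T) : option T :=
  [pick y | `[< exists p : seq T,
     [/\ path e x (y :: p), uniq (x :: y :: p) & last y p = r] >]].

(* Edge set, and successor function of the cyclic order at each black vertex u,
   which fixes the white vertices not adjacent to u. *)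
Definition coding_data (U V : finType) : finType :=
  ({set U * V} * {ffun U -> {ffun V -> V}})%type.

Section CodingTrees.
Variables (k : nat) (U V : finType).
Implicit Types (T : coding_data U V) (u : U) (w : V).

Definition adj T : rel (U + V) := fun x y =>
  match x, y with
  | inl u, inr w | inr w, inl u => (u, w) \in T.1
  | _, _ => false
  end.

Definition succ_at T u : V -> V := T.2 u.

Definition is_coding_tree T : Prop :=
  [/\ is_tree (adj T),
      forall u, #|[set w | (u, w) \in T.1]| = k.+1,
      forall u w w', (u, w) \in T.1 ->
        fconnect (succ_at T u) w w' = ((u, w') \in T.1)
    & forall u w, (u, w) \notin T.1 -> succ_at T u w = w].

Definition relabel (s : {perm U}) (t : {perm V}) T : coding_data U V :=
  ([set (s e.1, t e.2) | e in T.1],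
   [ffun u => [ffun w => t (succ_at T ((s^-1)%g u) ((t^-1)%g w))]]).

(* Positions {1, ..., k+1} modulo k+1 are the elements of 'I_k.+1, position k+1
   being ord0.  The linearization of the cyclic order f with w0 in position k+1
   has iter a f w0 in position a. *)
Definition position (f : V -> V) w0 w : 'I_k.+1 := inord (findex f w0 w).

Lemma rho_subproof (s : 'S_k.+1) (i : 'I_k.+1) :
  injective (fun a : 'I_k.+1 => s (i + a) - s i).
Proof. by move=> a b /addIr /perm_inj /addrI. Qed.

Definition rho (i : 'I_k.+1) (s : 'S_k.+1) : 'S_k.+1 := perm (@rho_subproof s i).

(* Moving the vertex in position a to position s a for all a: the successor of
   the vertex formerly in position a is the one now in position s a + 1. *)
Definition reorder (f : V -> V) w0 (s : 'S_k.+1) : {ffun V -> V} :=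
  [ffun w => if fconnect f w0 w
             then iter ((s^-1)%g (ordS (s (position f w0 w)))) f w0
             else f w].

Definition white_above T (r : U + V) u : option V :=
  if parent (adj T) r (inl u) is Some (inr w) then Some w else None.

Definition black_above T (r : U + V) w : option U :=
  if parent (adj T) r (inr w) is Some (inl u) then Some u else None.

(* The permutation sigma_u, given the permutation s0 used at the black vertices
   with no other black vertex above them, and the white vertex [anchor u] put in
   position k+1 at each black u.  The fuel #|U| bounds the recursion depth. *)
Fixpoint spread_rec (fuel : nat) T (r : U + V) (anchor : U -> option V)
    (s0 : 'S_k.+1) u : 'S_k.+1 :=
  if fuel is fuel'.+1 then
    if white_above T r u is Some w then
      if black_above T r w is Some u' then
        if anchor u' is Some w' then
          rho (position (succ_at T u') w' w)
              (spread_rec fuel' T r anchor s0 u')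
        else s0
      else s0
    else s0
  else s0.

Definition spread := spread_rec #|U|.

Definition act_all T (r : U + V) (anchor : U -> option V) (s0 : 'S_k.+1) :
    coding_data U V :=
  (T.1, [ffun u => if anchor u is Some w
                   then reorder (succ_at T u) w (spread T r anchor s0 u)
                   else T.2 u]).

Definition Y_mem (Ty : coding_data U V * V) : Prop := is_coding_tree Ty.1.

Definition Y_transport (s : {perm U}) (t : {perm V})
    (Ty : coding_data U V * V) : coding_data U V * V :=
  (relabel s t Ty.1, t Ty.2).

(* 'S_k acts on {1, ..., k}, with i : 'I_k standing for i + 1, so that the
   embedding Delta is lift_perm ord0 ord0. *)
Definition Y_act (s : 'S_k) (Ty : coding_data U V * V) : coding_data U V * V :=
  let: (T, y) := Ty in
  (act_all T (inr y) (white_above T (inr y)) (lift_perm ord0 ord0 s), y).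

Definition XY_mem (Te : coding_data U V * (U * V)) : Prop :=
  is_coding_tree Te.1 /\ Te.2 \in Te.1.1.

Definition XY_transport (s : {perm U}) (t : {perm V})
    (Te : coding_data U V * (U * V)) : coding_data U V * (U * V) :=
  (relabel s t Te.1, (s Te.2.1, t Te.2.2)).

Definition XY_act (s : 'S_k.+1) (Te : coding_data U V * (U * V)) :
    coding_data U V * (U * V) :=
  let: (T, (v0, w0)) := Te in
  let anchor u := if u == v0 then Some w0 else white_above T (inl v0) u in
  (act_all T (inl v0) anchor s,
   (v0, iter ((s^-1)%g ord0) (succ_at T v0) w0)).

End CodingTrees.

Definition CT_Y (k : nat) : gspecies 'S_k :=
  @GSpecies 'S_k (fun U V => (coding_data U V * V)%type : finType)
    (@Y_mem k) Y_transport (@Y_act k).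

Definition CT_XY (k : nat) : gspecies 'S_k.+1 :=
  @GSpecies 'S_k.+1 (fun U V => (coding_data U V * (U * V))%type : finType)
    (@XY_mem k) XY_transport (@XY_act k).

(* Main.v *)
(* The proper (k+1)-colorings of a k-tree differ by a permutation of the colors,
   and each front misses exactly one color.  Coloring the fronts by their missing
   color, unlabeled k-trees with n hedra become the orbits of
   S_n * S_(kn+1) * S_(k+1) on the bipartite trees in which every black vertex
   (hedron) has exactly one neighbor (front) of each color.

   A rooted coding tree is a rooted colored tree too: the root white vertex gets
   color 0, and the colors increase along the cyclic order at each black vertex.
   The rule sigma_v' = rho_i(sigma_v) then says precisely that sigma acts by
   permuting the colors.  Hence every term of the right-hand side is, by
   Burnside, a sum over (s, t, g) of fixed colored trees with a fixed root; the
   requirement that a white root has color 0 is compensated by replacing S_(k+1)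
   by the stabilizer S_k of 0.  Since an automorphism of a tree which preserves
   the two sorts of vertices fixes one more vertex than edges, the
   three terms add up to the number of fixed unrooted colored trees. *)
Require Import Defs.
From mathcomp Require Import all_boot all_order all_algebra all_fingroup.
From mathcomp Require Import finmap multiset.
From mathcomp Require Import boolp.
From mathcomp Require Import zify ring.
Local Open Scope mset_scope.
Local Open Scope ring_scope.

Set Implicit Arguments.
Unset Strict Implicit.
Unset Printing Implicit Defensive.

Import GRing.Theory Num.Theory.

(** * Cycle types *)

(** A coding tree carries cyclic orders but no colors; its colors are determined up to a common
    shift modulo k+1, and the root fixes the shift. Two facts resolve the recursive rule: positions
    at a black vertex are differences of colors ([positionE]), and [rho i (rho j s)] is
    [rho (j + i) s]. So the indices telescope along the path to the root, and up to a rotation the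
    permutation used at a black vertex depends only on the color of its parent.

    An edge root {v, w} carries no more than the black root v, since w is the neighbor of v of color
    0. Hence [CT_XY] counts fixed black vertices, for every color permutation. If the permutation
    fixes color 0, a fixed v has a fixed w, and the same structures count fixed edges of color 0.
    This is how one species supplies both the first and the third sum.

    A k-tree is tied to its colored trees by a relation [codes], not a function: the names of hedra
    and fronts and the coloring are arbitrary, and changing them is exactly a recoloring. *)

Section CountingByCycleType.
Local Open Scope nat_scope.
Variable T : finType.
Implicit Types (s t : {perm T}) (A C : {set T}).

Definition stable s A := forall x, (s x \in A) = (x \in A).

Definition mult s A i := #|[set C in porbits s | (C \subset A) && (#|C| == i)]|.

(** The product runs over all sizes up to |T|; no orbit is empty, so the factor at i = 0 is 1. *)
Definition z_on s A := \prod_(i < #|T|.+1) (i ^ mult s A i * (mult s A i)`!).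

(** Equivariant injections from A to A', extended by the identity outside A so that each is a single
    finite function on T. Working relative to subsets lets an induction strip off one orbit at a
    time. *)
Definition eqv_maps s t A A' := [set h : {ffun T -> T} |
  [forall x, if x \in A then (h x \in A') && (h (s x) == t (h x)) else h x == x]
  && [forall x in A, forall y in A, (h x == h y) ==> (x == y)]].

Lemma eqv_mapsP s t A A' (h : {ffun T -> T}) :
  reflect [/\ {in A, forall x, h x \in A'}, {in A, forall x, h (s x) = t (h x)},
              {in [predC A], h =1 id} & {in A &, injective h}]
          (h \in eqv_maps s t A A').
Proof.
rewrite inE; apply: (iffP andP) => [[/forallP h1 /forall_inP h2]|[h1 h2 h3 h4]].
  split=> [x xA|x xA|x xA|x y xA yA hxy].
  - by move: (h1 x); rewrite xA => /andP[].
  - by move: (h1 x); rewrite xA => /andP[_ /eqP].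
  - by move: (h1 x); move: xA; rewrite inE => /negPf-> /eqP.
  by move: (h2 x xA) => /forall_inP /(_ y yA); rewrite hxy eqxx => /eqP.
split.
  apply/forallP=> x; case: ifPn => xA; first by rewrite h1 // h2 ?eqxx.
  by rewrite h3 ?inE.
apply/forall_inP => x xA; apply/forall_inP => y yA; apply/implyP => /eqP hxy.
by apply/eqP/h4.
Qed.

Lemma iter_stable s A n x : stable s A -> (iter n s x \in A) = (x \in A).
Proof. by move=> sA; elim: n => //= n IH; rewrite sA. Qed.

Lemma porbit_iterP s x y : reflect (exists n, y = iter n s x) (y \in porbit s x).
Proof.
by apply: (iffP (porbitP s x y)) => -[n ->]; exists n; rewrite ?permX // -permX.
Qed.

Lemma porbit_stable s x : stable s (porbit s x).
Proof.
by move=> y; rewrite -!eq_porbit_mem -(expg1 s) porbit_perm.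
Qed.

Lemma porbit_sub s A x : stable s A -> (porbit s x \subset A) = (x \in A).
Proof.
move=> sA; apply/subsetP/idP => [|xA y /porbit_iterP[n ->]].
  by apply; apply: porbit_id.
by rewrite iter_stable.
Qed.

Lemma stableD s A x : stable s A -> stable s (A :\: porbit s x).
Proof. by move=> sA y; rewrite !inE sA porbit_stable. Qed.

Lemma multP s A C : stable s A ->
  reflect (exists2 x, x \in A & C = porbit s x) ((C \in porbits s) && (C \subset A)).
Proof.
move=> sA; apply: (iffP andP) => [[/imsetP[x _ ->]]|[x xA ->]].
  by rewrite porbit_sub // => xA; exists x.
by rewrite porbit_sub // xA imset_f.
Qed.

Lemma trivIset_porbits s : trivIset (porbits s).
Proof.
apply/trivIsetP => C1 C2 /imsetP[x _ ->] /imsetP[y _ ->] nxy.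
rewrite -setI_eq0; apply/eqP/setP=> z; rewrite !inE.
apply/negP; rewrite -!eq_porbit_mem => /andP[/eqP zx /eqP zy].
by move: nxy; rewrite -zx -zy eqxx.
Qed.

Lemma card_porbit_eq s A i : stable s A ->
  #|[set x in A | #|porbit s x| == i]| = i * mult s A i.
Proof.
move=> sA; pose P := [set C in porbits s | (C \subset A) && (#|C| == i)].
pose D := [set x in A | #|porbit s x| == i].
have inP C : reflect (exists2 x, x \in D & C = porbit s x) (C \in P).
  rewrite inE andbA; apply: (iffP andP) => [[/(multP _ sA)[x xA ->] ci]|].
    by exists x; rewrite // inE xA.
  move=> [x]; rewrite inE => /andP[xA xi] ->; split=> //.
  by apply/(multP _ sA); exists x.
rewrite mulnC; apply: (@card_uniform_partition _ i P D).
  by move=> C /inP[x]; rewrite inE => /andP[_ /eqP <-] ->.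
apply/and3P; split.
- apply/eqP/setP=> x; apply/bigcupP/idP => [[C /inP[y yD ->]]|xD].
    move: yD; rewrite !inE -eq_porbit_mem => /andP[yA yi] /eqP xy.
    rewrite -(porbit_sub x sA) xy porbit_sub // yA.
    exact: yi.
  by exists (porbit s x); [apply/inP; exists x | apply: porbit_id].
- by apply: trivIsetS (trivIset_porbits s); apply/subsetP=> C; rewrite inE => /andP[].
apply/negP => /inP[x _ e0]; by have := porbit_id s x; rewrite -e0 inE.
Qed.

Lemma multD s A a i : stable s A -> a \in A ->
  mult s A i = (#|porbit s a| == i) + mult s (A :\: porbit s a) i.
Proof.
move=> sA aA; rewrite /mult.
set X := [set C in porbits s | (C \subset A) && _].
set Y := [set C in porbits s | (C \subset (A :\: porbit s a)) && _].
have -> : Y = X :\ porbit s a.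
  apply/setP=> C; rewrite !inE.
  case: (boolP (C \in porbits s)) => /=; last by rewrite andbF.
  move=> /imsetP[x _ ->]; rewrite !porbit_sub //; last exact: stableD.
  by rewrite inE -eq_porbit_mem -andbA.
rewrite (cardsD1 (porbit s a) X); congr (_ + _).
by rewrite inE imset_f //= porbit_sub // aA.
Qed.

(** With i the size of the orbit of a and m the multiplicity of i, this is i^m m! = (i m) (i^(m-1)
    (m-1)!). *)
Lemma z_onD s A a : stable s A -> a \in A ->
  z_on s A = #|porbit s a| * mult s A #|porbit s a| * z_on s (A :\: porbit s a).
Proof.
move=> sA aA; set i := #|porbit s a|.
have ilt : i < #|T|.+1 by rewrite ltnS max_card.
rewrite /z_on (bigD1 (Ordinal ilt)) //= [in RHS](bigD1 (Ordinal ilt)) //=.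
rewrite (multD i sA aA) eqxx add1n expnS factS -!mulnA.
congr (_ * _); rewrite mulnCA; do 3 congr (_ * _).
apply: eq_bigr => j; rewrite -val_eqE /= => ji.
by rewrite (multD j sA aA) eq_sym (negPf ji).
Qed.

Section Extension.
Variables (s t : {perm T}) (a b : T).
Hypothesis ab : #|porbit s a| = #|porbit t b|.
Let idx x := index x (traject s a #|porbit s a|).

Definition extend_map (h0 : {ffun T -> T}) : {ffun T -> T} :=
  [ffun x => if x \in porbit s a then iter (idx x) t b else h0 x].

Lemma iter_modn n (r : {perm T}) x : iter n r x = iter (n %% #|porbit r x|) r x.
Proof.
rewrite {1}(divn_eq n #|porbit r x|) addnC iterD; congr iter.
by elim: (n %/ _) => // q IH; rewrite mulSn addnC iterD iter_porbit.
Qed.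

Lemma iter_lt_inj (r : {perm T}) x i j : i < #|porbit r x| -> j < #|porbit r x| ->
  iter i r x = iter j r x -> i = j.
Proof.
move=> ilt jlt eij; have := uniq_traject_porbit r x => /uniqP u.
by apply: (u x); rewrite ?inE ?size_traject // !nth_traject.
Qed.

Lemma porbit_gt0 (r : {perm T}) x : 0 < #|porbit r x|.
Proof. by rewrite lt0n card_porbit_neq0. Qed.

Lemma extend_iter h0 n : extend_map h0 (iter n s a) = iter n t b.
Proof.
have nin : iter n s a \in porbit s a by apply/porbit_iterP; exists n.
rewrite ffunE nin (iter_modn n t b) -ab (iter_modn n s a).
set m := n %% _; have mlt : m < #|porbit s a| by rewrite ltn_pmod ?porbit_gt0.
rewrite /idx -(nth_traject s mlt a) index_uniq ?size_traject //.
exact: uniq_traject_porbit.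
Qed.

Lemma extend_out h0 x : x \notin porbit s a -> extend_map h0 x = h0 x.
Proof. by move=> /negPf xa; rewrite ffunE xa. Qed.

(** An equivariant map sending a to b is forced on the orbit of a, so only its restriction to the
    rest is free. [extend_map] restores the forced part, consistently because the two orbits have
    the same size. *)
Lemma card_eqv_fiber A A' : stable s A -> stable t A' -> a \in A -> b \in A' ->
  #|[set h in eqv_maps s t A A' | h a == b]|
    = #|eqv_maps s t (A :\: porbit s a) (A' :\: porbit t b)|.
Proof.
move=> sA tA' aA bA'.
pose phi (h : {ffun T -> T}) := [ffun x => if x \in porbit s a then x else h x].
set F := [set h in _ | _].
have hit h n : h \in F -> h (iter n s a) = iter n t b.
  rewrite inE => /andP[/eqv_mapsP[_ h2 _ _] /eqP hab].
  by elim: n => //= n IH; rewrite h2 ?IH ?iter_stable.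
have phi_inj : {in F &, injective phi}.
  move=> h h' hF h'F e; apply/ffunP=> x.
  have [/porbit_iterP[n ->]|/negPf xa] := boolP (x \in porbit s a); first by rewrite !hit.
  by have := congr1 (fun f : {ffun T -> T} => f x) e; rewrite !ffunE xa.
rewrite -(card_in_imset phi_inj); congr #|pred_of_set _|; apply/setP=> h0.
apply/imsetP/eqv_mapsP => [[h hF ->]|[h1 h2 h3 h4]].
  have hit' := hit h ^~ hF; move: hF; rewrite inE => /andP[/eqv_mapsP[h1 h2 h3 h4] _].
  split=> [x|x|x|x y].
  - rewrite inE => /andP[xa xA]; rewrite ffunE (negPf xa) inE h1 // andbT.
    apply/negP=> /porbit_iterP[n]; rewrite -hit' => /h4; rewrite iter_stable //.
    by move=> /(_ xA aA) xe; move/porbit_iterP: xa; apply; exists n.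
  - rewrite inE => /andP[xa xA].
    by rewrite !ffunE (porbit_stable s a) (negPf xa) h2.
  - rewrite !inE negb_and negbK ffunE; case: ifP => //= _ xA; exact: h3.
  rewrite !inE => /andP[/negPf xa xA] /andP[/negPf ya yA].
  by rewrite !ffunE xa ya; apply: h4.
have ext_in x : x \in A -> x \notin porbit s a ->
    (extend_map h0 x \in A') /\ extend_map h0 x \notin porbit t b.
  move=> xA xa; rewrite extend_out //; have := h1 x; rewrite !inE xa xA => /(_ isT).
  by case/andP.
exists (extend_map h0).
  rewrite inE (extend_iter h0 0) /= eqxx andbT; apply/eqv_mapsP; split.
  - move=> x xA; have [/porbit_iterP[n ->]|xa] := boolP (x \in porbit s a).
      by rewrite extend_iter iter_stable.
    by case: (ext_in x xA xa).
  - move=> x xA; have [/porbit_iterP[n ->]|xa] := boolP (x \in porbit s a).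
      by rewrite -iterS !extend_iter.
    by rewrite !extend_out ?porbit_stable // h2 // inE xa.
  - move=> x; rewrite inE => xA; rewrite extend_out; last first.
      by apply: contra xA => xa; move: aA; rewrite -(porbit_sub a sA) => /subsetP; apply.
    by rewrite h3 // !inE negb_and xA orbT.
  move=> x y xA yA.
  have [/porbit_iterP[n xn]|xa] := boolP (x \in porbit s a);
    have [/porbit_iterP[m ym]|ya] := boolP (y \in porbit s a).
  - rewrite xn ym !extend_iter (iter_modn n t b) (iter_modn m t b).
    rewrite (iter_modn n s a) (iter_modn m s a) -ab.
    by move=> e; rewrite (iter_lt_inj _ _ e) // -ab ltn_pmod ?porbit_gt0.
  - move=> e; case: (ext_in y yA ya) => _; rewrite -e xn extend_iter => /negP[].
    by apply/porbit_iterP; exists n.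
  - move=> e; case: (ext_in x xA xa) => _; rewrite e ym extend_iter => /negP[].
    by apply/porbit_iterP; exists m.
  by rewrite !extend_out //; apply: h4; rewrite inE ?xa ?ya.
apply/ffunP=> x; rewrite !ffunE; case: ifP => // xa.
  by rewrite h3 // !inE xa.
by rewrite xa.
Qed.

End Extension.

Lemma eqv_card_porbit s t A A' (h : {ffun T -> T}) a : stable s A -> h \in eqv_maps s t A A' ->
  a \in A -> #|porbit t (h a)| = #|porbit s a|.
Proof.
move=> sA /eqv_mapsP[h1 h2 h3 h4] aA.
have hit n : h (iter n s a) = iter n t (h a).
  by elim: n => //= n IH; rewrite h2 ?IH ?iter_stable.
have sub x : x \in porbit s a -> x \in A.
  by move=> /porbit_iterP[n ->]; rewrite iter_stable.
rewrite -(@card_in_imset _ _ h (mem (porbit s a))); last first.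
  by move=> x y /sub xA /sub yA; apply: h4.
apply: eq_card => y; apply/porbit_iterP/imsetP => [[n ->]|[x /porbit_iterP[n ->] ->]].
  by exists (iter n s a); rewrite ?hit //; apply/porbit_iterP; exists n.
by exists n; rewrite hit.
Qed.

(** A point a in an orbit of size i can go to any point of A' in an orbit of size i, and the rest is
    counted by induction; [z_onD] is the same recursion. *)
Lemma card_eqv_maps s t A A' : stable s A -> stable t A' ->
  (forall i, mult s A i = mult t A' i) -> #|eqv_maps s t A A'| = z_on s A.
Proof.
move: {2}#|A| (leqnn #|A|) => n; elim: n A A' => [|n IH] A A'.
  rewrite leqn0 cards_eq0 => /eqP -> s0 sA' em.
  have m0 r : mult r set0 =1 fun=> 0.
    move=> i; apply: eq_card0 => C; rewrite !inE subset0.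
    by apply/negP => /and3P[/imsetP[x _ ->] /eqP/setP/(_ x)]; rewrite porbit_id inE.
  have A'0 : A' = set0.
    apply/setP=> x; rewrite [RHS]inE; apply/negP => xA'.
    have := multD #|porbit t x| sA' xA'.
    by rewrite -em m0 eqxx.
  rewrite /z_on big1; last by move=> i _; rewrite m0.
  rewrite (_ : eqv_maps _ _ _ _ = [set [ffun x => x]]) ?cards1 //.
  apply/setP=> h; rewrite [RHS]inE; apply/eqv_mapsP/eqP => [[_ _ h3 _]|->].
    by apply/ffunP=> x; rewrite ffunE h3 ?inE.
  by rewrite A'0; split=> [x|x|x|x y]; rewrite ?inE // ffunE.
move=> cA sA tA' em; have [A0|[a aA]] := set_0Vmem A.
  by apply: IH => //; rewrite A0 cards0.
set i := #|porbit s a|.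
rewrite (z_onD sA aA) -/i em -card_porbit_eq // -sum_nat_const.
transitivity (\sum_(b in [set x in A' | #|porbit t x| == i])
   #|[set h in eqv_maps s t A A' | h a == b]|).
  rewrite -sum1_card (partition_big (fun h : {ffun T -> T} => h a)
    (mem [set x in A' | #|porbit t x| == i])) /=; last first.
    move=> h hm; rewrite inE (eqv_card_porbit sA hm aA) eqxx andbT.
    by case/eqv_mapsP: hm => ->.
  by apply: eq_bigr => b _; rewrite -sum1_card; apply: eq_bigl => h; rewrite inE.
apply: eq_bigr => b; rewrite inE => /andP[bA' /eqP bi].
rewrite card_eqv_fiber //; apply: IH; try exact: stableD.
  rewrite -ltnS; apply: leq_trans cA; apply: proper_card.
  rewrite properE subsetDl; apply/subsetPn; exists a => //.
  by rewrite inE porbit_id.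
move=> j; have := em j; rewrite (multD j sA aA) (multD j tA' bA') bi -/i.
exact: addnI.
Qed.

End CountingByCycleType.

(** * Conjugacy classes of permutations and the number z *)

Section CycleTypeClasses.
Local Open Scope nat_scope.
Implicit Types (n : nat).

Lemma stableT (T : finType) (s : {perm T}) : stable s setT.
Proof. by move=> x; rewrite !inE. Qed.

Lemma mult0 (T : finType) (s : {perm T}) A : mult s A 0 = 0.
Proof.
apply: eq_card0 => C; rewrite !inE cards_eq0.
by apply/negP => /and3P[/imsetP[x _ ->] _ /eqP/setP/(_ x)]; rewrite porbit_id inE.
Qed.

Lemma cycle_typeE n (s : 'S_n) i : cycle_type s i = mult s setT i.
Proof.
rewrite /cycle_type mset_seqE count_map -size_filter /mult cardE.
rewrite -filter_predI; congr size; apply: eq_filter => C.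
by rewrite !inE subsetT andbC.
Qed.

Lemma cycle_type_card n (s : 'S_n) i :
  i * cycle_type s i = #|[set x | #|porbit s x| == i]|.
Proof.
rewrite cycle_typeE -card_porbit_eq; last exact: stableT.
by apply: eq_card => x; rewrite !inE.
Qed.

Lemma cycle_type0 n (s : 'S_n) : cycle_type s 0 = 0.
Proof. by rewrite cycle_typeE mult0. Qed.

(** Counting points instead of orbits lets bijections of points compare cycle types; size 0 is
    treated apart because the multiplicity is recovered by dividing by i. *)
Lemma eq_cycle_type n m (s : 'S_n) (t : 'S_m) :
  (forall i, #|[set x | #|porbit s x| == i]| = #|[set x | #|porbit t x| == i]|) ->
  cycle_type s = cycle_type t.
Proof.
move=> st; apply/msetP => -[|i]; first by rewrite !cycle_type0.
by apply/eqP; rewrite -(@eqn_pmul2l i.+1) // !cycle_type_card st.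
Qed.

(** This turns the count of conjugators into an instance of [card_eqv_maps]. *)
Lemma conj_eqv n (s t p : 'S_n) :
  ((s ^ p)%g == t) = (finfun p \in eqv_maps s t setT setT).
Proof.
apply/eqP/eqv_mapsP => [<-|[_ h2 _ _]].
  split=> [x|x _|x|x y _ _]; rewrite ?inE // !ffunE ?permJ //; exact: perm_inj.
apply/permP=> x; rewrite -[x](permKV p) permJ.
by have := h2 (p^-1%g x) (in_setT _); rewrite !ffunE.
Qed.

Lemma card_porbitJ n (s p : 'S_n) x : #|porbit (s ^ p)%g (p x)| = #|porbit s x|.
Proof.
have /eqv_card_porbit := etrans (esym (conj_eqv s (s ^ p)%g p)) (eqxx _).
by move=> /(_ x (@stableT _ s) (in_setT _)); rewrite ffunE.
Qed.

Lemma cycle_typeJ n (s p : 'S_n) : cycle_type (s ^ p)%g = cycle_type s.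
Proof.
apply: eq_cycle_type => i; rewrite -[RHS](card_imset _ (@perm_inj _ p)).
apply: eq_card => x; rewrite inE; apply/idP/imsetP => [xi|[y]].
  by exists (p^-1%g x); rewrite ?permKV // inE -(card_porbitJ s p) permKV.
by rewrite inE -(card_porbitJ s p) => yi ->.
Qed.

Lemma cycle_type_partition n (s : 'S_n) : is_partition n (cycle_type s).
Proof.
split; first by rewrite -mset_eq0 cycle_type0.
rewrite (perm_big _ (perm_eq_seq_mset _)) /= big_map big_enum /=.
have pP : partition (porbits s) setT.
  apply/and3P; split.
  - apply/eqP/setP=> x; rewrite inE; apply/bigcupP.
    by exists (porbit s x); rewrite ?imset_f // porbit_id.
  - exact: trivIset_porbits.
  by apply/negP => /imsetP[x _ e0]; have := porbit_id s x; rewrite -e0 inE.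
by rewrite -(card_partition pP) cardsT card_ord.
Qed.

Lemma z_partE n (s : 'S_n) : z_part (cycle_type s) = z_on s setT.
Proof.
rewrite /z_part /z_on; under eq_bigr do rewrite cycle_typeE.
rewrite -(big_mkord xpredT (fun i => i ^ mult s setT i * (mult s setT i)`!)).
rewrite (bigID (fun i => mult s setT i == 0)) /= [RHS](bigID (fun i => mult s setT i == 0)) /=.
rewrite big1 ?mul1n => [|i /eqP ->//]; rewrite [X in _ = X * _]big1 ?mul1n => [|i /eqP ->//].
rewrite -big_filter -[RHS]big_filter; apply: perm_big.
apply: uniq_perm; rewrite ?filter_uniq ?iota_uniq ?fset_uniq // => i.
rewrite !mem_filter; case: eqP => //= /eqP m0.
rewrite mem_index_iota /= msuppE -mset_neq0 cycle_typeE m0.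
have : 0 < mult s setT i by rewrite lt0n.
by rewrite ltnS => /card_gt0P[C]; rewrite inE => /and3P[_ _ /eqP <-]; rewrite max_card.
Qed.

Lemma card_conj n (s t : 'S_n) : cycle_type s = cycle_type t ->
  #|[set p : 'S_n | (s ^ p)%g == t]| = z_part (cycle_type s).
Proof.
move=> st; rewrite z_partE -(@card_eqv_maps _ s t setT setT) //; first last.
- by move=> i; rewrite -!cycle_typeE st.
- exact: stableT.
- exact: stableT.
pose F (p : 'S_n) := finfun p.
have F_inj : injective F.
  by move=> p q /ffunP e; apply/permP=> x; have := e x; rewrite !ffunE.
rewrite -(card_imset _ F_inj); apply: eq_card => h; apply/imsetP/idP => [[p]|].
  by rewrite inE conj_eqv => ? ->.
move=> hm; have /eqv_mapsP[_ _ _ h4] := hm.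
have hi : injective h by move=> x y; apply: h4; rewrite inE.
have Fh : F (perm hi) = h by apply/ffunP=> x; rewrite ffunE permE.
by exists (perm hi); rewrite // inE conj_eqv -/(F _) Fh.
Qed.

Lemma z_part_gt0 n (s : 'S_n) : 0 < z_part (cycle_type s).
Proof.
rewrite -(@card_conj _ s s) //; apply/card_gt0P; exists 1%g.
by rewrite inE conjg1.
Qed.

Lemma cycle_type_conj n (s t : 'S_n) : cycle_type s = cycle_type t ->
  exists p, t = (s ^ p)%g.
Proof.
move=> st; have := z_part_gt0 s; rewrite -(card_conj st) => /card_gt0P[p].
by rewrite inE => /eqP <-; exists p.
Qed.

(** The map p to s ^ p splits the n! permutations into fibers of size z over the class of s. *)
Lemma card_cycle_type n (s : 'S_n) :
  #|[set t : 'S_n | cycle_type t == cycle_type s]| * z_part (cycle_type s) = n`!.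
Proof.
rewrite -card_Sn -sum_nat_const -[RHS]sum1_card.
rewrite [RHS](partition_big (fun p => (s ^ p)%g)
  (mem [set t : 'S_n | cycle_type t == cycle_type s])) /=; last first.
  by move=> p _; rewrite inE cycle_typeJ.
apply: eq_bigr => t; rewrite inE => /eqP st.
by rewrite -(card_conj (esym st)) sum1_card; apply: eq_card => p; rewrite !inE.
Qed.

Lemma iter_lift_perm n (s : 'S_n) x m :
  iter m (lift_perm ord0 ord0 s) (lift ord0 x) = lift ord0 (iter m s x).
Proof. by elim: m => //= m ->; rewrite lift_perm_lift. Qed.

Lemma card_porbit_lift n (s : 'S_n) x :
  #|porbit (lift_perm ord0 ord0 s) (lift ord0 x)| = #|porbit s x|.
Proof.
rewrite -[RHS](card_imset _ (@lift_inj _ ord0)); apply: eq_card => y.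
apply/porbit_iterP/imsetP => [[m ->]|[z /porbit_iterP[m ->] ->]].
  by exists (iter m s x); rewrite ?iter_lift_perm //; apply/porbit_iterP; exists m.
by exists m; rewrite iter_lift_perm.
Qed.

Lemma card_porbit_fixed n (s : 'S_n) x : s x = x -> #|porbit s x| = 1.
Proof.
move=> sx; rewrite -(cards1 x); apply: eq_card => y; rewrite inE.
apply/porbit_iterP/eqP => [[m ->]|->]; last by exists 0.
by elim: m => //= m ->.
Qed.

Lemma cycle_type_lift n (s : 'S_n) :
  cycle_type (lift_perm ord0 ord0 s) = (cycle_type s `+` [mset 1])%mset.
Proof.
apply/msetP => -[|i]; first by rewrite cycle_type0 msetE2 cycle_type0 msetnE.
rewrite msetE2 msetnE; apply/eqP; rewrite -(@eqn_pmul2l i.+1) // mulnDr.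
rewrite !cycle_type_card (cardsD1 ord0) addnC inE card_porbit_fixed ?lift_perm_id //.
apply/eqP; congr (_ + _); last by case: i => [|i] /=; rewrite ?muln0.
rewrite -[RHS](card_imset _ (@lift_inj _ ord0)); apply: eq_card => y; rewrite !inE.
apply/andP/imsetP => [[]|[x]]; last first.
  by rewrite inE => xi ->; rewrite card_porbit_lift eq_sym neq_lift.
by case: (unliftP ord0 y) => [x ->|->] //= _; rewrite card_porbit_lift => xi; exists x; rewrite // inE.
Qed.

Lemma lift_permP n (s : 'S_n.+1) : s ord0 = ord0 -> exists t, s = lift_perm ord0 ord0 t.
Proof.
move=> s0; have sl i : exists j, s (lift ord0 i) = lift ord0 j.
  case: (unliftP ord0 (s (lift ord0 i))) => [j ->|]; first by exists j.
  by rewrite -[RHS]s0 => /perm_inj e; have := neq_lift ord0 i; rewrite e eqxx.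
have [f fP] := boolp.choice sl.
have fi : injective f.
  by move=> i j e; apply/(@lift_inj _ ord0)/(@perm_inj _ s); rewrite !fP e.
exists (perm fi); apply/permP=> i; case: (unliftP ord0 i) => [j ->|->].
  by rewrite lift_perm_lift permE fP.
by rewrite lift_perm_id.
Qed.

Lemma lift_perm_inj n : injective (@lift_perm n ord0 ord0).
Proof.
move=> s t e; apply/permP=> i; apply: (@lift_inj _ ord0).
by rewrite -!(lift_perm_lift ord0 ord0) e.
Qed.

(** The part 1 provides a fixed point, and conjugating it to [ord0] lands in the image of S_n.
    Needed in the third sum, where a multiset that is no cycle type must remain so after a part 1 is
    added. *)
Lemma cycle_type_lift_inv n (s : 'S_n.+1) la :
  cycle_type s = (la `+` [mset 1])%mset -> exists t : 'S_n, cycle_type t = la.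
Proof.
move=> sla; have : 0 < cycle_type s 1 by rewrite sla msetE2 msetnxx addn1.
rewrite -[X in _ < X]mul1n cycle_type_card => /card_gt0P[x]; rewrite inE => x1.
have sx : s x = x.
  have /cards1P[y /setP yE] := x1.
  have := porbit_stable s x x; rewrite porbit_id yE !inE => /eqP ->.
  by have := yE x; rewrite porbit_id !inE => /esym/eqP.
pose p := tperm x ord0.
have /lift_permP[t st] : (s ^ p)%g ord0 = ord0.
  by rewrite -{1}(tpermL x ord0) permJ sx tpermL.
exists t; have := cycle_type_lift t; rewrite -st cycle_typeJ sla.
by move=> /(congr1 (fun A => A `\` [mset 1])%mset); rewrite !msetDKBC.
Qed.

End CycleTypeClasses.

(** * Trees *)

Section Acyclic.
Local Open Scope nat_scope.
Variables (T : finType) (e : rel T).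
Hypothesis e_sym : symmetric e.

Definition within (P : pred T) : rel T := fun x y => [&& P x, P y & e x y].
Arguments within P x y /.

Definition cut (a b : T) : rel T := fun x y =>
  e x y && ~~ ((x == a) && (y == b) || (x == b) && (y == a)).
Arguments cut a b x y /.

Lemma within_sym P : symmetric (within P).
Proof. by move=> x y /=; rewrite e_sym andbCA. Qed.

Lemma cut_sym a b : symmetric (cut a b).
Proof.
move=> x y /=; rewrite e_sym; congr (_ && ~~ _).
by rewrite orbC [X in X || _]andbC [X in _ || X]andbC.
Qed.

Lemma cutC a b : cut a b =2 cut b a.
Proof. by move=> x y /=; rewrite orbC. Qed.

Lemma within_path (P : pred T) x p :
  path (within P) x p -> all P p && path e x p.
Proof. by elim: p x => //= y p IH x /andP[/and3P[_ -> ->] /IH]. Qed.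

Lemma sub_within (P Q : pred T) : subpred P Q ->
  subrel (connect (within P)) (connect (within Q)).
Proof.
move=> PQ; apply: connect_sub => x y /and3P[Px Py exy].
by apply: connect1; rewrite /= !PQ.
Qed.

Lemma connect_simple (r : rel T) x y : connect r x y ->
  exists p, [/\ path r x p, uniq (x :: p) & last x p = y].
Proof. by case/connectP=> p /shortenP[q rq uq _] ->; exists q. Qed.

Lemma simple_off x z p : path e z p -> uniq (x :: z :: p) ->
  connect (within (predC1 x)) z (last z p).
Proof.
elim: p z => [|y p IH] z //= /andP[ezy py] /andP[].
rewrite !inE !negb_or => /and3P[xz xy xp] /and3P[_ yp up].
apply: (connect_trans (y := y)).
  by apply: connect1; rewrite /= eq_sym xz eq_sym xy.
by apply: IH; rewrite //= inE negb_or xy xp yp.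
Qed.

Hypothesis acyclic : forall c : seq T, ucycle e c -> size c <= 2.

(** A simple path off x between distinct a and b, closed up through x, would be a cycle of length at
    least 3. *)
Lemma acyclic_off x a b : a != x -> e x a -> e x b ->
  connect (within (predC1 x)) a b -> a = b.
Proof.
move=> ax exa exb /connect_simple[p [pp up lp]].
have /andP[px pe] := within_path pp.
case: p pp up lp px pe => [|y p] pp up lp px pe; first by [].
have := acyclic (c := x :: a :: y :: p).
have xp : x \notin y :: p by apply/negP => /(allP px); rewrite /= eqxx.
rewrite /ucycle /path.cycle rcons_path (_ : last x _ = b) // e_sym exb.
rewrite [path _ _ _]/= exa -/(path e a (y :: p)) pe.
by rewrite cons_uniq inE negb_or eq_sym ax xp up => /(_ isT).
Qed.

(** Connectivity within a set that misses x is easier to supply than the simple path in the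
    definition of [parent]; uniqueness is [acyclic_off]. *)
Lemma parentP r x y : y != x -> e x y -> connect (within (predC1 x)) y r ->
  parent e r x = Some y.
Proof.
move=> yx exy yr; rewrite /parent; case: pickP => [z|/(_ y)] /asboolP.
  move=> [p [/= /andP[exz pz] uz lz]]; congr Some.
  have zx : z != x by case/andP: uz; rewrite inE negb_or eq_sym => /andP[].
  apply: (acyclic_off zx exz exy); rewrite -lz in yr.
  apply: (connect_trans (simple_off pz uz)).
  by rewrite (sym_connect_sym (within_sym _)).
case; have [p [pp up lp]] := connect_simple yr.
have /andP[px pe] := within_path pp.
exists p; split=> //=; first by rewrite exy.
rewrite -/(uniq (y :: p)) up andbT inE negb_or eq_sym yx /=.
by apply/negP => /(allP px); rewrite /= eqxx.
Qed.

Lemma parent_root r : parent e r r = None.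
Proof.
rewrite /parent; case: pickP => // z /asboolP[p [_ u l]].
by move: u; rewrite cons_uniq -{1}l mem_last.
Qed.

Lemma acyclic_cut x z : x != z -> e x z -> ~~ connect (cut x z) x z.
Proof.
move=> xz exz; apply/negP => /connect_simple[p [pp up lp]].
case: p pp up lp => [|a [|b p]] pp up lp.
- by rewrite /= in lp; rewrite lp eqxx in xz.
- by move: pp; rewrite /= in lp; rewrite /= lp !eqxx /= andbF.
have := acyclic (c := [:: x, a, b & p]).
have pe : path e x [:: a, b & p] by apply: sub_path pp => u v /andP[].
by rewrite /ucycle /path.cycle rcons_path pe lp e_sym exz up => /(_ isT).
Qed.

Hypothesis conn : forall x y, connect e x y.

(** Walking from a shows that every vertex stays reachable from one end of the removed edge; by
    [acyclic_cut] it is never reachable from both. *)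
Lemma cut_side a b c : a != b -> e a b ->
  connect (cut a b) a c = ~~ connect (cut a b) b c.
Proof.
move=> nab eab; have csym := sym_connect_sym (cut_sym a b).
have some : connect (cut a b) a c || connect (cut a b) b c.
  have /connectP[p pp ->] := conn a c.
  elim/last_ind: p pp => [|p y IH] /=; first by rewrite connect0.
  rewrite rcons_path last_rcons => /andP[/IH{}IH ey].
  have [/orP[/andP[_ /eqP ->]|/andP[_ /eqP ->]]|nc] :=
    boolP ((last a p == a) && (y == b) || (last a p == b) && (y == a)).
  - by rewrite connect0 orbT.
  - by rewrite connect0.
  have c1 : connect (cut a b) (last a p) y by apply: connect1; rewrite /= ey nc.
  by case/orP: IH => /connect_trans /(_ c1) ->; rewrite ?orbT.
case: (boolP (connect (cut a b) b c)) some => [bc _|_]; last by rewrite orbF.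
apply/negP => ac; have := acyclic_cut nab eab; rewrite (connect_trans ac) //.
by rewrite csym.
Qed.

Hypothesis irr : forall x y, e x y -> x != y.

Lemma off_cut x z : subrel (connect (within (predC1 x))) (connect (cut x z)).
Proof.
apply: connect_sub => a b /and3P[/= ax bx eab]; apply: connect1.
by rewrite /= eab (negPf ax) (negPf bx) andbF.
Qed.

(** The neighbor z is the first step of the simple path from x to y. The rest of this path avoids x,
    so it survives the removal of any edge at x. *)
Lemma crossing_neighbor x y : x != y ->
  exists2 z, e x z & forall z', e x z' -> connect (cut x z') x y = (z' != z).
Proof.
move=> xy; have [p [pp up lp]] := connect_simple (conn x y).
case: p pp up lp => [|z p] pp up lp; first by rewrite /= in lp; rewrite lp eqxx in xy.
move: pp => /= /andP[exz pz]; exists z => // z' exz'.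
have off := simple_off pz up; rewrite /= in lp; rewrite lp in off.
have zy : connect (cut x z') z y by apply: off_cut off.
have [zz'|nz] := eqVneq z' z.
  rewrite zz' in zy *; apply/negbTE; apply: contra (acyclic_cut (irr exz) exz) => xy'.
  by rewrite (connect_trans xy') // (sym_connect_sym (cut_sym _ _)).
apply: connect_trans zy; apply: connect1.
by rewrite /= exz eqxx /= eq_sym (negPf nz) [z == x]eq_sym (negPf (irr exz)) andbF.
Qed.

End Acyclic.
Arguments within {T} e P x y /.
Arguments cut {T} e a b x y /.

(** The relation [adj] as a function of the edge set alone, so that coding trees and colored trees
    share one theory. *)
Definition tadj (U V : finType) (E : {set U * V}) : rel (U + V) := fun x y =>
  match x, y with
  | inl u, inr w | inr w, inl u => (u, w) \in E
  | _, _ => false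
  end.

Definition nbrs (U V : finType) (E : {set U * V}) u := [set w | (u, w) \in E].

Section BipartiteTrees.
Local Open Scope nat_scope.
Variables (U V : finType) (E : {set U * V}).
Implicit Types (u : U) (w : V) (B : {set U}) (W : {set V}).
Notation e := (tadj E).

Lemma tadj_sym : symmetric e. Proof. by move=> [u|w] [u'|w']. Qed.

Lemma tadj_neq x y : e x y -> x != y. Proof. by case: x y => [u|w] [u'|w']. Qed.

Definition nodes B W : pred (U + V) := fun x =>
  match x with inl u => u \in B | inr w => w \in W end.

(* A connected subtree which contains all the neighbors of its black vertices. *)
Definition subtree B W : Prop :=
  (forall u w, u \in B -> (u, w) \in E -> w \in W) /\
  (forall x y, nodes B W x -> nodes B W y -> connect (within e (nodes B W)) x y).

Lemma subtree_white w : subtree set0 [set w].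
Proof.
split=> [u w'|]; first by rewrite !inE.
by move=> [u|w1] [u'|w2] /=; rewrite ?inE // => /eqP-> /eqP->.
Qed.

Lemma subtree_black u : subtree [set u] (nbrs E u).
Proof.
split=> [u' w|]; first by rewrite !inE => /eqP->.
set r := within _ _; have rsym := sym_connect_sym (within_sym tadj_sym (nodes [set u] (nbrs E u))).
have c0 x : nodes [set u] (nbrs E u) x -> connect r (inl u) x.
  case: x => [u'|w] /=; rewrite inE; first by move=> /eqP->.
  by move=> uw; apply: connect1; rewrite /r /= !inE eqxx uw.
by move=> x y /c0 xu /c0 uy; apply: connect_trans uy; rewrite rsym.
Qed.

Hypothesis tree : is_tree e.
Let acyclic : forall c : seq (U + V), ucycle e c -> size c <= 2.
Proof. by case: tree. Qed.
Let conn : forall x y, connect e x y. Proof. by case: tree. Qed.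

Lemma subtreeU B W u w : subtree B W -> w \in W -> (u, w) \in E ->
  subtree (u |: B) (W :|: nbrs E u).
Proof.
move=> [cl co] wW uw; split=> [u' w'|].
  by rewrite !inE => /orP[/eqP -> ->|/cl h /h ->]; rewrite ?orbT.
set N := nodes _ _; have rsym := sym_connect_sym (within_sym tadj_sym N).
have sub : subpred (nodes B W) N by case=> [u'|w'] /=; rewrite !inE => ->; rewrite ?orbT.
have cu : connect (within e N) (inr w) (inl u).
  by apply: connect1; rewrite /= !inE wW eqxx uw.
have c0 x : N x -> connect (within e N) (inr w) x.
  have old y : nodes B W y -> connect (within e N) (inr w) y.
    by move=> ny; apply: (sub_within sub); apply: co.
  case: x => [u'|w'] /=; rewrite !inE => /orP[].
  - by move=> /eqP->.
  - by move=> u'B; apply: old.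
  - by move=> w'W; apply: old.
  move=> uw'; apply: (connect_trans cu); apply: connect1.
  by rewrite /= !inE eqxx uw' orbT.
by move=> x y /c0 xu /c0 uy; apply: connect_trans uy; rewrite rsym.
Qed.

(** Two points of attachment would be joined inside the subtree, hence off u, and [acyclic_off]
    identifies them. *)
Lemma subtree_attach B W u w w' : subtree B W -> u \notin B ->
  w \in W -> (u, w) \in E -> w' \in W -> (u, w') \in E -> w' = w.
Proof.
move=> [_ co] uB wW uw w'W uw'.
have off : connect (within e (predC1 (inl u))) (inr w') (inr w).
  apply: (@sub_within _ _ (nodes B W)); last exact: co.
  by case=> [u'|w''] //= u'B; apply: contraNneq uB => -[<-].
by have [] := @acyclic_off _ _ tadj_sym acyclic (inl u) (inr w') (inr w) isT uw' uw off.
Qed.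

(** The induction principle for trees: a subtree grows by one black vertex together with all its
    neighbors, of which exactly one is old. The measure is the number of black vertices still
    missing. *)
Lemma tree_growth (P : {set U} -> {set V} -> Prop) B0 W0 w0 :
  w0 \in W0 -> subtree B0 W0 -> P B0 W0 ->
  (forall B W u w, subtree B W -> P B W -> u \notin B -> w \in W ->
     (u, w) \in E -> (forall w', w' \in W -> (u, w') \in E -> w' = w) ->
     P (u |: B) (W :|: nbrs E u)) ->
  P setT setT.
Proof.
move=> w0W S0 P0 step.
(* If no edge leaves the subtree from a white vertex, none leaves it at all, since it contains the
   neighbors of its black vertices; connectivity makes it the whole tree. *)
have full B W : w0 \in W -> subtree B W ->
    ~~ [exists ew, [&& ew \in E, ew.1 \notin B & ew.2 \in W]] -> B = setT /\ W = setT.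
  move=> wW S closed; suff all x : nodes B W x.
    split; apply/setP => v; rewrite inE; first exact: (all (inl v)).
    exact: (all (inr v)).
  have /connectP[p pp ->] := conn (inr w0) x.
  elim/last_ind: p pp => [|p y IH] //=; rewrite rcons_path last_rcons => /andP[/IH{}IH].
  case: (last _ _) IH y => [u|w] /= IHn [u'|w'] //= ue; first by case: S => cl _; apply: cl ue.
  apply: contraNT closed => u'B; apply/existsP; exists (u', w).
  by rewrite /= ue u'B.
move: {2}#|~: B0| (leqnn #|~: B0|) => n; elim: n B0 W0 w0W S0 P0 => [|n IH] B W wW S PB.
all: have [/existsP[[u w] /= /and3P[uw uB wW']]|/(full _ _ wW S)[<- <-] //] :=
  boolP [exists ew, [&& ew \in E, ew.1 \notin B & ew.2 \in W]].
  by rewrite leqn0 cards_eq0 => /eqP/setP/(_ u); rewrite !inE uB.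
move=> cB; apply: (IH (u |: B) (W :|: nbrs E u)).
- by rewrite inE wW.
- exact: subtreeU S wW' uw.
- apply: (step _ _ _ w) => // w' w'W uw'; exact: (subtree_attach S uB wW' uw w'W uw').
rewrite setCU -ltnS; apply: leq_trans cB; apply: proper_card.
rewrite properE subsetIr; apply/subsetPn; exists u; rewrite !inE ?uB //.
by rewrite eqxx.
Qed.

End BipartiteTrees.

(** * Fixed vertices and edges of a tree automorphism *)

Section FixedPoints.
Local Open Scope nat_scope.
Variables (U V : finType) (E : {set U * V}).
Hypothesis tree : is_tree (tadj E).

(** A growth step at a black vertex of degree d adds one black vertex, d - 1 white vertices and d
    edges. *)
Lemma tree_euler (w0 : V) : #|U| + #|V| = #|E|.+1.
Proof.
pose P (B : {set U}) (W : {set V}) := #|B| + #|W| = #|[set ew in E | ew.1 \in B]|.+1.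
have : P setT setT.
  apply: (tree_growth tree (w0 := w0) (B0 := set0) (W0 := [set w0])).
  - by rewrite inE.
  - exact: subtree_white.
  - rewrite /P cards0 cards1 (_ : [set _ in E | _] = set0) ?cards0 //.
    by apply/setP=> ew; rewrite !inE andbF.
  move=> B W u w S PB uB wW uw uniqw; rewrite /P.
  have -> : [set ew in E | ew.1 \in u |: B]
      = [set (u, w') | w' in nbrs E u] :|: [set ew in E | ew.1 \in B].
    apply/setP=> -[u' w']; rewrite !inE /= andb_orr; congr orb.
    apply/andP/imsetP => [[ue /eqP u'u]|[w'' ]].
      by exists w'; rewrite ?inE -?u'u ?ue.
    by rewrite inE => ue [-> ->].
  rewrite !cardsU (_ : [set (u, w') | w' in nbrs E u] :&: [set ew in E | ew.1 \in B] = set0);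
    last first.
    apply/setP=> -[u' w']; rewrite !inE; apply/negbTE/negP => /andP[/imsetP[w'' _ [-> _]]].
    by rewrite (negPf uB) andbF.
  rewrite (_ : W :&: nbrs E u = [set w]); last first.
    apply/setP=> w'; rewrite !inE; apply/andP/eqP => [[w'W uw']|-> //].
    exact: uniqw.
  rewrite cards0 subn0 cards1 card_imset; last by move=> x y [].
  rewrite (_ : [set u] :&: B = set0) ?cards0 ?cards1; last first.
    by apply/setP=> u'; rewrite !inE; case: eqP => // ->; apply/negbTE.
  have W0 : 0 < #|W| by apply/card_gt0P; exists w.
  by move: PB; rewrite /P; lia.
rewrite /P !cardsT => ->; congr _.+1; apply: eq_card => ew; by rewrite !inE andbT.
Qed.

Variables (s : {perm U}) (t : {perm V}).
Hypothesis aut : forall u w, ((s u, t w) \in E) = ((u, w) \in E).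

Let G (x : U + V) : U + V := match x with inl u => inl (s u) | inr w => inr (t w) end.

Let crossed x z := ~~ connect (cut (tadj E) x z) x (G x).

Let sum_black u : \sum_(w in nbrs E u) crossed (inl u) (inr w) = (s u != u).
Proof.
case: tree => _ conn acyc.
have [su|su] /= := eqVneq (s u) u.
  by rewrite big1 // => w _; rewrite /crossed /= su connect0.
have usu : inl u != inl (s u) :> U + V by apply: contraNneq su => -[<-].
have [z ez zP] := crossing_neighbor (@tadj_sym _ _ E) acyc conn (@tadj_neq _ _ E) usu.
case: z ez zP => [//|w0] ez zP; rewrite (bigD1 w0) /=; last by rewrite inE.
rewrite /crossed zP // eqxx big1 ?addn0 // => w /andP[]; rewrite inE => uw ww0.
by rewrite /crossed zP //= (_ : inr w != inr w0).
Qed.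

Let sum_white w : \sum_(u | (u, w) \in E) crossed (inr w) (inl u) = (t w != w).
Proof.
case: tree => _ conn acyc.
have [tw|tw] /= := eqVneq (t w) w.
  by rewrite big1 // => u _; rewrite /crossed /= tw connect0.
have wtw : inr w != inr (t w) :> U + V by apply: contraNneq tw => -[<-].
have [z ez zP] := crossing_neighbor (@tadj_sym _ _ E) acyc conn (@tadj_neq _ _ E) wtw.
case: z ez zP => [u0|//] ez zP; rewrite (bigD1 u0) //=.
rewrite /crossed zP // eqxx big1 ?addn0 // => u /andP[uw uu0].
by rewrite /crossed zP //= (_ : inl u != inl u0).
Qed.

(** The image of a moved edge is a different edge and survives the removal of the first one. So both
    image vertices lie on the same side, and exactly one end is separated from its own image. *)
Let sum_edge ew : ew \in E ->
  crossed (inl ew.1) (inr ew.2) + crossed (inr ew.2) (inl ew.1)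
  = ~~ ((s ew.1 == ew.1) && (t ew.2 == ew.2)).
Proof.
case: tree => _ conn acyc; case: ew => u w /= uw.
rewrite /crossed /= (eq_connect (cutC _ (inr w) (inl u))).
have [/andP[/eqP -> /eqP ->]|fixed] := boolP ((s u == u) && (t w == w)); first by rewrite !connect0.
have sut : cut (tadj E) (inl u) (inr w) (inl (s u)) (inr (t w)).
  rewrite /= aut uw /= orbF; apply: contra fixed.
  by move=> /andP[/eqP[->] /eqP[->]]; rewrite !eqxx.
have csym := sym_connect_sym (cut_sym (@tadj_sym _ _ E) (inl u) (inr w)).
rewrite (same_connect1r csym sut) (cut_side (@tadj_sym _ _ E) acyc conn) //.
by case: connect.
Qed.

(* Let x move to its image G x, and say that x crosses the edge {x, z} if z lies
   on the path from x to G x.  A moved vertex crosses exactly one edge, and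
   a moved edge is crossed by exactly one of its ends; fixed vertices cross
   nothing and fixed edges are not crossed. *)
Lemma fixed_tree (w0 : V) :
  #|[set u | s u == u]| + #|[set w | t w == w]|
  = #|[set ew in E | (s ew.1 == ew.1) && (t ew.2 == ew.2)]|.+1.
Proof.
have sumb (T : finType) (A : {pred T}) (p : pred T) :
    \sum_(x in A) ~~ p x + #|[set x in A | p x]| = #|A|.
  rewrite -!sum1_card addnC [RHS](bigID p) /=; congr (_ + _).
    by apply: eq_bigl => x; rewrite inE.
  by rewrite [RHS]big_mkcondr /=; apply: eq_bigr => x _; case: (p x).
(* Crossings are counted by vertices and by edges; taking the moved elements out of [tree_euler]
   leaves the fixed ones. *)
have moved : \sum_(u : U) (s u != u) + \sum_(w : V) (t w != w)
    = \sum_(ew in E) ~~ ((s ew.1 == ew.1) && (t ew.2 == ew.2)).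
  rewrite -(eq_bigr _ sum_edge) big_split /=; congr (_ + _).
    under eq_bigr do rewrite -sum_black.
    by rewrite pair_big_dep /=; apply: eq_big => [[u w]|[u w] _] //=; rewrite inE.
  under eq_bigr do rewrite -sum_white.
  rewrite pair_big_dep /= [RHS](reindex (fun p : V * U => (p.2, p.1))) /=.
    by apply: eq_bigl => -[].
  by exists (fun p => (p.2, p.1)) => -[].
have := tree_euler w0; rewrite -(sumb _ predT (fun u => s u == u)) -(sumb _ predT (fun w => t w == w)).
rewrite -(sumb _ E (fun ew => (s ew.1 == ew.1) && (t ew.2 == ew.2))) -moved.
by rewrite addnACA -addnS => /addnI.
Qed.

End FixedPoints.

(** * Coding trees as colored trees *)

Section TreeIso.
Local Open Scope nat_scope.

Lemma is_tree_iso (T T' : finType) (e : rel T) (e' : rel T') (f : T -> T') (g : T' -> T) :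
  cancel f g -> cancel g f -> (forall x y, e' (f x) (f y) = e x y) ->
  is_tree e -> is_tree e'.
Proof.
move=> fK gK fe [c0 conn acyc]; split.
- by case/card_gt0P: c0 => x _; apply/card_gt0P; exists (f x).
- move=> x y; rewrite -(gK x) -(gK y); have /connectP[p pp ->] := conn (g x) (g y).
  apply/connectP; exists (map f p); rewrite ?last_map // path_map.
  by rewrite (eq_path (e' := e)).
move=> c /andP[cc uc]; rewrite -(size_map g); apply: acyc.
rewrite /ucycle (map_inj_uniq (can_inj gK)) uc andbT.
rewrite cycle_map (eq_cycle (e' := e')) // => x y /=.
by rewrite -fe !gK.
Qed.

End TreeIso.

Section ColoredTrees.
Variables (k : nat) (U V : finType).
Notation color := 'I_k.+1.
Notation colored := ({set U * V} * {ffun V -> color})%type.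
Implicit Types (u : U) (w : V) (x : colored) (T : coding_data U V) (c : {ffun V -> color}).

Definition colored_tree x : Prop :=
  [/\ is_tree (tadj x.1), forall u, #|nbrs x.1 u| = k.+1
    & forall u, {in nbrs x.1 u &, injective x.2}].

Lemma colored_tree_nbr x u (i : color) : colored_tree x ->
  exists2 w, (u, w) \in x.1 & x.2 w = i.
Proof.
case=> _ card_nbrs inj; have : i \in x.2 @: nbrs x.1 u.
  suff -> : x.2 @: nbrs x.1 u = setT by rewrite inE.
  by apply/eqP; rewrite eqEcard subsetT cardsT card_ord (card_in_imset (@inj u)) card_nbrs leqnn.
by case/imsetP=> w; rewrite inE => uw ->; exists w.
Qed.

Definition succ_color (i : color) : color := i + inZp 1.

Lemma ordS_succ (i : color) : ordS i = succ_color i.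
Proof. by apply: val_inj; rewrite /= modnDmr addn1. Qed.

Lemma inZp_succ n : (inZp n.+1 : color) = inZp n + inZp 1.
Proof. by apply: val_inj; rewrite /= modnDm addn1. Qed.

(* The coding tree whose cyclic orders at the black vertices follow the cyclic
   order of the colors. *)
Definition to_coding x : coding_data U V :=
  (x.1, [ffun u => [ffun w => if (u, w) \in x.1 then
     odflt w [pick w' | ((u, w') \in x.1) && (x.2 w' == succ_color (x.2 w))] else w]]).

Lemma to_codingE x u w w' : {in nbrs x.1 u &, injective x.2} ->
  (u, w) \in x.1 -> (u, w') \in x.1 -> x.2 w' = succ_color (x.2 w) ->
  succ_at (to_coding x) u w = w'.
Proof.
move=> inj uw uw' cw'; rewrite /succ_at /= !ffunE uw.
case: pickP => [w1 /andP[uw1 /eqP cw1]|/(_ w')] /=; last by rewrite uw' cw' eqxx.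
by apply: inj; rewrite ?inE // cw1.
Qed.

Lemma to_coding_out x u w : (u, w) \notin x.1 -> succ_at (to_coding x) u w = w.
Proof. by move=> /negPf uw; rewrite /succ_at /= !ffunE uw. Qed.

Lemma to_coding_succ x u w : colored_tree x -> (u, w) \in x.1 ->
  (u, succ_at (to_coding x) u w) \in x.1 /\
  x.2 (succ_at (to_coding x) u w) = succ_color (x.2 w).
Proof.
move=> ct uw; have [w' uw' cw'] := colored_tree_nbr u (succ_color (x.2 w)) ct.
by case: ct => _ _ inj; rewrite (to_codingE (inj u) uw uw' cw').
Qed.

Definition compatible T c := forall u w, (u, w) \in T.1 ->
  c (succ_at T u w) = succ_color (c w).

Lemma to_coding_iter x u w n : colored_tree x -> (u, w) \in x.1 ->
  (u, iter n (succ_at (to_coding x) u) w) \in x.1 /\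
  x.2 (iter n (succ_at (to_coding x) u) w) = x.2 w + inZp n.
Proof.
move=> ct uw; elim: n => [|n [IH1 IH2]].
  by rewrite /= (_ : inZp 0 = 0) ?addr0 //; apply: val_inj; rewrite /= mod0n.
have [h1 h2] := to_coding_succ ct IH1.
by rewrite iterS h1 h2 IH2 inZp_succ addrA.
Qed.

Lemma to_coding_tree x : colored_tree x -> is_coding_tree k (to_coding x).
Proof.
move=> ct; case: (ct) => tree card_nbrs inj; split=> //=.
  move=> u w w' uw; apply/idP/idP => [/iter_findex <-|uw'].
    by case: (to_coding_iter (findex (succ_at (to_coding x) u) w w') ct uw).
  (* The number of steps from w to w' is the difference of their colors. *)
  have [h1 h2] := to_coding_iter (val (x.2 w' - x.2 w)) ct uw.
  suff -> : w' = iter (val (x.2 w' - x.2 w)) (succ_at (to_coding x) u) w by apply: fconnect_iter.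
  by apply: (inj u); rewrite ?inE // h2 valZpK addrC subrK.
by move=> u w uw; apply: to_coding_out.
Qed.

Lemma to_coding_compatible x : colored_tree x -> compatible (to_coding x) x.2.
Proof. by move=> ct u w uw; case: (to_coding_succ ct uw). Qed.

Section CodingTree.
Variable T : coding_data U V.
Hypothesis coding : is_coding_tree k T.
Notation f := (succ_at T).

Lemma coding_tadj : is_tree (tadj T.1). Proof. by case: coding. Qed.

Lemma succ_nbr u w : (u, w) \in T.1 -> (u, f u w) \in T.1.
Proof. by case: coding => _ _ fc _ uw; rewrite -(fc u w) // fconnect1. Qed.

Lemma iter_nbr u w n : (u, w) \in T.1 -> (u, iter n (f u) w) \in T.1.
Proof. by move=> uw; elim: n => //= n; apply: succ_nbr. Qed.

Lemma order_nbr u w : (u, w) \in T.1 -> fingraph.order (f u) w = k.+1.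
Proof.
case: coding => _ cn fc _ uw; rewrite -(cn u); apply: eq_card => w'.
by rewrite inE -(fc u w).
Qed.

Lemma iter_period u w : (u, w) \in T.1 -> iter k.+1 (f u) w = w.
Proof.
case: coding => _ cn fc _ uw; rewrite -(order_nbr uw).
apply: (@iter_order_cycle _ _ (fingraph.orbit (f u) w)); rewrite ?fingraph.in_orbit //.
by rewrite -fconnect_f fc ?uw ?succ_nbr.
Qed.

Lemma iter_mod u w n : (u, w) \in T.1 -> iter n (f u) w = iter (n %% k.+1) (f u) w.
Proof.
move=> uw; rewrite {1}(divn_eq n k.+1) addnC iterD; congr iter.
elim: (n %/ _)%N => // q IH.
by rewrite mulSn addnC iterD iter_period.
Qed.

Lemma findex_inZp u w n : (u, w) \in T.1 ->
  inZp (findex (f u) w (iter n (f u) w)) = inZp n :> color.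
Proof.
move=> uw; rewrite iter_mod // findex_iter ?order_nbr ?ltn_pmod //.
by apply: val_inj; rewrite /= modn_mod.
Qed.

Lemma findex_nbr u w w' : (u, w) \in T.1 -> (u, w') \in T.1 ->
  exists2 n, (n < k.+1)%N & w' = iter n (f u) w /\ findex (f u) w w' = n.
Proof.
move=> uw uw'; have fc : fconnect (f u) w w' by case: coding => _ _ ->.
exists (findex (f u) w w'); first by rewrite -(order_nbr uw) findex_max.
by rewrite iter_findex.
Qed.

Lemma compatible_iter c u w n : compatible T c -> (u, w) \in T.1 ->
  c (iter n (f u) w) = c w + inZp n.
Proof.
move=> cc uw; elim: n => [|n IH].
  by rewrite /= (_ : inZp 0 = 0) ?addr0 //; apply: val_inj; rewrite /= mod0n.
by rewrite iterS cc ?iter_nbr // IH inZp_succ /succ_color addrA.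
Qed.

(** The bridge from positions, in which the actions are defined, to colors: each step of the cyclic
    order raises the color by 1. *)
Lemma positionE c u w w' : compatible T c -> (u, w) \in T.1 -> (u, w') \in T.1 ->
  position k (f u) w w' = c w' - c w.
Proof.
move=> cc uw uw'; have [n nk [-> en]] := findex_nbr uw uw'.
rewrite /position findex_iter ?order_nbr // (compatible_iter _ cc) // addrC addKr.
by apply: val_inj; rewrite /= inordK // modn_small.
Qed.

Lemma compatible_inj c u : compatible T c -> {in nbrs T.1 u &, injective c}.
Proof.
move=> cc w w'; rewrite !inE => uw uw' cw.
have [n nk [w'n en]] := findex_nbr uw uw'.
have := compatible_iter n cc uw; rewrite -w'n -cw -[LHS]addr0 => /addrI/(congr1 val).
by rewrite /= modn_small // => n0; rewrite w'n -n0.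
Qed.

Lemma compatible_colored c : compatible T c -> colored_tree (T.1, c).
Proof.
move=> cc; split=> /=; first exact: coding_tadj.
  by case: coding.
by move=> u; apply: compatible_inj.
Qed.

Lemma compatible_to_coding c : compatible T c -> T = to_coding (T.1, c).
Proof.
move=> cc; suff e : T.2 = (to_coding (T.1, c)).2 by rewrite [LHS]surjective_pairing e.
apply/ffunP=> u; apply/ffunP=> w; rewrite -[LHS]/(f u w) -[RHS]/(succ_at _ u w).
have [uw|uw] := boolP ((u, w) \in T.1); last first.
  by rewrite to_coding_out //; case: coding => _ _ _ ->.
apply/esym/to_codingE => //=; [exact: compatible_inj|exact: succ_nbr|exact: cc].
Qed.

(** By [positionE] the color of one neighbor of a black vertex determines the others, so agreement
    at y propagates by growth. *)
Lemma compatible_unique c c' y : compatible T c -> compatible T c' -> c y = c' y -> c = c'.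
Proof.
move=> cc cc' cy; apply/ffunP=> w.
pose P (B : {set U}) (W : {set V}) := {in W, c =1 c'}.
have : P setT setT.
  apply: (tree_growth coding_tadj (w0 := y) (B0 := set0) (W0 := [set y])).
  - by rewrite inE.
  - exact: subtree_white.
  - by move=> w'; rewrite inE => /eqP->.
  move=> B W u w0 _ PB _ w0W uw0 _ w'; rewrite !inE => /orP[/PB //|uw'].
  have /eqP := positionE cc uw0 uw'.
  by rewrite (positionE cc' uw0 uw') (PB _ w0W) eq_sym => /eqP/addIr.
by apply; rewrite inE.
Qed.

(** Colors propagate from y without conflict, because a new black vertex has a single neighbor that
    is already colored. *)
Lemma compatible_exists y : exists2 c, compatible T c & c y = 0.
Proof.
pose P (B : {set U}) (W : {set V}) := exists2 c : {ffun V -> color},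
  (forall u w, u \in B -> (u, w) \in T.1 -> c (f u w) = succ_color (c w)) & c y = 0 /\ y \in W.
have : P setT setT; last first.
  by case=> c cc [cy _]; exists c => // u w; apply: cc; rewrite inE.
apply: (tree_growth coding_tadj (w0 := y) (B0 := set0) (W0 := [set y])).
- by rewrite inE.
- exact: subtree_white.
- exists [ffun=> 0]; last by rewrite ffunE inE.
  by move=> u w; rewrite inE.
move=> B W u w [cl _] [c cc [cy yW]] uB wW uw uniqw.
exists [ffun w' => if w' \in W then c w' else c w + inZp (findex (f u) w w')]; last first.
  by rewrite ffunE yW inE yW.
(* The formula for new vertices also holds at w, the only old one, so it covers the whole cyclic
   order. *)
have cu n : [ffun w' => if w' \in W then c w' else c w + inZp (findex (f u) w w')]
    (iter n (f u) w) = c w + inZp n :> color.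
  rewrite ffunE; case: ifP => [nW|_]; last by rewrite findex_inZp.
  have e := uniqw _ nW (iter_nbr n uw).
  by rewrite -(findex_inZp n uw) e findex0 (_ : inZp 0 = 0) ?addr0 //; apply: val_inj; rewrite /= mod0n.
move=> u' w'; rewrite !inE => /orP[/eqP-> uw'|u'B uw'].
  have [n _ [-> _]] := findex_nbr uw uw'.
  by rewrite -iterS !cu inZp_succ /succ_color addrA.
by rewrite !ffunE (cl u' w') // (cl u' (f u' w')) ?succ_nbr // cc.
Qed.

End CodingTree.

(** Passing to cyclic orders forgets the colors only up to a shift, which the color of y pins
    down. *)
Lemma to_coding_inj x x' y : colored_tree x -> colored_tree x' -> x.2 y = x'.2 y ->
  to_coding x = to_coding x' -> x = x'.
Proof.
case: x x' => [E c] [E' c'] ct ct' cy e.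
have EE : E = E' by apply: (congr1 fst e).
congr pair => //; apply: (compatible_unique (to_coding_tree ct) _ _ cy).
  exact: to_coding_compatible.
by rewrite e; apply: to_coding_compatible.
Qed.

(** Relabelings and color permutations act jointly; the orbits on colored trees will be the
    unlabeled k-trees. *)
Definition recolor (s : {perm U}) (t : {perm V}) (g : 'S_k.+1) x : colored :=
  ([set (s ew.1, t ew.2) | ew in x.1], [ffun w => g (x.2 ((t^-1)%g w))]).

Lemma mem_recolor s t g x u w :
  ((u, w) \in (recolor s t g x).1) = (((s^-1)%g u, (t^-1)%g w) \in x.1).
Proof.
apply/imsetP/idP => [[[u' w'] uw [-> ->]]|uw]; first by rewrite !permK.
by exists ((s^-1)%g u, (t^-1)%g w); rewrite //= !permKV.
Qed.

Lemma recolor_tree s t g x : colored_tree x -> colored_tree (recolor s t g x).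
Proof.
case=> tree cn inj; split.
- pose F (s : {perm U}) (t : {perm V}) (v : U + V) : U + V :=
    match v with inl u => inl (s u) | inr w => inr (t w) end.
  apply: (is_tree_iso (f := F s t) (g := F (s^-1)%g (t^-1)%g)) tree.
  + by move=> [v|v] /=; rewrite permK.
  + by move=> [v|v] /=; rewrite permKV.
  by move=> [v|v] [v'|v'] //; rewrite /F /tadj mem_recolor !permK.
- move=> u; apply: (etrans _ (cn ((s^-1)%g u))).
  rewrite -[RHS](card_imset _ (@perm_inj _ t)); apply: eq_card => w; rewrite inE mem_recolor; apply/idP/imsetP => [uw|[w']].
    by exists ((t^-1)%g w); rewrite ?inE ?permKV.
  by rewrite inE => uw ->; rewrite permK.
move=> u w w'; rewrite !inE !mem_recolor !ffunE => uw uw' /perm_inj e.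
by apply: (@perm_inj _ (t^-1)%g); apply: (inj ((s^-1)%g u)); rewrite ?inE.
Qed.

Lemma relabel_to_coding s t x : colored_tree x ->
  relabel s t (to_coding x) = to_coding (recolor s t 1%g x).
Proof.
move=> ct; congr pair; apply/ffunP=> u; apply/ffunP=> w.
transitivity (t (succ_at (to_coding x) ((s^-1)%g u) ((t^-1)%g w))).
  by rewrite ffunE ffunE.
rewrite -[RHS]/(succ_at (to_coding (recolor s t 1%g x)) u w).
have [uw|uw] := boolP ((u, w) \in (recolor s t 1%g x).1); last first.
  rewrite (to_coding_out uw) to_coding_out ?permKV //.
  by rewrite mem_recolor in uw.
move: (uw); rewrite mem_recolor => uw'; have [h1 h2] := to_coding_succ ct uw'.
apply/esym/to_codingE => //.
- by case: (recolor_tree s t 1%g ct).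
- by rewrite mem_recolor permK.
by rewrite !ffunE permK !perm1.
Qed.

Lemma recolorM s t g s' t' g' x :
  recolor s' t' g' (recolor s t g x) = recolor (s * s')%g (t * t')%g (g * g')%g x.
Proof.
rewrite [LHS]surjective_pairing [RHS]surjective_pairing; congr pair.
  by apply/setP=> -[u w]; rewrite !mem_recolor !invgM !permM.
by apply/ffunP=> w; rewrite !ffunE invgM !permM.
Qed.

Lemma recolor1 x : recolor 1%g 1%g 1%g x = x.
Proof.
rewrite [LHS]surjective_pairing [RHS]surjective_pairing; congr pair.
  by apply/setP=> -[u w]; rewrite mem_recolor !invg1 !perm1.
by apply/ffunP=> w; rewrite !ffunE invg1 !perm1.
Qed.

End ColoredTrees.

(** * The two actions on rooted coding trees as recolorings *)

Section Actions.
Variables (k : nat) (U V : finType).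
Notation color := 'I_k.+1.
Notation colored := ({set U * V} * {ffun V -> color})%type.
Implicit Types (u : U) (w y : V) (x : colored) (T : coding_data U V) (c : {ffun V -> color}).

Lemma rhoE (i a : color) (s : 'S_k.+1) : rho i s a = s (i + a) - s i.
Proof. by rewrite permE. Qed.

Lemma rho_rho (i j : color) (s : 'S_k.+1) : rho i (rho j s) = rho (j + i) s.
Proof. by apply/permP=> a; rewrite !rhoE addrA opprB addrA subrK. Qed.

Section FixedTree.
Variables (T : coding_data U V) (c : {ffun V -> color}) (s : 'S_k.+1).
Hypotheses (coding : is_coding_tree k T) (cc : compatible T c).
Notation f := (succ_at T).

(* Reordering by [q] around a white vertex of color [i] has the same effect as
   recoloring by [s]: the induced cyclic order only depends on the [rho j q]. *)
Definition follows (q : 'S_k.+1) (i : color) := forall j, rho j q = rho (i + j) s.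

(** The new successor of w comes from the position b with q b = q a + 1, where a is the position of
    w. Evaluating [rho a q] = [rho (c w) s] at b - a turns this into an increase by 1 of the new
    color s (c w). *)
Lemma reorder_succ q u w0 w : follows q (c w0) -> (u, w0) \in T.1 -> (u, w) \in T.1 ->
  let w' := reorder (f u) w0 q w in (u, w') \in T.1 /\ s (c w') = succ_color (s (c w)).
Proof.
move=> fq uw0 uw /=; rewrite /reorder ffunE ifT; last by case: coding => _ _ ->.
rewrite (positionE coding cc) //; set a := c w - c w0.
set b := (q^-1)%g _; split; first exact: (iter_nbr coding).
rewrite (compatible_iter coding _ cc) // valZpK.
have qb : q b = q a + inZp 1 by rewrite /b permKV ordS_succ.
have := congr1 (fun p : 'S_k.+1 => p (b - a)) (fq a).
have e1 : a + (b - a) = b by rewrite addrC subrK.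
have e2 : c w0 + a = c w by rewrite addrC subrK.
rewrite !rhoE e1 -(addrA (c w0)) e1 e2 qb [q a + _]addrC addrK => e.
by rewrite /succ_color e [RHS]addrC subrK.
Qed.

Lemma act_all_to_coding r anchor s0 :
  (forall u, exists w0, [/\ anchor u = Some w0, (u, w0) \in T.1
                          & follows (spread T r anchor s0 u) (c w0)]) ->
  act_all T r anchor s0 = to_coding (T.1, [ffun w => s (c w)]).
Proof.
move=> h; congr pair; apply/ffunP=> u; rewrite [LHS]ffunE.
have [w0 [-> uw0 fq]] := h u; apply/ffunP=> w.
rewrite -[RHS]/(succ_at (to_coding (T.1, [ffun w => s (c w)])) u w).
have [uw|uw] := boolP ((u, w) \in T.1); last first.
  rewrite to_coding_out // ffunE; case: (coding) => _ _ fc out.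
  by rewrite fc // (negPf uw) out.
have [h1 h2] := reorder_succ fq uw0 uw.
apply/esym/to_codingE; rewrite //=; last by rewrite [LHS]ffunE h2 ffunE.
move=> w1 w2 uw1 uw2; rewrite !ffunE => /perm_inj; exact: (compatible_inj coding cc uw1 uw2).
Qed.

Section Spread.
Variables (r : U + V) (anchor : U -> option V) (s0 : 'S_k.+1).
Variables (B0 : {set U}) (W0 : {set V}).

(** Stated from an arbitrary initial subtree to serve both actions: it is the single white vertex y
    for a white root, and the black vertex v with its neighbors for an edge root. *)
Lemma spread_follows w0 : w0 \in W0 -> subtree T.1 B0 W0 -> nodes B0 W0 r ->
  (forall u w, u \notin B0 -> white_above T r u = Some w -> anchor u = Some w) ->
  (forall u, u \in B0 -> exists w, [/\ anchor u = Some w, (u, w) \in T.1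
     & forall fuel, follows (spread_rec fuel T r anchor s0 u) (c w)]) ->
  (forall w, w \in W0 -> black_above T r w = None /\ follows s0 (c w) \/
     exists u, [/\ u \in B0, black_above T r w = Some u & (u, w) \in T.1]) ->
  forall u, exists w, [/\ anchor u = Some w, (u, w) \in T.1
     & follows (spread T r anchor s0 u) (c w)].
Proof.
move=> w0W S0 r0 anchorE hB hW.
(* Fuel |B| suffices on B: the recursion from a vertex of B stays in B, and each growth step deepens
   it by at most one level. *)
pose P (B : {set U}) (W : {set V}) :=
  [/\ B0 \subset B, nodes B W r,
   forall u, u \in B -> exists w, [/\ anchor u = Some w, (u, w) \in T.1
     & forall fuel, (#|B| <= fuel)%N -> follows (spread_rec fuel T r anchor s0 u) (c w)]
   & forall w, w \in W -> black_above T r w = None /\ follows s0 (c w) \/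
     exists u, [/\ u \in B, black_above T r w = Some u & (u, w) \in T.1]].
have : P setT setT; last first.
  case=> _ _ h _ u; have [w [a uw fw]] := h u (in_setT u).
  by exists w; split=> //; apply: fw; rewrite cardsT.
have tree := coding_tadj coding; have [_ _ acyc] := tree.
have tsym := @tadj_sym _ _ T.1.
apply: (tree_growth tree w0W S0).
  split=> // u uB; have [w [a uw fw]] := hB u uB.
  by exists w; split=> // fuel _.
move=> B W u w [_ co] [B0B rB PB PW] uB wW uw uniqw.
have wr : connect (within (tadj T.1) (nodes B W)) (inr w) r by apply: co.
have wu : white_above T r u = Some w.
  rewrite /white_above (_ : parent _ _ _ = Some (inr w)) //.
  apply: (parentP tsym acyc) => //; apply: (sub_within _ wr) => -[u'|w'] //= u'B.
  by apply: contraNneq uB => -[<-].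
have au : anchor u = Some w.
  by apply: anchorE wu; apply: contra uB; apply: (subsetP B0B).
split.
- by apply: (subset_trans B0B); apply: subsetUr.
- by case: r rB => [u'|w'] /=; rewrite !inE => ->; rewrite ?orbT.
- move=> u'; rewrite !inE => /orP[/eqP->|u'B]; last first.
    have [w' [a uw' fw]] := PB u' u'B; exists w'; split=> // fuel fle.
    by apply: fw; apply: leq_trans fle; apply: subset_leq_card; apply: subsetUr.
  exists w; split=> // -[|fuel]; rewrite cardsU1 uB add1n // ltnS => fle /=.
  rewrite wu; case: (PW w wW) => [[-> //]|[u1 [u1B -> u1w]]].
  have [w1 [-> u1w1 fw]] := PB u1 u1B.
  (* The index of the last [rho] is c w - c w1, and adding it to c w1 gives c w. *)
  by move=> j; rewrite rho_rho (fw _ fle) (positionE coding cc) // addrA [c w1 + _]addrC subrK.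
move=> w'; rewrite inE; have [w'W _|w'W /=] := boolP (w' \in W).
  case: (PW w' w'W) => [|[u1 [u1B bu1 u1w']]]; [by left|right].
  by exists u1; rewrite inE u1B orbT.
rewrite inE => uw'; right; exists u; rewrite !inE eqxx; split=> //.
rewrite /black_above (_ : parent _ _ _ = Some (inl u)) //.
apply: (parentP tsym acyc) => //; apply: (connect_trans (y := inr w)).
  apply: connect1; rewrite /= uw andbT.
  by apply: contraNneq w'W => -[<-].
apply: (sub_within _ wr) => -[u1|w1] //= w1W.
by apply: contraNneq w'W => -[<-].
Qed.

End Spread.
End FixedTree.

Lemma Y_act_to_coding (g : 'S_k) x y : colored_tree x -> x.2 y = 0 ->
  Y_act g (to_coding x, y) = (to_coding (recolor 1%g 1%g (lift_perm ord0 ord0 g) x), y).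
Proof.
move=> ct cy; rewrite /Y_act; congr pair.
set s := lift_perm ord0 ord0 g.
have -> : recolor 1%g 1%g s x = (x.1, [ffun w => s (x.2 w)]).
  rewrite [LHS]surjective_pairing; congr pair.
    by apply/setP=> -[u w]; rewrite mem_recolor !invg1 !perm1.
  by apply/ffunP=> w; rewrite !ffunE invg1 perm1.
apply: (act_all_to_coding (to_coding_tree ct) (to_coding_compatible ct)).
apply: (spread_follows (to_coding_tree ct) (to_coding_compatible ct)
  (w0 := y) (B0 := set0) (W0 := [set y])).
- by rewrite inE.
- exact: subtree_white.
- by rewrite /= inE.
- by [].
- by move=> u; rewrite inE.
move=> w; rewrite inE => /eqP->; left; split.
  by rewrite /black_above parent_root.
by move=> j; rewrite cy add0r.
Qed.

(** The white vertex moved to position k+1 is the one whose new color is 0, so the normalization of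
    the root edge survives the action. *)
Lemma XY_act_to_coding (s : 'S_k.+1) x v w : colored_tree x -> (v, w) \in x.1 -> x.2 w = 0 ->
  exists2 w', XY_act s (to_coding x, (v, w)) = (to_coding (recolor 1%g 1%g s x), (v, w'))
    & (v, w') \in x.1 /\ s (x.2 w') = 0.
Proof.
move=> ct vw cw; have coding := to_coding_tree ct; have cc := to_coding_compatible ct.
exists (iter ((s^-1)%g ord0) (succ_at (to_coding x) v) w); last first.
  split; first exact: (iter_nbr coding).
  by rewrite (compatible_iter coding _ cc) // cw add0r valZpK permKV.
rewrite /XY_act; congr pair.
have -> : recolor 1%g 1%g s x = (x.1, [ffun w => s (x.2 w)]).
  rewrite [LHS]surjective_pairing; congr pair.
    by apply/setP=> -[u w']; rewrite mem_recolor !invg1 !perm1.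
  by apply/ffunP=> w'; rewrite !ffunE invg1 perm1.
apply: (act_all_to_coding coding cc).
apply: (spread_follows coding cc (w0 := w) (B0 := [set v]) (W0 := nbrs x.1 v)).
- by rewrite inE.
- exact: subtree_black.
- by rewrite /= inE.
- by move=> u w'; rewrite inE => /negPf->.
- move=> u; rewrite inE => /eqP->; exists w; rewrite eqxx; split=> // fuel.
  have -> : spread_rec fuel (to_coding x) (inl v)
      (fun u0 => if u0 == v then Some w else white_above (to_coding x) (inl v) u0) s v = s.
    by case: fuel => //= fuel; rewrite /white_above parent_root.
  by move=> j; rewrite cw add0r.
move=> w'; rewrite inE => vw'; right; exists v; rewrite inE eqxx; split=> //.
rewrite /black_above (_ : parent _ _ _ = Some (inl v)) //.
have [_ _ acyc] := coding_tadj coding.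
by apply: (parentP (@tadj_sym _ _ x.1) acyc).
Qed.

End Actions.

(** * Fixed rooted coding trees counted as fixed colored trees *)

Section FixedStructures.
Variables (k : nat) (U V : finType).
Notation color := 'I_k.+1.
Notation colored := ({set U * V} * {ffun V -> color})%type.
Implicit Types (x : colored) (s : {perm U}) (t : {perm V}) (g : 'S_k.+1).

Definition fixed_colored s t g : {set colored} :=
  [set x | `[< colored_tree x >] && (recolor s t g x == x)].

Lemma fixed_coloredP s t g x :
  reflect (colored_tree x /\ recolor s t g x = x) (x \in fixed_colored s t g).
Proof.
rewrite inE; apply: (iffP andP) => [[/asboolP ? /eqP //]|[ct fx]].
by rewrite fx eqxx; split=> //; apply/asboolP.
Qed.

Lemma fixed_edge s t g x u w : recolor s t g x = x ->
  ((s u, t w) \in x.1) = ((u, w) \in x.1).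
Proof. by move=> fx; rewrite -{1}fx mem_recolor !permK. Qed.

Lemma fixed_color s t g x w : recolor s t g x = x -> x.2 (t w) = g (x.2 w).
Proof. by move=> fx; rewrite -{1}fx ffunE permK. Qed.

Lemma card_fixed_dep (I : finType) (A : {set colored}) (B : colored -> {set I}) :
  #|[set xi : colored * I | (xi.1 \in A) && (xi.2 \in B xi.1)]| = (\sum_(x in A) #|B x|)%N.
Proof.
under eq_bigr do rewrite -sum1_card.
rewrite pair_big_dep /= -sum1_card; apply: eq_bigl => -[x i]; by rewrite inE.
Qed.

Lemma Y_transport_act (g : 'S_k) s t x y : colored_tree x -> x.2 y = 0 ->
  Y_act g (Y_transport s t (to_coding x, y))
  = (to_coding (recolor s t (lift_perm ord0 ord0 g) x), t y).
Proof.
move=> ct cy; rewrite /Y_transport relabel_to_coding // Y_act_to_coding.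
- by rewrite recolorM !mulg1 mul1g.
- exact: recolor_tree.
by rewrite ffunE permK cy perm1.
Qed.

Lemma coding_colored (T : coding_data U V) y : is_coding_tree k T ->
  exists x, [/\ colored_tree x, x.2 y = 0 & T = to_coding x].
Proof.
move=> coding; have [c cc cy] := compatible_exists coding y.
exists (T.1, c); split=> //; first exact: compatible_colored.
exact: compatible_to_coding.
Qed.

(** A white-rooted coding tree amounts to a colored tree whose root has color 0: the coloring exists
    by [coding_colored] and is unique by [to_coding_inj]. This dictionary is equivariant. *)
Lemma fix_Y_colored (g : 'S_k) s t :
  #|[set Ty : coding_data U V * V | `[< Y_mem k Ty >] & Y_act g (Y_transport s t Ty) == Ty]|
  = (\sum_(x in fixed_colored s t (lift_perm ord0 ord0 g))
       #|[set w | (t w == w) && (x.2 w == 0%R)]|)%N.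
Proof.
rewrite -card_fixed_dep; set A := [set _ | _].
set B := [set xi | _]; pose psi (xy : colored * V) := (to_coding xy.1, xy.2).
have psi_inj : {in B &, injective psi}.
  move=> [x y] [x' y']; rewrite !inE /= => /andP[/andP[/asboolP ct _] /andP[_ /eqP cy]].
  move=> /andP[/andP[/asboolP ct' _] /andP[_ /eqP cy']] e.
  have e3 : y = y' by apply: (congr1 snd e).
  rewrite -e3 in cy' *; congr pair.
  by apply: (to_coding_inj (y := y) ct ct'); [rewrite cy cy' | apply: (congr1 fst e)].
rewrite -(card_in_imset psi_inj); apply: eq_card => -[T y]; apply/idP/imsetP.
  rewrite inE => /andP[/asboolP /(coding_colored y)[x [ct cy TE]]].
  have {TE}-> : T = to_coding x by [].
  rewrite Y_transport_act // => /eqP e; exists (x, y) => //.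
  have ty : t y = y by apply: (congr1 snd e).
  rewrite !inE /= ty cy !eqxx !andbT; apply/andP; split; first exact/asboolP.
  (* Injectivity needs equal colors at y; they agree because y is fixed and the lifted permutation
     fixes color 0. *)
  apply/eqP/(to_coding_inj (y := y)) => //; first exact: recolor_tree.
    by rewrite ffunE /= -{1}ty permK cy lift_perm_id.
  exact: (congr1 fst e).
move=> [[x y'] xB e]; move: xB; rewrite inE => /andP[/fixed_coloredP[/= ct fx]].
rewrite inE => /andP[/eqP /= ty /eqP /= cy]; rewrite inE.
have -> : T = to_coding x := congr1 fst e; have -> : y = y' := congr1 snd e.
rewrite Y_transport_act // fx ty eqxx andbT.
by apply/asboolP; exact: to_coding_tree.
Qed.

Lemma XY_transport_act g s t x v w : colored_tree x -> (v, w) \in x.1 -> x.2 w = 0 ->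
  exists2 w', XY_act g (XY_transport s t (to_coding x, (v, w)))
              = (to_coding (recolor s t g x), (s v, w'))
    & (s v, w') \in (recolor s t g x).1 /\ (recolor s t g x).2 w' = 0.
Proof.
move=> ct vw cw; rewrite /XY_transport relabel_to_coding //.
have [||w' -> [vw' cw']] := XY_act_to_coding g (v := s v) (w := t w) (recolor_tree s t 1%g ct).
- by rewrite mem_recolor !permK.
- by rewrite ffunE permK cw perm1.
exists w'; first by rewrite recolorM !mulg1 mul1g.
by move: vw' cw'; rewrite !mem_recolor !ffunE perm1.
Qed.

(** In a fixed tree the root edge is sent to the edge of color 0 at s v, so being fixed reduces to s
    v = v. *)
Lemma fix_XY_edges g s t :
  #|[set Te : coding_data U V * (U * V) | `[< XY_mem k Te >] & XY_act g (XY_transport s t Te) == Te]|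
  = (\sum_(x in fixed_colored s t g)
       #|[set e in x.1 | (s e.1 == e.1) && (x.2 e.2 == 0%R)]|)%N.
Proof.
rewrite -card_fixed_dep; set A := [set _ | _].
set B := [set xi | _]; pose psi (xe : colored * (U * V)) := (to_coding xe.1, xe.2).
have psi_inj : {in B &, injective psi}.
  move=> [x y] [x' y']; rewrite !inE /= => /andP[/andP[/asboolP ct _] /and3P[_ _ /eqP cy]].
  move=> /andP[/andP[/asboolP ct' _] /and3P[_ _ /eqP cy']] e.
  have e3 : y = y' by apply: (congr1 snd e).
  rewrite -e3 in cy' *; congr pair.
  by apply: (to_coding_inj (y := y.2) ct ct'); [rewrite cy cy' | apply: (congr1 fst e)].
rewrite -(card_in_imset psi_inj); apply: eq_card => -[T [v w]]; apply/idP/imsetP.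
  rewrite inE => /andP[/asboolP[/(coding_colored w)[x [ct cw TE]] vw]].
  have {}TE : T = to_coding x by []; rewrite TE in vw *.
  have [w' -> [vw' cw']] := XY_transport_act g s t ct vw cw.
  move=> /eqP e; exists (x, (v, w)) => //.
  have sv : s v = v by apply: (congr1 (fun z => z.2.1) e).
  have ww : w' = w by apply: (congr1 (fun z => z.2.2) e).
  rewrite !inE /= sv cw vw !eqxx !andbT; apply/andP; split; first exact/asboolP.
  apply/eqP/(to_coding_inj (y := w)) => //; first exact: recolor_tree.
    by rewrite -ww cw' ww.
  exact: (congr1 fst e).
move=> [[x [v' w']] xB e]; move: xB; rewrite inE => /andP[/fixed_coloredP[/= ct fx]].
rewrite inE => /and3P[/= vw /eqP sv /eqP cw]; rewrite inE.
have -> : T = to_coding x := congr1 fst e.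
have -> : v = v' := congr1 (fun z => z.2.1) e.
have -> : w = w' := congr1 (fun z => z.2.2) e.
apply/andP; split; first by apply/asboolP; split=> //=; exact: to_coding_tree.
have [w1 -> []] := XY_transport_act g s t ct vw cw.
rewrite fx sv => vw1 cw1; case: (ct) => _ _ inj.
by rewrite (inj v' w1 w') ?inE // cw1 cw.
Qed.

Lemma card_root_edges (P : pred U) (i : color) x : colored_tree x ->
  #|[set e in x.1 | P e.1 && (x.2 e.2 == i)]| = #|[set v | P v]|.
Proof.
move=> ct; have fst_inj : {in [set e in x.1 | P e.1 && (x.2 e.2 == i)] &, injective (@fst U V)}.
  move=> [u w] [u' w']; rewrite !inE /= => /and3P[uw _ /eqP cw] /and3P[uw' _ /eqP cw'] uu.
  rewrite -uu in uw' *; congr pair; case: ct => _ _ inj.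
  by apply: (inj u); rewrite ?inE // cw cw'.
rewrite -(card_in_imset fst_inj); apply: eq_card => v; rewrite inE.
apply/imsetP/idP => [[[u w]]|Pv]; first by rewrite inE /= => /and3P[_ Pu _] ->.
have [w vw cw] := colored_tree_nbr v i ct; exists (v, w) => //.
by rewrite inE /= vw Pv cw eqxx.
Qed.

Lemma fix_XY_colored g s t :
  #|[set Te : coding_data U V * (U * V) | `[< XY_mem k Te >] & XY_act g (XY_transport s t Te) == Te]|
  = (\sum_(x in fixed_colored s t g) #|[set v | s v == v]|)%N.
Proof.
rewrite fix_XY_edges; apply: eq_bigr => x /fixed_coloredP[ct _].
exact: (card_root_edges (fun v => s v == v)).
Qed.

(** Here color 0 is preserved, so the neighbor of color 0 of a fixed black vertex is fixed as
    well. *)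
Lemma fix_XY_lift (g : 'S_k) s t :
  #|[set Te : coding_data U V * (U * V) | `[< XY_mem k Te >]
      & XY_act (lift_perm ord0 ord0 g) (XY_transport s t Te) == Te]|
  = (\sum_(x in fixed_colored s t (lift_perm ord0 ord0 g))
       #|[set e in x.1 | (s e.1 == e.1) && (t e.2 == e.2) && (x.2 e.2 == 0%R)]|)%N.
Proof.
rewrite fix_XY_edges; apply: eq_bigr => x /fixed_coloredP[ct fx].
apply: eq_card => -[v w]; rewrite !inE /=; case: (boolP ((v, w) \in x.1)) => //= vw.
case: eqP => //= sv; rewrite andbC; case: eqP => //= cw; apply/esym/eqP.
case: ct => _ _ inj; apply: (inj v); rewrite ?inE //.
  by rewrite -{1}sv (fixed_edge _ _ fx).
by rewrite (fixed_color _ fx) cw lift_perm_id.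
Qed.

(** Euler's relation with (k+1)|U| edges. It leaves one possible number of white labels for each
    number of black ones. *)
Lemma colored_tree_card x : colored_tree x -> (0 < #|V|)%N -> #|V| = (k * #|U|).+1.
Proof.
case=> tree cn _ /card_gt0P[w0 _]; have := tree_euler tree w0.
rewrite -[#|x.1|](_ : \sum_(u : U) #|nbrs x.1 u| = _)%N.
  by rewrite (eq_bigr (fun=> k.+1)) // sum_nat_const cardT -cardE; lia.
under eq_bigr do rewrite -sum1_card.
rewrite pair_big_dep /= -sum1_card; apply: eq_bigl => -[u w]; by rewrite inE.
Qed.

Lemma colored_tree_white x : colored_tree x -> (0 < #|V|)%N.
Proof.
case=> [[/card_gt0P[[u|w] _] _ _] cn _]; last by apply/card_gt0P; exists w.
by apply: leq_trans (max_card (mem (nbrs x.1 u))); rewrite cn.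
Qed.

(* The fixed vertices and edges of a tree automorphism form a nonempty tree. *)
Lemma fixed_colored_euler s t g x : x \in fixed_colored s t g ->
  (#|[set v | s v == v]| + \sum_(i < k.+1) #|[set w | (t w == w) && (x.2 w == i)]|
  = 1 + \sum_(i < k.+1) #|[set e in x.1 | (s e.1 == e.1) && (t e.2 == e.2) && (x.2 e.2 == i)]|)%N.
Proof.
move=> /fixed_coloredP[ct fx]; have /card_gt0P[w0 _] := colored_tree_white ct.
have tree : is_tree (tadj x.1) by case: ct.
have split_color (I : finType) (P : pred I) (h : I -> color) :
    (\sum_(i < k.+1) #|[set j | P j && (h j == i)]| = #|[set j | P j]|)%N.
  rewrite -[RHS]sum1_card (partition_big h xpredT) //=; apply: eq_bigr => i _.
  by rewrite -sum1_card; apply: eq_bigl => j; rewrite !inE.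
rewrite split_color (fixed_tree tree (fun u w => fixed_edge u w fx) w0) -[LHS]add1n.
congr addn; rewrite -(split_color _ _ (fun e => x.2 e.2)).
by apply: eq_bigr => i _; apply: eq_card => e; rewrite !inE -!andbA.
Qed.

Lemma recolor_conj s t g p x : x \in fixed_colored s t g ->
  recolor 1%g 1%g p x \in fixed_colored s t (g ^ p)%g.
Proof.
move=> /fixed_coloredP[ct fx]; apply/fixed_coloredP; split; first exact: recolor_tree.
by rewrite recolorM -{2}fx recolorM !mulg1 !mul1g conjgE mulKVg.
Qed.

Lemma recolor_idK p : cancel (recolor 1%g 1%g p) (@recolor k U V 1%g 1%g p^-1%g).
Proof. by move=> x; rewrite recolorM !mulg1 mulgV recolor1. Qed.

(** Recoloring by p is a bijection between the trees fixed with g and those fixed with its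
    conjugate; this makes the rooted counts invariant under conjugation. *)
Lemma sum_fixed_conj s t g p (F F' : colored -> nat) :
  (forall x, F' (recolor 1%g 1%g p x) = F x) ->
  (\sum_(x in fixed_colored s t (g ^ p)%g) F' x = \sum_(x in fixed_colored s t g) F x)%N.
Proof.
move=> FF; rewrite (reindex (recolor 1%g 1%g p)) /=; last first.
  exists (recolor 1%g 1%g p^-1%g) => x _; first exact: recolor_idK.
  by have := recolor_idK p^-1%g x; rewrite invgK.
apply: eq_big => [x|x _]; last exact: FF.
apply/idP/idP; last exact: recolor_conj.
by move=> /(recolor_conj p^-1%g); rewrite recolor_idK conjgK.
Qed.

Lemma recolor1_edges p x : (recolor 1%g 1%g p x).1 = x.1.
Proof. by apply/setP=> -[u w]; rewrite mem_recolor !invg1 !perm1. Qed.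

Lemma recolor1_color p x w : (recolor 1%g 1%g p x).2 w = p (x.2 w).
Proof. by rewrite ffunE invg1 perm1. Qed.

End FixedStructures.

(** * Averaging over the color of the root *)

Section Averaging.
Local Open Scope nat_scope.
Variable k : nat.

Lemma sum_stabilizer (D : 'S_k.+1 -> nat) : (forall g : 'S_k.+1, g ord0 != ord0 -> D g = 0) ->
  \sum_g D g = \sum_(g : 'S_k) D (lift_perm ord0 ord0 g).
Proof.
move=> D0; rewrite -(big_imset _ (in2W (@lift_perm_inj k))) /=.
rewrite [LHS](bigID (mem (lift_perm ord0 ord0 @: {: 'S_k}))) /= [X in _ + X]big1 ?addn0.
  by apply: eq_bigl => g.
move=> g; apply: contraNeq => Dg; have [/D0 Dg0|/negbNE/eqP g0] := boolP (g ord0 != ord0).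
  by rewrite Dg0 eqxx in Dg.
by have [h ->] := lift_permP g0; apply: imset_f.
Qed.

(** Conjugation by the transposition of 0 and i shows that all colors contribute alike, and at color
    0 only its stabilizer counts. The factor k+1 is the index of S_k in S_(k+1). *)
Lemma sum_over_colors (D : 'S_k.+1 -> 'I_k.+1 -> nat) :
  (forall (g p : 'S_k.+1) i, D (g ^ p)%g (p i) = D g i) ->
  (forall (g : 'S_k.+1) i, g i != i -> D g i = 0) ->
  \sum_g \sum_i D g i = k.+1 * \sum_(g : 'S_k) D (lift_perm ord0 ord0 g) ord0.
Proof.
move=> Dconj D0; rewrite exchange_big /=.
rewrite (eq_bigr (fun=> \sum_g D g ord0)) => [|i _].
  by rewrite sum_nat_const card_ord (sum_stabilizer (D := D^~ ord0)) // => g; apply: D0.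
rewrite (reindex_inj (conjg_inj (tperm ord0 i))) /=; apply: eq_bigr => g _.
by rewrite -{2}(tpermL ord0 i) Dconj.
Qed.

End Averaging.

(** * k-trees *)

Section Rank.
Local Open Scope nat_scope.

(** At a vertex of maximal rank on a cycle, both neighbors on the cycle have no larger rank, hence
    coincide. *)
Lemma acyclic_rank (T : finType) (e : rel T) (r : T -> nat) : symmetric e ->
  (forall x y z, e x y -> e x z -> r y <= r x -> r z <= r x -> y = z) ->
  forall c : seq T, ucycle e c -> size c <= 2.
Proof.
move=> e_sym uniq_low c; case: c => // x0 c0; set c := x0 :: c0 => uc.
have [x xc xmax] : exists2 x, x \in c & {in c, forall y, r y <= r x}.
  case: (@arg_maxnP _ x0 (mem c) r); first by rewrite /= mem_head.
  by move=> x xc xmax; exists x.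
have [i p cE] := rot_to xc; rewrite -(size_rot i) cE.
have : ucycle e (x :: p) by rewrite -cE rot_ucycle.
have {}xmax y : y \in p -> r y <= r x.
  by move=> yp; apply: xmax; rewrite -(mem_rot i) cE inE yp orbT.
case: p {cE} xmax => // y p xmax /andP[/=]; rewrite rcons_path => /andP[exy /andP[_ ezx]].
rewrite e_sym in ezx => /and3P[_ yp _].
have yz := uniq_low x y _ exy ezx (xmax y (mem_head _ _)) (xmax _ (mem_last _ _)).
case: p {xmax ezx} yp yz => // z p yp yz.
by have := mem_last z p; rewrite /= in yz; rewrite -yz (negPf yp).
Qed.

(** The bijection between the images is completed by one between their complements; these can be
    nonempty, as the coloring of a k-tree without hedra omits a color. *)
Lemma perm_extend (T C : finType) (f g : T -> C) :
  (forall a b, (f a == f b) = (g a == g b)) -> exists s : {perm C}, forall a, s (f a) = g a.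
Proof.
move=> fg; pose A := [set f a | a in T]; pose B := [set g a | a in T].
pose ga i := if [pick a | f a == i] is Some a then g a else i.
have gaE a : ga (f a) = g a.
  rewrite /ga; case: pickP => [b|/(_ a)]; last by rewrite eqxx.
  by rewrite fg => /eqP.
have cAB : #|A| = #|B|.
  rewrite -(@card_in_imset _ _ ga (mem A)); last first.
    move=> _ _ /imsetP[a _ ->] /imsetP[b _ ->]; rewrite !gaE => /eqP.
    by rewrite -fg => /eqP.
  apply: eq_card => i; apply/imsetP/imsetP => [[_ /imsetP[a _ ->] ->]|[a _ ->]].
    by exists a; rewrite ?gaE.
  by exists (f a); rewrite ?gaE ?imset_f.
have cCAB : #|~: A| = #|~: B| by have := cardsC A; have := cardsC B; lia.
pose h i := if i \in A then ga i else nth i (enum (~: B)) (index i (enum (~: A))).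
have h_out i : i \notin A -> h i \in ~: B.
  move=> iA; rewrite /h (negPf iA) -mem_enum mem_nth // -cardE -cCAB cardE.
  by rewrite index_mem mem_enum inE.
have h_in i : i \in A -> h i \in B.
  by move=> iA; rewrite /h iA; case/imsetP: iA => a _ ->; rewrite gaE imset_f.
have h_inj : injective h.
  move=> i j; have [iA|iA] := boolP (i \in A); have [jA|jA] := boolP (j \in A).
  - rewrite /h iA jA; case/imsetP: iA => a _ ->; case/imsetP: jA => b _ ->.
    by rewrite !gaE => /eqP; rewrite -fg => /eqP.
  - by move=> e; have := h_out j jA; rewrite -e inE h_in.
  - by move=> e; have := h_out i iA; rewrite e inE h_in.
  have ii : index i (enum (~: A)) < size (enum (~: B)).
    by rewrite -cardE -cCAB cardE index_mem mem_enum inE.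
  have jj : index j (enum (~: A)) < size (enum (~: B)).
    by rewrite -cardE -cCAB cardE index_mem mem_enum inE.
  rewrite /h (negPf iA) (negPf jA) (set_nth_default j i ii) => /eqP.
  rewrite nth_uniq ?enum_uniq // => /eqP e.
  have iM : i \in enum (~: A) by rewrite mem_enum inE.
  have jM : j \in enum (~: A) by rewrite mem_enum inE.
  by rewrite -(nth_index i iM) e nth_index.
exists (perm h_inj) => a; rewrite permE /h imset_f //.
Qed.

End Rank.

(** * Cliques and colorings along the growth of a k-tree *)

Section KTreeFacts.
Local Open Scope nat_scope.
Variables (k : nat) (T : finType).
Notation color := 'I_k.+1.
Implicit Types (e : rel T) (S Q A B P : {set T}).

Lemma cliqueP e Q : reflect {in Q &, forall x y, x != y -> e x y} (clique e Q).
Proof.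
apply: (iffP forall_inP) => [h x y xQ yQ xy|h x xQ].
  by have /forall_inP /(_ y yQ) := h x xQ; rewrite xy.
by apply/forall_inP => y yQ; apply/implyP => xy; apply: h.
Qed.

Lemma clique_sub e A B : A \subset B -> clique e B -> clique e A.
Proof. by move=> /subsetP sAB /cliqueP cB; apply/cliqueP => x y /sAB xB /sAB; apply: cB. Qed.

Definition cliques_in e S m := [set Q : {set T} | [&& Q \subset S, clique e Q & #|Q| == m]].

(** Fronts and hedra, the future vertices of the colored tree. *)
Definition node e S A := (A \in cliques_in e S k) || (A \in cliques_in e S k.+1).

Definition proper_coloring e S (h : T -> color) := {in S &, forall a b, e a b -> h a != h b}.

Lemma nodeS e S S' A : S \subset S' -> node e S A -> node e S' A.
Proof.
by rewrite /node !inE => SS' /orP[] /and3P[AS -> ->]; rewrite (subset_trans AS SS') ?orbT.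
Qed.

Lemma node_sub e S A : node e S A -> A \subset S.
Proof. by rewrite /node !inE => /orP[] /and3P[]. Qed.

Lemma node_clique e S A : node e S A -> clique e A.
Proof. by rewrite /node !inE => /orP[] /and3P[]. Qed.

Lemma node_proper e S A B : node e S A -> node e S B -> A \subset B -> A != B ->
  A \in cliques_in e S k /\ B \in cliques_in e S k.+1.
Proof.
move=> nA nB AB neAB; have AltB : #|A| < #|B|.
  by apply: proper_card; rewrite properEneq neAB.
move: nA nB; rewrite /node => /orP[hA|hA] /orP[hB|hB] //; move: (hA) (hB);
  rewrite !inE => /and3P[_ _ /eqP cA] /and3P[_ _ /eqP cB]; lia.
Qed.

Lemma missing_color (A : {set color}) i j : #|A| = k -> i \notin A -> j \notin A -> i = j.
Proof.
move=> cA iA jA; have /eqP/cards1P[l lE] : #|~: A| = 1.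
  by have := cardsC A; rewrite card_ord cA; lia.
by move/setP: lE => lE; have := lE i; have := lE j; rewrite !inE iA jA => /esym/eqP-> /esym/eqP.
Qed.

Lemma missing_color_exists (A : {set color}) : #|A| = k -> exists i, i \notin A.
Proof.
move=> cA; have /card_gt0P[i] : 0 < #|~: A| by have := cardsC A; rewrite card_ord cA; lia.
by rewrite inE; exists i.
Qed.

Lemma clique_coloring_inj e S (h : T -> color) A : proper_coloring e S h ->
  A \subset S -> clique e A -> {in A &, injective h}.
Proof.
move=> hp /subsetP AS /cliqueP cA a b aA bA /eqP; apply: contraTeq => ab.
by apply: hp; rewrite ?AS // cA.
Qed.

Definition comparable_sets A B := ((A \subset B) || (B \subset A)) && (A != B).

Section Step.
Variables (e : rel T) (S Q : {set T}) (x : T).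
Hypotheses (e_sym : symmetric e) (xS : x \notin S) (QS : Q \subset S).
Hypotheses (cQ : #|Q| = k) (Qc : clique e Q) (ex : {in S, forall y, e x y = (y \in Q)}).

Lemma step_xQ : x \notin Q. Proof. by apply: contra xS; apply: (subsetP QS). Qed.

Lemma step_card : #|x |: Q| = k.+1. Proof. by rewrite cardsU1 step_xQ cQ. Qed.

Lemma step_clique : clique e (x |: Q).
Proof.
apply/cliqueP=> a b; rewrite !inE => /orP[/eqP->|aQ] /orP[/eqP->|bQ] ab.
- by rewrite eqxx in ab.
- by rewrite ex ?(subsetP QS).
- by rewrite e_sym ex ?(subsetP QS).
by move/cliqueP: Qc; apply.
Qed.

Lemma step_hedron : x |: Q \in cliques_in e (x |: S) k.+1.
Proof. by rewrite inE step_clique step_card eqxx setUS. Qed.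

Lemma step_sub A : A \subset x |: S -> clique e A -> x \in A -> A \subset x |: Q.
Proof.
move=> /subsetP AS /cliqueP Ac xA; apply/subsetP=> y yA; rewrite !inE.
have [//|/= yx] := eqVneq y x; have := AS y yA; rewrite !inE (negPf yx) /= => yS.
by rewrite -ex // Ac // eq_sym.
Qed.

Lemma step_old A : A \subset x |: S -> x \notin A -> A \subset S.
Proof.
move=> /subsetP AS xA; apply/subsetP=> y yA; have := AS y yA; rewrite !inE.
by case/orP=> // /eqP yx; rewrite -yx yA in xA.
Qed.

(** The neighbors of x in S are those in Q, so a clique containing x lies inside x |: Q, which is
    itself a clique. *)
Lemma cliques_step m A : (A \in cliques_in e (x |: S) m) =
  (A \in cliques_in e S m) || [&& x \in A, A \subset x |: Q & #|A| == m].
Proof.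
rewrite !inE; apply/and3P/orP => [[AS Ac cA]|[/and3P[AS -> ->]|/and3P[xA AQ cA]]].
- have [xA|xA] := boolP (x \in A); first by right; rewrite cA step_sub.
  by left; rewrite step_old // Ac.
- by rewrite (subset_trans AS) // subsetUr.
by split=> //; [apply: subset_trans AQ (setUS _ QS) | apply: clique_sub step_clique].
Qed.

Lemma hedra_step : cliques_in e (x |: S) k.+1 = (x |: Q) |: cliques_in e S k.+1.
Proof.
apply/setP=> A; rewrite cliques_step in_setU1 orbC; congr orb.
apply/and3P/eqP => [[_ AQ cA]|->]; last by rewrite setU11 step_card.
by apply/eqP; rewrite eqEcard AQ step_card (eqP cA) leqnn.
Qed.

Lemma step_node A : node e (x |: S) A -> [\/ node e S A, A = x |: Q
  | [/\ x \in A, A \subset x |: Q & #|A| = k]].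
Proof.
rewrite /node !cliques_step => /orP[/orP[h|/and3P[xA AQ /eqP cA]]|/orP[h|/and3P[xA AQ /eqP cA]]].
- by apply: Or31; rewrite h.
- by apply: Or33.
- by apply: Or31; rewrite h orbT.
by apply: Or32; apply/eqP; rewrite eqEcard AQ step_card cA leqnn.
Qed.

Lemma node_old A : node e S A -> x \notin A.
Proof. by move=> /node_sub /subsetP AS; apply: contra xS; apply: AS. Qed.

Lemma front_Q : node e S Q.
Proof. by rewrite /node inE QS Qc cQ eqxx. Qed.

Lemma node_hedron : node e (x |: S) (x |: Q).
Proof. by rewrite /node step_hedron orbT. Qed.

Lemma adjacent_new_front A B : x \in A -> #|A| = k -> node e (x |: S) A ->
  node e (x |: S) B -> comparable_sets A B -> B = x |: Q.
Proof.
move=> xA cA nA nB /andP[/orP[AB|BA] neAB].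
  have [_] := node_proper nA nB AB neAB.
  rewrite cliques_step => /orP[|/and3P[_ BQ /eqP cB]].
    rewrite inE => /and3P[/subsetP BS _ _]; move/negP: xS; case.
    exact/BS/(subsetP AB).
  by apply/eqP; rewrite eqEcard BQ step_card cB leqnn.
rewrite eq_sym in neAB; have [_] := node_proper nB nA BA neAB.
by rewrite inE cA => /and3P[_ _]; rewrite eqn_leq ltnn andbF.
Qed.

Lemma adjacent_hedron B : node e S B -> comparable_sets (x |: Q) B -> B = Q.
Proof.
move=> nB /andP[/orP[QB|BQ] neQB].
  by have := node_old nB; rewrite (subsetP QB) // setU11.
have nB' := nodeS (subsetUr [set x] S) nB.
rewrite eq_sym in neQB; have [cB _] := node_proper nB' node_hedron BQ neQB.
apply/eqP; rewrite eqEcard cQ; move: cB; rewrite inE => /and3P[_ _ /eqP ->].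
rewrite leqnn andbT; apply/subsetP=> y yB; have := subsetP BQ y yB; rewrite !inE.
by case/orP=> // /eqP yx; have := node_old nB; rewrite -yx yB.
Qed.

End Step.

(** The set P is taken empty for the connectedness of the whole tree, and {a} for that of the nodes
    around a vertex a. *)
Definition node_adj e S P : rel {set T} := fun A B =>
  [&& node e S A, node e S B, P \subset A, P \subset B & comparable_sets A B].

Lemma comparable_sym : symmetric comparable_sets.
Proof. by move=> A B; rewrite /comparable_sets orbC eq_sym. Qed.

Lemma node_adj_sym e S P : symmetric (node_adj e S P).
Proof.
move=> A B; rewrite /node_adj comparable_sym.
by case: node; case: node; case: (P \subset A); case: (P \subset B).
Qed.

(** A new node containing P equals or is adjacent to the hedron x |: Q. If an old node contains P
    too, then x is not in P, so P lies in Q and the route can pass through the front Q. *)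
Lemma ktree_connected e S : symmetric e -> ktree_on k e S ->
  forall P A B, node e S A -> node e S B -> P \subset A -> P \subset B ->
  connect (node_adj e S P) A B.
Proof.
move=> e_sym; elim=> {S} [S cS Sc|S Q x _ IH xS QS cQ Qc ex] P A B.
  have only A' : node e S A' -> A' = S.
    rewrite /node !inE => /orP[] /and3P[A'S _ /eqP cA']; apply/eqP.
      by rewrite eqEcard A'S cS cA' leqnn.
    by have := subset_leq_card A'S; rewrite cA' cS ltnn.
  by move=> /only -> /only ->; rewrite connect0.
move=> nA nB PA PB; set S' := x |: S; set r := node_adj _ _ _.
have rsym := sym_connect_sym (node_adj_sym e S' P).
have up C : node e S' C -> P \subset C -> ~~ node e S C -> connect r C (x |: Q).
  move=> nC PC /negP oC; case: (step_node e_sym xS QS cQ Qc ex nC) => [//|->|[xC CQ cC]].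
    by rewrite connect0.
  apply: connect1; rewrite /r /node_adj nC node_hedron // PC (subset_trans PC CQ).
  rewrite /comparable_sets CQ /=; apply/eqP => CE.
  by move: cC; rewrite CE (step_card xS QS cQ) => /eqP; rewrite eqn_leq ltnn.
have old C D : node e S C -> node e S D -> P \subset C -> P \subset D -> connect r C D.
  move=> nC nD PC PD; apply: connect_sub (IH P C D nC nD PC PD) => C' D'.
  move=> /and5P[nC' nD' PC' PD' cCD]; apply: connect1.
  by rewrite /r /node_adj !(nodeS (subsetUr [set x] S)) // PC' PD' cCD.
have mixed C D : node e S' C -> ~~ node e S C -> node e S D ->
    P \subset C -> P \subset D -> connect r C D.
  move=> nC nwC oD PC PD.
  have xP : x \notin P by apply: contra (node_old xS oD); apply: (subsetP PD).
  have PQ : P \subset x |: Q.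
    case: (step_node e_sym xS QS cQ Qc ex nC) => [oC|<- //|[_ CQ _]]; first by rewrite oC in nwC.
    exact: subset_trans CQ.
  have PQ' : P \subset Q.
    apply/subsetP=> y yP; have := subsetP PQ y yP; rewrite !inE => /orP[/eqP yx|//].
    by rewrite -yx yP in xP.
  apply: connect_trans (up C nC PC nwC) _.
  apply: (connect_trans (y := Q)); last by apply: old => //; apply: front_Q.
  apply: connect1; rewrite /r /node_adj node_hedron // PQ PQ' /=.
  rewrite (nodeS (subsetUr [set x] S)) ?front_Q //= /comparable_sets subsetUr orbT /=.
  by apply/eqP => QE; have := step_xQ xS QS; rewrite -QE setU11.
have [oA|nwA] := boolP (node e S A); have [oB|nwB] := boolP (node e S B).
- exact: old.
- by rewrite rsym; apply: mixed.
- exact: mixed.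
apply: connect_trans (up A nA PA nwA) _; rewrite rsym; exact: up.
Qed.

(* Adding a vertex x joined to Q creates one hedron, adjacent to the single old
   front Q, and fronts adjacent to that hedron only; ranking the nodes by order
   of creation makes every node adjacent to at most one node of smaller rank. *)
Lemma ktree_rank e S : symmetric e -> ktree_on k e S -> exists r : {set T} -> nat,
  forall A B B', node e S A -> node e S B -> node e S B' ->
  comparable_sets A B -> comparable_sets A B' -> r B <= r A -> r B' <= r A -> B = B'.
Proof.
move=> e_sym; elim=> {S} [S cS Sc|S Q x _ [r IH] xS QS cQ Qc ex].
  exists (fun=> 0) => A B B' nA nB; have only A' : node e S A' -> A' = S.
    rewrite /node !inE => /orP[] /and3P[A'S _ /eqP cA']; apply/eqP.
      by rewrite eqEcard A'S cS cA' leqnn.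
    by have := subset_leq_card A'S; rewrite cA' cS ltnn.
  by move=> nB' _ _ _ _; rewrite (only B nB) (only B' nB').
pose M := \max_(A : {set T}) r A.
have rM A : r A <= M by apply: (leq_bigmax A).
(* The new hedron ranks after all old nodes and before its new fronts, so that Q is its only
   neighbor of rank at most M + 1. *)
pose r' (A : {set T}) := if x \in A then if A == x |: Q then M.+1 else M.+2 else r A.
exists r' => A B B' nA nB nB' cAB cAB'.
have sn := step_node e_sym xS QS cQ Qc ex.
have r'old C : node e (x |: S) C -> ~~ node e S C -> M < r' C.
  move=> nC oC; rewrite /r'; case: (sn C nC) => [h|->|[-> _ _]].
  - by rewrite h in oC.
  - by rewrite setU11 eqxx.
  by case: ifP.
have r'le C : node e S C -> r' C = r C by move=> nC; rewrite /r' (negPf (node_old xS nC)).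
have low C : node e (x |: S) C -> r' C <= M -> node e S C.
  by move=> nC; apply: contraTT => oC; rewrite -ltnNge; apply: r'old.
case: (sn A nA) => [oA|AE|[xA AQ cA]].
- rewrite (r'le A oA) => rB rB'.
  have oB := low B nB (leq_trans rB (rM A)); have oB' := low B' nB' (leq_trans rB' (rM A)).
  by rewrite !r'le // in rB rB'; apply: IH rB'.
- have rA : r' A = M.+1 by rewrite /r' AE setU11 eqxx.
  rewrite rA; have is_Q C : node e (x |: S) C -> comparable_sets A C -> r' C <= M.+1 -> C = Q.
    move=> nC cAC rC; have [oC|oC] := boolP (node e S C).
      by apply: (adjacent_hedron e_sym xS QS cQ Qc ex oC); rewrite -AE.
    case: (sn C nC) => [h|CE|[xC CQ cC]]; first by rewrite h in oC.
      by move: cAC; rewrite AE CE /comparable_sets eqxx andbF.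
    move: rC; rewrite /r' xC; case: eqP => [CE|_]; last by rewrite ltnn.
    by move: cC; rewrite CE (step_card xS QS cQ) => /eqP; rewrite eqn_leq ltnn.
  by move=> rB rB'; rewrite (is_Q B) // (is_Q B').
have new C : node e (x |: S) C -> comparable_sets A C -> C = x |: Q.
  by move=> nC; apply: (adjacent_new_front e_sym xS QS cQ Qc ex).
by move=> _ _; rewrite (new B) // (new B').
Qed.

Lemma ktree_card_hedra e S : symmetric e -> ktree_on k e S ->
  #|S| = #|cliques_in e S k.+1| + k.
Proof.
move=> e_sym; elim=> {S} [S cS Sc|S Q x _ IH xS QS cQ Qc ex].
  rewrite cS (_ : cliques_in _ _ _ = set0) ?cards0 //; apply/setP=> A; rewrite !inE.
  apply/negP => /and3P[AS _ /eqP cA]; have := subset_leq_card AS.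
  by rewrite cA cS ltnn.
rewrite (hedra_step e_sym xS QS cQ Qc ex) !cardsU1 xS IH addnA; congr (_ + _ + _).
suff -> : x |: Q \notin cliques_in e S k.+1 by [].
by apply/negP; rewrite inE => /and3P[/subsetP /(_ x (setU11 _ _))]; rewrite (negPf xS).
Qed.

(** The new vertex lies in the front obtained from x |: Q by dropping some y of Q; such a y exists
    as k > 0. *)
Lemma clique_in_node e S : 0 < k -> symmetric e -> ktree_on k e S ->
  (forall a, a \in S -> exists2 A, A \in cliques_in e S k & a \in A) /\
  (forall a b, a \in S -> b \in S -> e a b -> exists A, [/\ node e S A, a \in A & b \in A]).
Proof.
move=> k0 e_sym; elim=> {S} [S cS Sc|S Q x _ [IH1 IH2] xS QS cQ Qc ex].
  have SS : S \in cliques_in e S k by rewrite inE subxx Sc cS eqxx.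
  by split=> [a aS|a b aS bS _]; exists S; rewrite // /node SS.
have sub A : node e S A -> node e (x |: S) A by apply: nodeS; apply: subsetUr.
have xH b : b \in Q -> exists A, [/\ node e (x |: S) A, x \in A & b \in A].
  by move=> bQ; exists (x |: Q); rewrite node_hedron // !inE bQ eqxx orbT.
split=> [a|a b]; rewrite !inE => /orP[/eqP->|aS].
- have [y yQ] : exists y, y \in Q by apply/card_gt0P; rewrite cQ.
  exists ((x |: Q) :\ y).
    rewrite (cliques_step e_sym QS Qc ex); apply/orP; right.
    rewrite subD1set !inE eqxx andbT; apply/andP; split.
      by apply: contraTneq yQ => <-; apply: step_xQ xS QS.
    by have := cardsD1 y (x |: Q); rewrite (step_card xS QS cQ) !inE yQ orbT; lia.
  by rewrite !inE eqxx andbT; apply: contraTneq yQ => <-; apply: step_xQ xS QS.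
- have [A hA aA] := IH1 a aS; exists A => //.
  by rewrite (cliques_step e_sym QS Qc ex) hA.
- move=> /orP[/eqP->|bS exb]; last by apply: xH; rewrite -ex.
  move=> _; have [y yQ] : exists y, y \in Q by apply/card_gt0P; rewrite cQ.
  by have [A [nA xA _]] := xH y yQ; exists A.
move=> /orP[/eqP-> eax|bS eab].
  have [|A [nA xA aA]] := xH a; last by exists A.
  by rewrite -ex // e_sym.
by have [A [nA aA bA]] := IH2 a b aS bS eab; exists A; rewrite sub.
Qed.

Lemma ktree_colorable e S : symmetric e -> irreflexive e -> ktree_on k e S ->
  exists h, proper_coloring e S h.
Proof.
move=> e_sym e_irr; elim=> {S} [S cS Sc|S Q x _ [h hp] xS QS cQ Qc ex].
  exists (fun a => inord (index a (enum S))) => a b aS bS; apply: contraTneq => /(congr1 val).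
  have lt c : c \in S -> index c (enum S) < k.+1.
    by move=> cS'; rewrite -cS cardE ltnS index_size.
  rewrite /= !inordK ?lt // => /(congr1 (nth a (enum S))).
  by rewrite !nth_index ?mem_enum // => ->; rewrite e_irr.
have cC : #|h @: Q| = k.
  by rewrite card_in_imset //; apply: clique_coloring_inj hp QS Qc.
have [i iQ] := missing_color_exists cC.
have xne a : a \in S -> a != x by move=> aS; apply: contraNneq xS => <-.
have iex b : b \in S -> e x b -> i != h b.
  by move=> bS; rewrite ex // => bQ; apply: contraNneq iQ => ->; apply: imset_f.
exists (fun a => if a == x then i else h a) => a b; rewrite !inE.
move=> /orP[/eqP->|aS] /orP[/eqP->|bS].
- by rewrite e_irr.
- by rewrite eqxx (negPf (xne b bS)); apply: iex.
- by rewrite eqxx (negPf (xne a aS)) e_sym eq_sym; apply: iex.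
by rewrite (negPf (xne a aS)) (negPf (xne b bS)); apply: hp.
Qed.

(** Uniqueness up to a permutation of colors, stated as equality of kernels. In the step, x and c
    agree exactly when the color of c is absent from Q, since only one color is missing there. *)
Lemma ktree_coloring_unique e S h h' : symmetric e -> ktree_on k e S ->
  proper_coloring e S h -> proper_coloring e S h' ->
  {in S &, forall a b, (h a == h b) = (h' a == h' b)}.
Proof.
move=> e_sym; elim=> {S} [S cS Sc|S Q x _ IH xS QS cQ Qc ex] hp hp' a b.
  move=> aS bS; rewrite !(inj_in_eq (clique_coloring_inj _ (subxx S) Sc)) //.
have hpS : proper_coloring e S h by move=> c d cS dS; apply: hp; rewrite inE (cS, dS) orbT.
have hpS' : proper_coloring e S h' by move=> c d cS dS; apply: hp'; rewrite inE (cS, dS) orbT.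
have eqx g c : proper_coloring e (x |: S) g -> c \in S ->
    (g x == g c) = [forall z in Q, g c != g z].
  move=> gp cS; have gpS : proper_coloring e S g.
    by move=> c' d cS' dS; apply: gp; rewrite inE (cS', dS) orbT.
  have xg z : z \in Q -> g x != g z.
    by move=> zQ; apply: gp; rewrite ?setU11 ?inE ?(subsetP QS) ?orbT // ex ?(subsetP QS).
  apply/eqP/forall_inP => [<- z zQ|gc]; first exact: xg.
  apply: (@missing_color (g @: Q)).
  - by rewrite card_in_imset //; apply: clique_coloring_inj gpS QS Qc.
  - by apply/imsetP => -[z /xg /eqP h1 h2].
  by apply/imsetP => -[z /gc /eqP h1 h2].
have eqx' c : c \in S -> (h x == h c) = (h' x == h' c).
  move=> cS; rewrite !eqx //; apply: eq_forallb => z; case: (boolP (z \in Q)) => //= zQ.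
  by congr (~~ _); apply: (IH hpS hpS') => //; apply: (subsetP QS).
rewrite !inE => /orP[/eqP->|aS] /orP[/eqP->|bS].
- by rewrite !eqxx.
- exact: eqx'.
- by rewrite [h a == _]eq_sym [h' a == _]eq_sym; apply: eqx'.
exact: IH.
Qed.

Lemma ktree_on_eq e e' S : {in S &, e =2 e'} -> ktree_on k e S -> ktree_on k e' S.
Proof.
have eq_clique (A B : {set T}) : {in B &, e =2 e'} -> A \subset B -> clique e A -> clique e' A.
  move=> ee /subsetP AB /cliqueP cA; apply/cliqueP => a b aA bA ab.
  by rewrite -ee ?AB // cA.
move=> ee kS; elim: kS ee => {S} [S cS Sc|S Q x _ IH xS QS cQ Qc ex] ee.
  by apply: ktree_base => //; apply: eq_clique ee (subxx S) Sc.
have eeS : {in S &, e =2 e'} by move=> a b aS bS; apply: ee; rewrite inE (aS, bS) orbT.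
apply: (ktree_step (Q := Q)) => //; [exact: IH | exact: eq_clique eeS QS Qc|].
by move=> y yS; rewrite -ee ?setU11 ?inE ?yS ?orbT // ex.
Qed.

End KTreeFacts.

(** * The colored tree of a k-tree *)

Section Codes.
Local Open Scope nat_scope.
Variables (k : nat) (T U V : finType).
Hypothesis k_gt0 : 0 < k.
Notation color := 'I_k.+1.
Notation colored := ({set U * V} * {ffun V -> color})%type.
Implicit Types (e : rel T) (S : {set T}) (B : {set U}) (W : {set V}) (x : colored).
Implicit Types (h : T -> color) (H : U -> {set T}) (F : V -> {set T}).

(* The black vertices in B name the hedra of the subgraph induced on S, and the
   white ones in W name its fronts; a front is colored by its missing color. *)
Definition codes_on S B W e x h H F : Prop :=
  [/\ {in B &, injective H} /\ H @: B = cliques_in e S k.+1,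
      {in W &, injective F} /\ F @: W = cliques_in e S k,
      {in B, forall u, {in W, forall w, ((u, w) \in x.1) = (F w \subset H u)}},
      proper_coloring e S h
    & {in W, forall w, {in F w, forall a, h a != x.2 w}}].

Definition codes := codes_on setT setT setT.

Section CodesFacts.
Variables (e : rel T) (x : colored) (h : T -> color) (H : U -> {set T}) (F : V -> {set T}).
Hypotheses (e_sym : symmetric e) (e_irr : irreflexive e) (kt : ktree_on k e setT).
Hypothesis cd : codes e x h H F.

Lemma codes_hedron u : H u \in cliques_in e setT k.+1.
Proof. by case: cd => [[_ <-]] *; apply: imset_f. Qed.

Lemma codes_front w : F w \in cliques_in e setT k.
Proof. by case: cd => _ [_ <-] *; apply: imset_f. Qed.

Lemma codes_hedronP A : A \in cliques_in e setT k.+1 -> exists u, A = H u.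
Proof. by case: cd => [[_ <-]] _ _ _ _ /imsetP[u _ ->]; exists u. Qed.

Lemma codes_frontP A : A \in cliques_in e setT k -> exists w, A = F w.
Proof. by case: cd => _ [_ <-] _ _ _ /imsetP[w _ ->]; exists w. Qed.

Lemma codes_edge u w : ((u, w) \in x.1) = (F w \subset H u).
Proof. by case: cd => _ _ h1 _ _; rewrite h1 ?inE. Qed.

Lemma codes_H_inj : injective H.
Proof. by case: cd => [[hi _]] _ _ _ _ u u'; apply: hi; rewrite inE. Qed.

Lemma codes_F_inj : injective F.
Proof. by case: cd => _ [hi _] _ _ _ w w'; apply: hi; rewrite inE. Qed.

Lemma codes_proper : proper_coloring e setT h. Proof. by case: cd. Qed.

Lemma codes_card_H u : #|H u| = k.+1.
Proof. by have := codes_hedron u; rewrite inE => /and3P[_ _ /eqP]. Qed.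

Lemma codes_card_F w : #|F w| = k.
Proof. by have := codes_front w; rewrite inE => /and3P[_ _ /eqP]. Qed.

Lemma codes_missing w a : a \in F w -> h a != x.2 w.
Proof. by case: cd => _ _ _ _ hm aF; apply: (hm w). Qed.

Definition code_node (v : U + V) : {set T} :=
  match v with inl u => H u | inr w => F w end.

Lemma code_node_node v : node k e setT (code_node v).
Proof. by case: v => [u|w]; rewrite /node ?codes_hedron ?codes_front ?orbT. Qed.

Lemma code_node_inj : injective code_node.
Proof.
move=> [u|w] [u'|w'] /=; [by move=> /codes_H_inj->| | |by move=> /codes_F_inj->].
  by move=> e1; have := codes_card_H u; rewrite e1 codes_card_F => /eqP; rewrite eqn_leq ltnn andbF.
by move=> e1; have := codes_card_H u'; rewrite -e1 codes_card_F => /eqP; rewrite eqn_leq ltnn andbF.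
Qed.

Lemma code_nodeP A : node k e setT A -> exists v, A = code_node v.
Proof.
rewrite /node => /orP[/codes_frontP[w ->]|/codes_hedronP[u ->]]; first by exists (inr w).
by exists (inl u).
Qed.

Lemma code_node_coloring_inj v : {in code_node v &, injective h}.
Proof.
have nv := code_node_node v.
exact: clique_coloring_inj codes_proper (node_sub nv) (node_clique nv).
Qed.

Lemma code_node_adj v v' : tadj x.1 v v' = comparable_sets (code_node v) (code_node v').
Proof.
have cmp u w : ((u, w) \in x.1) = comparable_sets (H u) (F w).
  rewrite codes_edge /comparable_sets; have HF : H u != F w.
    apply/eqP=> HF; have := codes_card_H u; rewrite HF codes_card_F => /eqP.
    by rewrite eqn_leq ltnn andbF.
  rewrite HF andbT; case: (boolP (H u \subset F w)) => // /subset_leq_card.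
  by rewrite codes_card_H codes_card_F ltnn.
have eqc (A A' : {set T}) : #|A| = #|A'| -> comparable_sets A A' = false.
  move=> cA; rewrite /comparable_sets; apply/negbTE/negP => /andP[/orP[s|s] /eqP[]].
    by apply/eqP; rewrite eqEcard s cA leqnn.
  by apply/esym/eqP; rewrite eqEcard s cA leqnn.
case: v v' => [u|w] [u'|w'] /=.
- by rewrite eqc // !codes_card_H.
- exact: cmp.
- by rewrite cmp comparable_sym.
by rewrite eqc // !codes_card_F.
Qed.

Lemma codes_connect (P : {set T}) v v' : P \subset code_node v -> P \subset code_node v' ->
  connect (within (tadj x.1) (fun v1 => P \subset code_node v1)) v v'.
Proof.
move=> Pv Pv'; have := ktree_connected e_sym kt (code_node_node v) (code_node_node v') Pv Pv'.
move=> /connectP[p pp ep].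
suff [v1 e1 c1] : exists2 v1, code_node v1 = last (code_node v) p &
    connect (within (tadj x.1) (fun v1 => P \subset code_node v1)) v v1.
  by rewrite -ep in e1; rewrite -(code_node_inj e1).
elim/last_ind: p pp {ep} => [|p A IH] /=; first by exists v.
rewrite rcons_path last_rcons => /andP[/IH[v1 e1 c1]].
rewrite -e1 => /and5P[_ /code_nodeP[v2 ->] P1 P2 cmp]; exists v2 => //.
by apply: (connect_trans c1); apply: connect1; rewrite /= P1 P2 code_node_adj.
Qed.

Lemma codes_is_tree : is_tree (tadj x.1).
Proof.
split.
- have [A /andP[Ac cA]] : exists A, clique e A && (#|A| == k).
    by elim: kt => [S cS Sc|S Q y _ //]; exists S; rewrite Sc cS eqxx.
  have [w _] : exists w, A = F w by apply: codes_frontP; rewrite inE subsetT Ac cA.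
  by apply/card_gt0P; exists (inr w).
- move=> v v'; have := codes_connect (sub0set (code_node v)) (sub0set (code_node v')).
  by apply: connect_sub => a b /and3P[_ _ ab]; apply: connect1.
have [r rP] := ktree_rank e_sym kt.
apply: (acyclic_rank (r := fun v => r (code_node v)) (@tadj_sym _ _ x.1)) => v v1 v2.
rewrite !code_node_adj => c1 c2 r1 r2; apply: code_node_inj.
by apply: rP c1 c2 r1 r2; apply: code_node_node.
Qed.

(** The neighbors of a hedron are its k+1 subsets of size k, and inside the hedron each is recovered
    from its one missing color. *)
Lemma codes_colored_tree : colored_tree x.
Proof.
split; first exact: codes_is_tree.
- move=> u; rewrite -(card_imset _ codes_F_inj).
  transitivity #|[set A : {set T} | A \subset H u & #|A| == k]|; last first.
    by rewrite cards_draws codes_card_H binSn.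
  apply: eq_card => A; rewrite inE; apply/imsetP/andP => [[w]|[AH cA]].
    by rewrite inE codes_edge => FH ->; rewrite FH codes_card_F.
  have [w Aw] : exists w, A = F w.
    apply: codes_frontP; rewrite inE subsetT cA andbT.
    by apply: clique_sub AH (node_clique (code_node_node (inl u))).
  by exists w; rewrite // inE codes_edge -Aw.
move=> u w w'; rewrite !inE !codes_edge => wH w'H cww'.
have h_inj := @code_node_coloring_inj (inl u).
apply: codes_F_inj; have Fw w1 : F w1 \subset H u -> h @: F w1 = ~: [set x.2 w1].
  move=> w1H; apply/eqP; rewrite eqEcard; apply/andP; split.
    apply/subsetP=> _ /imsetP[a aF ->]; rewrite !inE; exact: codes_missing.
  rewrite cardsC1 card_ord card_in_imset ?codes_card_F //.
  exact: (@code_node_coloring_inj (inr w1)).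
have sub w1 w2 : F w1 \subset H u -> F w2 \subset H u -> x.2 w1 = x.2 w2 -> F w1 \subset F w2.
  move=> h1 h2 c12; apply/subsetP=> a aF.
  have : h a \in h @: F w2 by rewrite Fw // -c12 -Fw // imset_f.
  case/imsetP=> b bF hab; rewrite (h_inj a b) //; first exact: (subsetP h1).
  exact: (subsetP h2).
by apply/eqP; rewrite eqEsubset !sub.
Qed.

Lemma codes_front_color w i : i != x.2 w -> exists2 a, a \in F w & h a = i.
Proof.
move=> iw; suff : i \in h @: F w by case/imsetP=> a aF ->; exists a.
apply: contraNT iw => iF; apply/eqP/(missing_color _ iF).
  rewrite card_in_imset ?codes_card_F //; exact: (@code_node_coloring_inj (inr w)).
by apply/imsetP => -[a /codes_missing /eqP h1 h2]; apply: h1.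
Qed.

Lemma codes_hedron_color u i : exists2 a, a \in H u & h a = i.
Proof.
suff : i \in h @: H u by case/imsetP=> a aH ->; exists a.
suff -> : h @: H u = setT by rewrite inE.
apply/eqP; rewrite eqEcard subsetT cardsT card_ord.
by rewrite (card_in_imset (@code_node_coloring_inj (inl u))) codes_card_H leqnn.
Qed.

Lemma codes_node_color v a b : a \in code_node v -> b \in code_node v -> h a = h b -> a = b.
Proof. by move=> av bv; apply: (code_node_coloring_inj (v := v)). Qed.

Lemma codes_in_front a : exists w, a \in F w.
Proof.
have [h1 _] := clique_in_node k_gt0 e_sym kt.
by have [A /codes_frontP[w ->] aA] := h1 a (in_setT a); exists w.
Qed.

Lemma codes_in_node a b : e a b -> exists v, a \in code_node v /\ b \in code_node v.
Proof.
have [_ h2] := clique_in_node k_gt0 e_sym kt.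
move=> ab; have [A [/code_nodeP[v ->] aA bA]] := h2 a b (in_setT a) (in_setT b) ab.
by exists v.
Qed.

End CodesFacts.

Lemma codes_exists e : symmetric e -> irreflexive e -> ktree_on k e setT ->
  #|cliques_in e setT k.+1| = #|U| -> #|cliques_in e setT k| = #|V| ->
  exists x h H F, codes e x h H F.
Proof.
move=> e_sym e_irr kt cH cF.
have naming (I : finType) (C : {set {set T}}) : #|C| = #|I| ->
    exists2 f : I -> {set T}, injective f & f @: setT = C.
  move=> cI; exists (fun i => enum_val (cast_ord (esym cI) (enum_rank i))).
    by move=> i j /enum_val_inj /cast_ord_inj /enum_rank_inj.
  apply/setP=> A; apply/imsetP/idP => [[i _ ->]|AC]; first exact: enum_valP.
  exists (enum_val (cast_ord cI (enum_rank_in AC A))) => //.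
  by rewrite enum_valK cast_ordK enum_rankK_in.
have [H H_inj HE] := naming _ _ cH; have [F F_inj FE] := naming _ _ cF.
have [h hp] := ktree_colorable e_sym e_irr kt.
have cl w : F w \in cliques_in e setT k by rewrite -FE imset_f.
have missing w : exists i, i \notin h @: F w.
  apply: missing_color_exists; have := cl w; rewrite inE => /and3P[FS Fc /eqP cFw].
  by rewrite card_in_imset //; apply: clique_coloring_inj hp FS Fc.
have [c cP] := boolp.choice missing.
exists ([set ew | F ew.2 \subset H ew.1], [ffun w => c w]), h, H, F; split=> //.
- by split=> // u u' _ _; apply: H_inj.
- by split=> // w w' _ _; apply: F_inj.
- by move=> u _ w _; rewrite inE.
by move=> w _ a aF; rewrite ffunE; apply: contraNneq (cP w) => <-; apply: imset_f.
Qed.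

End Codes.

(** * Isomorphisms of k-trees against recolorings of their codes *)

Section CodesIso.
Local Open Scope nat_scope.
Variables (k : nat) (T U V : finType).
Hypothesis k_gt0 : 0 < k.
Notation color := 'I_k.+1.
Notation colored := ({set U * V} * {ffun V -> color})%type.

Definition act_node (s : {perm U}) (t : {perm V}) (v : U + V) : U + V :=
  match v with inl u => inl (s u) | inr w => inr (t w) end.

(* A vertex a of color i is determined by any node which contains it, and the
   nodes containing a are connected: so is the vertex of color [g i] common to
   the images of these nodes. *)
Lemma codes_map (e e' : rel T) (x x' : colored) h h' H H' F F' s t g :
  symmetric e -> ktree_on k e setT -> codes e x h H F -> codes e' x' h' H' F' ->
  x' = recolor s t g x ->
  exists f : T -> T, forall v a, a \in code_node H F v ->
    f a \in code_node H' F' (act_node s t v) /\ h' (f a) = g (h a).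
Proof.
move=> e_sym kt cd cd' xx'.
have adj v v' : tadj x'.1 (act_node s t v) (act_node s t v') = tadj x.1 v v'.
  by case: v v' => [u|w] [u'|w'] //=; rewrite xx' mem_recolor !permK.
have color_in v a : a \in code_node H F v ->
    exists2 b, b \in code_node H' F' (act_node s t v) & h' b = g (h a).
  case: v => [u|w] /= aN; first exact: codes_hedron_color cd' (s u) (g (h a)).
  apply: (codes_front_color cd'); rewrite xx' ffunE permK.
  by apply: contraNneq (codes_missing cd aN) => /perm_inj ->.
suff total a : exists b, forall v, a \in code_node H F v ->
    b \in code_node H' F' (act_node s t v) /\ h' b = g (h a).
  by have [f fP] := boolp.choice total; exists f => v a; apply: fP.
have [w aF] := codes_in_front k_gt0 e_sym kt cd a.
have [b bF cb] := color_in (inr w) a aF; exists b => v av; split=> //.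
have := codes_connect e_sym kt cd (P := [set a]) (v := inr w) (v' := v).
rewrite !sub1set => /(_ aF av) /connectP[p pp ->].
elim/last_ind: p pp => [|p v1 IH] //=; rewrite rcons_path last_rcons.
move=> /andP[/IH{}IH /and3P[_ a1 ad]]; rewrite sub1set in a1.
have [b1 b1N cb1] := color_in v1 a a1.
rewrite -adj (code_node_adj cd') in ad.
case/andP: ad => /orP[/subsetP sub|/subsetP sub] _; first exact: sub.
by rewrite (codes_node_color cd' IH (sub _ b1N)) // cb cb1.
Qed.

(** The vertex maps given by the recoloring and by its inverse are mutually inverse, as a vertex is
    known from its color and one node containing it. Adjacency is preserved because adjacent
    vertices share a node, and nodes are cliques. *)
Lemma codes_graph_iso (e e' : rel T) (x x' : colored) h h' H H' F F' s t g :
  symmetric e -> irreflexive e -> ktree_on k e setT ->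
  symmetric e' -> irreflexive e' -> ktree_on k e' setT ->
  codes e x h H F -> codes e' x' h' H' F' -> x' = recolor s t g x ->
  exists p : {perm T}, forall a b, e' (p a) (p b) = e a b.
Proof.
move=> e_sym e_irr kt e_sym' e_irr' kt' cd cd' xx'.
have x'x : x = recolor s^-1%g t^-1%g g^-1%g x' by rewrite xx' recolorM !mulgV recolor1.
have [f fP] := codes_map e_sym kt cd cd' xx'.
have [f' fP'] := codes_map e_sym' kt' cd' cd x'x.
have actK : cancel (act_node s t) (act_node s^-1%g t^-1%g).
  by case=> [u|w] /=; rewrite permK.
have actKV : cancel (act_node s^-1%g t^-1%g) (act_node s t).
  by case=> [u|w] /=; rewrite permKV.
have fK : cancel f f'.
  move=> a; have [w aF] := codes_in_front k_gt0 e_sym kt cd a.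
  have [faN cfa] := fP (inr w) a aF; have [] := fP' _ _ faN; rewrite actK => ffaN cffa.
  by apply: (codes_node_color cd ffaN aF); rewrite cffa cfa permK.
have fK' : cancel f' f.
  move=> a; have [w aF] := codes_in_front k_gt0 e_sym' kt' cd' a.
  have [faN cfa] := fP' (inr w) a aF; have [] := fP _ _ faN; rewrite actKV => ffaN cffa.
  by apply: (codes_node_color cd' ffaN aF); rewrite cffa cfa permKV.
exists (perm (can_inj fK)) => a b; rewrite !permE; apply/idP/idP => ab.
  have [v [/fP'[+ _] /fP'[+ _]]] := codes_in_node k_gt0 e_sym' kt' cd' ab.
  rewrite !fK => aN bN; have cl v' := elimT (cliqueP _ _) (node_clique (code_node_node cd v')).
  by apply: cl aN bN _; apply: contraTneq ab => ->; rewrite e_irr'.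
have [v [/fP[aN _] /fP[bN _]]] := codes_in_node k_gt0 e_sym kt cd ab.
have cl v' := elimT (cliqueP _ _) (node_clique (code_node_node cd' v')).
apply: cl aN bN _.
by apply: contraTneq ab => /(can_inj fK) ->; rewrite e_irr.
Qed.

(** An isomorphism permutes hedra and fronts, which gives s and t. It pulls h' back to a proper
    coloring of the first graph, which differs from h by some g. *)
Lemma codes_colored_iso (e e' : rel T) (x x' : colored) h h' H H' F F' (p : {perm T}) :
  symmetric e -> ktree_on k e setT ->
  codes e x h H F -> codes e' x' h' H' F' -> (forall a b, e' (p a) (p b) = e a b) ->
  exists s t g, x' = recolor s t g x.
Proof.
move=> e_sym kt cd cd' pe.
have im m A : A \in cliques_in e setT m -> p @: A \in cliques_in e' setT m.
  rewrite !inE => /and3P[_ /cliqueP cA cardA]; rewrite subsetT card_imset ?cardA ?andbT /=.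
    apply/cliqueP => _ _ /imsetP[a aA ->] /imsetP[b bA ->] ab; rewrite pe cA //.
    by apply: contraNneq ab => ->.
  exact: perm_inj.
have p_inj : injective (fun A : {set T} => p @: A) by apply: imset_inj; apply: perm_inj.
have /boolp.choice[s0 sP] u : exists u', p @: H u = H' u'.
  by apply: (codes_hedronP cd'); apply: im; apply: codes_hedron cd u.
have /boolp.choice[t0 tP] w : exists w', p @: F w = F' w'.
  by apply: (codes_frontP cd'); apply: im; apply: codes_front cd w.
have s_inj : injective s0.
  by move=> u u' su; apply: (codes_H_inj cd); apply: p_inj; rewrite /= !sP su.
have t_inj : injective t0.
  by move=> w w' tw; apply: (codes_F_inj cd); apply: p_inj; rewrite /= !tP tw.
have hp' : proper_coloring e setT (h' \o p).
  by move=> a b _ _ ab; apply: (codes_proper cd'); rewrite ?inE ?pe.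
have [g gP] : exists g : 'S_k.+1, forall a, g (h a) = h' (p a).
  apply: perm_extend => a b.
  exact: (ktree_coloring_unique e_sym kt (codes_proper cd) hp' (in_setT a) (in_setT b)).
exists (perm s_inj), (perm t_inj), g.
rewrite [LHS]surjective_pairing [RHS]surjective_pairing; congr pair.
  apply/setP=> -[u' w']; rewrite mem_recolor -{1}[u'](permKV (perm s_inj)) -{1}[w'](permKV (perm t_inj)).
  move: ((perm s_inj)^-1%g u') ((perm t_inj)^-1%g w') => u w.
  rewrite !permE (codes_edge cd') (codes_edge cd) -sP -tP; apply/idP/idP; last exact: imsetS.
  move=> /subsetP sub; apply/subsetP => a aF.
  by have /imsetP[b bH /perm_inj ->] := sub _ (imset_f p aF).
apply/ffunP=> w'; rewrite [RHS]ffunE -{1}[w'](permKV (perm t_inj)).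
move: ((perm t_inj)^-1%g w') => w; rewrite permE.
have inj' : {in F' (t0 w) &, injective h'} by apply: (code_node_coloring_inj cd' (v := inr (t0 w))).
apply: (@missing_color _ (h' @: F' (t0 w))).
- by rewrite (card_in_imset inj') (codes_card_F cd').
- by apply/imsetP => -[a /(codes_missing cd') /eqP ne /esym].
apply/imsetP => -[a]; rewrite -tP => /imsetP[b bF ->]; rewrite -gP => /perm_inj cb.
by have := codes_missing cd bF; rewrite -cb eqxx.
Qed.

End CodesIso.

(** * From colored trees back to k-trees *)

Section Construction.
Local Open Scope nat_scope.
Variables (k : nat) (T U V : finType).
Notation color := 'I_k.+1.
Notation colored := ({set U * V} * {ffun V -> color})%type.
Implicit Types (e : rel T) (S : {set T}) (B : {set U}) (W : {set V}).

Lemma cliques_in_eq e e' S m : {in S &, e =2 e'} -> cliques_in e S m = cliques_in e' S m.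
Proof.
move=> ee; apply/setP=> A; rewrite !inE; case: (boolP (A \subset S)) => //= /subsetP AS.
congr (_ && _); apply/cliqueP/cliqueP => h a b aA bA ab; last by rewrite ee ?AS ?h.
by rewrite -ee ?AS ?h.
Qed.

(** A complete graph on k vertices, named w0, receives the k colors other than that of w0. *)
Lemma codes_on_start (x : colored) (w0 : V) S : #|S| = k ->
  exists e h H F, [/\ symmetric e, irreflexive e, ktree_on k e S
                    & codes_on S set0 [set w0] e x h H F].
Proof.
move=> cS; pose e a b := [&& a \in S, b \in S & a != b].
pose h a := nth (x.2 w0) (enum [set~ x.2 w0]) (index a (enum S)).
have lt a : a \in S -> index a (enum S) < size (enum [set~ x.2 w0]).
  by move=> aS; rewrite -cardE cardsC1 card_ord -cS cardE index_mem mem_enum.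
have only A : A \in cliques_in e S k -> A = S.
  rewrite inE => /and3P[AS _ /eqP cA]; apply/eqP.
  by rewrite eqEcard AS cS cA leqnn.
have Sc : clique e S by apply/cliqueP => a b aS bS ab; rewrite /e aS bS.
exists e, h, (fun=> set0), (fun=> S); split.
- by move=> a b; rewrite /e eq_sym andbCA.
- by move=> a; rewrite /e eqxx !andbF.
- exact: ktree_base.
split.
- split=> [u u'|]; first by rewrite inE.
  rewrite imset0; apply/setP=> A; rewrite !inE; apply/esym/negbTE/negP.
  move=> /and3P[AS _ /eqP cA]; have := subset_leq_card AS.
  by rewrite cA cS ltnn.
- split=> [w w'|]; first by rewrite !inE => /eqP-> /eqP->.
  rewrite imset_set1; apply/setP=> A; rewrite in_set1; apply/eqP/idP => [->|/only //].
  by rewrite inE subxx Sc cS eqxx.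
- by move=> u; rewrite inE.
- move=> a b aS bS /and3P[_ _]; rewrite /h nth_uniq ?lt ?enum_uniq //.
  apply: contraNneq => /(congr1 (nth a (enum S))).
  by rewrite !nth_index ?mem_enum // => ->.
move=> w; rewrite inE => /eqP-> a aS; have := mem_nth (x.2 w0) (lt a aS).
by rewrite mem_enum !inE.
Qed.

Section Attach.
Variables (x : colored) (S : {set T}) (B : {set U}) (W : {set V}) (e : rel T).
Variables (h : T -> color) (H : U -> {set T}) (F : V -> {set T}) (u : U) (w : V) (a0 : T).
Hypotheses (ct : colored_tree x) (cl : forall u' w', u' \in B -> (u', w') \in x.1 -> w' \in W).
Hypotheses (uB : u \notin B) (wW : w \in W) (uw : (u, w) \in x.1).
Hypothesis uniqw : forall w', w' \in W -> (u, w') \in x.1 -> w' = w.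
Hypotheses (e_sym : symmetric e) (e_irr : irreflexive e) (kt : ktree_on k e S).
Hypotheses (cd : codes_on S B W e x h H F) (a0S : a0 \notin S).

(** The fresh vertex a0 is joined to the front Q named w and must take the one color missing there,
    x.2 w. The new hedron K is named u, and each new neighbor v of u names the front left when the
    vertex of color x.2 v is dropped from K. *)
Let Q := F w.
Let K := a0 |: Q.
Let e' : rel T := fun a b => if a == a0 then b \in Q else if b == a0 then a \in Q else e a b.
Let h' a := if a == a0 then x.2 w else h a.
Let H' v := if v == u then K else H v.
Let F' v := if v \in W then F v else [set a in K | h' a != x.2 v].

Let F_clique v : v \in W -> F v \in cliques_in e S k.
Proof. by move=> vW; case: cd => _ [_ <-] *; apply: imset_f. Qed.

Let F_sub v : v \in W -> F v \subset S.
Proof. by move=> /F_clique; rewrite inE => /and3P[]. Qed.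

Let a0_F v : v \in W -> a0 \notin F v.
Proof. by move=> /F_sub /subsetP sub; apply: contra a0S; apply: sub. Qed.

Let H_sub v : v \in B -> H v \subset S.
Proof.
move=> vB; have : H v \in cliques_in e S k.+1 by case: cd => [[_ <-]] *; apply: imset_f.
by rewrite inE => /and3P[].
Qed.

Let a0_H v : v \in B -> a0 \notin H v.
Proof. by move=> /H_sub /subsetP sub; apply: contra a0S; apply: sub. Qed.

Let old a : a \in S -> (a == a0) = false.
Proof. by move=> aS; apply: contraNF a0S => /eqP <-. Qed.

Let ee' : {in S &, e =2 e'}.
Proof. by move=> a b aS bS; rewrite /e' !old. Qed.

Let QS : Q \subset S. Proof. exact: F_sub. Qed.
Let cQ : #|Q| = k.
Proof. by have := F_clique wW; rewrite inE => /and3P[_ _ /eqP]. Qed.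

Let Qc : clique e' Q.
Proof. by have := F_clique wW; rewrite (cliques_in_eq _ ee') inE => /and3P[]. Qed.

Let e_sym' : symmetric e'.
Proof. by move=> a b; rewrite /e'; case: (eqVneq a a0) => [e1|_]; case: (eqVneq b a0) => [e2|_] //; rewrite e1 e2. Qed.

Let e_irr' : irreflexive e'.
Proof. by move=> a; rewrite /e'; case: eqP => // ->; apply/negbTE/(a0_F wW). Qed.

Let ex : {in S, forall y, e' a0 y = (y \in Q)}.
Proof. by move=> y yS; rewrite /e' eqxx. Qed.

Let kt' : ktree_on k e' (a0 |: S).
Proof. by apply: (ktree_step (Q := Q)) => //; apply: ktree_on_eq ee' kt. Qed.

Let hp' : proper_coloring e' (a0 |: S) h'.
Proof.
have miss b : b \in Q -> x.2 w != h b by move=> bQ; case: cd => _ _ _ _ hm; rewrite eq_sym hm.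
have hp : proper_coloring e S h by case: cd.
move=> a b; rewrite !inE /e' /h'.
case: (eqVneq a a0) => [_ _|na /= aS]; case: (eqVneq b a0) => [->|nb /= bS].
- by move=> _ /negPn; rewrite (a0_F wW).
- exact: miss.
- by move=> _ aQ; rewrite eq_sym miss.
exact: hp.
Qed.

Let hK_inj : {in K &, injective h'}.
Proof.
apply: clique_coloring_inj hp' (setUS _ QS) _.
exact: step_clique e_sym' QS Qc ex.
Qed.

Let cK : #|K| = k.+1. Proof. exact: step_card a0S QS cQ. Qed.

Let K_color i : exists2 a, a \in K & h' a = i.
Proof.
suff : i \in h' @: K by case/imsetP=> a aK ->; exists a.
suff -> : h' @: K = setT by rewrite inE.
by apply/eqP; rewrite eqEcard subsetT cardsT card_ord (card_in_imset hK_inj) cK leqnn.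
Qed.

Let new_front v : v \notin W -> (u, v) \in x.1 ->
  [/\ a0 \in F' v, F' v \subset K, #|F' v| = k & x.2 v != x.2 w].
Proof.
move=> vW uv; have vw : x.2 v != x.2 w.
  apply: contraNneq vW => vw; suff -> : v = w by [].
  by case: ct => _ _ inj; apply: (inj u); rewrite ?inE.
rewrite /F' (negPf vW); split=> //.
- by rewrite !inE eqxx /h' eqxx eq_sym.
- by apply/subsetP=> a; rewrite inE => /andP[].
have [a aK ha] := K_color (x.2 v).
have -> : [set a in K | h' a != x.2 v] = K :\ a.
  apply/setP=> b; rewrite in_setD1 inE andbC.
  by case bK: (b \in K); rewrite ?andbF // !andbT -ha (inj_in_eq hK_inj).
by have := cardsD1 a K; rewrite aK cK => -[].
Qed.

Lemma codes_on_attach : exists e' h' H' F',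
  [/\ symmetric e', irreflexive e', ktree_on k e' (a0 |: S)
    & codes_on (a0 |: S) (u |: B) (W :|: nbrs x.1 u) e' x h' H' F'].
Proof.
exists e', h', H', F'; split=> //.
have H'B v : v \in B -> H' v = H v.
  by move=> vB; rewrite /H' ifN //; apply: contraNneq uB => <-.
have H'u : H' u = K by rewrite /H' eqxx.
have F'W v : v \in W -> F' v = F v by rewrite /F' => ->.
have a0K : a0 \in K by rewrite setU11.
have memW v : v \in W :|: nbrs x.1 u -> v \in W \/ v \notin W /\ (u, v) \in x.1.
  by rewrite !inE; case: (v \in W) => /=; [left | right].
split.
- split=> [v v'|].
    rewrite !inE => /orP[/eqP->|vB] /orP[/eqP->|v'B] //.
    + by rewrite H'u H'B // => KH; have := a0_H v'B; rewrite -KH a0K.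
    + by rewrite H'u H'B // => KH; have := a0_H vB; rewrite KH a0K.
    by rewrite !H'B //; case: cd => [[H_inj _]] _ _ _ _; apply: H_inj.
  rewrite (hedra_step e_sym' a0S QS cQ Qc ex) imsetU imset_set1 H'u; congr setU.
  rewrite -(cliques_in_eq _ ee'); case: cd => [[_ <-]] _ _ _ _.
  exact: eq_in_imset.
- split=> [v v' /memW vm /memW vm'|].
    case: vm => [vW|[vW uv]]; case: vm' => [v'W|[v'W uv']].
    + by rewrite !F'W //; case: cd => _ [F_inj _] _ _ _; apply: F_inj.
    + have [a0v' _ _ _] := new_front v'W uv'.
      by rewrite F'W // => FF; have := a0_F vW; rewrite FF a0v'.
    + have [a0v _ _ _] := new_front vW uv.
      by rewrite (F'W v') // => FF; have := a0_F v'W; rewrite -FF a0v.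
    move=> FF; have [a aK ha] := K_color (x.2 v).
    case: ct => _ _ inj; apply: (inj u); rewrite ?inE // -ha; apply/eqP.
    have : a \notin F' v by rewrite /F' (negPf vW) inE ha eqxx andbF.
    by rewrite FF /F' (negPf v'W) inE aK /= negbK.
  apply/setP=> A; rewrite (cliques_step e_sym' QS Qc ex) -(cliques_in_eq _ ee').
  apply/imsetP/orP => [[v /memW[vW|[vW uv]] ->]|[AS|/and3P[a0A AK /eqP cA]]].
  + by left; rewrite F'W // F_clique.
  + by right; have [-> -> -> _] := new_front vW uv; rewrite eqxx.
  + move: AS; case: cd => _ [_ <-] _ _ _ /imsetP[v vW ->].
    by exists v; rewrite ?F'W // inE vW.
  have /card_gt0P[a] : 0 < #|K :\: A|.
    by rewrite cardsD (setIidPr AK) cA cK subSnn.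
  (* The front A omits one vertex a of K; its name is the neighbor of u with the color of a. This
     neighbor is new, because A contains a0, the vertex of K with the color of w. *)
  rewrite inE => /andP[aA aK]; have [v uv va] := colored_tree_nbr u (h' a) ct.
  have vW : v \notin W.
    apply/negP => vW; have vw := uniqw vW uv.
    suff a_a0 : a = a0 by rewrite a_a0 a0A in aA.
    by apply: hK_inj; rewrite // -va vw /h' eqxx.
  exists v; first by rewrite !inE uv orbT.
  have [_ FK cF _] := new_front vW uv; apply/eqP; rewrite eqEcard cA cF leqnn andbT.
  apply/subsetP=> b bA; rewrite /F' (negPf vW) inE va.
  rewrite (inj_in_eq hK_inj (subsetP AK b bA) aK) (subsetP AK) //=.
  by apply: contraNneq aA => <-.
- move=> v; rewrite !inE => /orP[/eqP->|vB] v' /memW[v'W|[v'W uv']].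
  + rewrite H'u F'W //; apply/idP/idP => [/(uniqw v'W)->|FK]; first exact: subsetUr.
    have FQ : F v' \subset Q.
      apply/subsetP=> a aF; have := subsetP FK a aF; rewrite !inE.
      by case/orP=> // /eqP aa; have := a0_F v'W; rewrite -aa aF.
    suff -> : v' = w by [].
    case: cd => _ [F_inj _] _ _ _; apply: F_inj => //; apply/eqP.
    rewrite eqEcard FQ -/Q cQ; have := F_clique v'W.
    by rewrite inE => /and3P[_ _ /eqP ->]; rewrite leqnn.
  + by rewrite H'u uv'; have [_ -> _ _] := new_front v'W uv'.
  + by rewrite H'B // F'W //; case: cd => _ _ inc _ _; apply: inc.
  rewrite H'B //; have [a0v _ _ _] := new_front v'W uv'.
  rewrite (contraNF (cl vB) v'W); apply/esym/negbTE/negP => /subsetP /(_ _ a0v).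
  by rewrite (negPf (a0_H vB)).
- exact: hp'.
move=> v /memW[vW|[vW uv]] a.
  rewrite F'W // => aF; rewrite /h' old; last exact: (subsetP (F_sub vW)).
  by case: cd => _ _ _ _ hm; apply: hm.
by rewrite /F' (negPf vW) inE => /andP[].
Qed.

End Attach.

(** The graph has k vertices for the initial front and one more for each hedron, which accounts for
    |U| + k. *)
Lemma ktree_of_colored_tree (x : colored) : #|T| = #|U| + k -> colored_tree x ->
  exists e h H F, [/\ symmetric e, irreflexive e, ktree_on k e setT & codes e x h H F].
Proof.
move=> cT ct; have /card_gt0P[w0 _] := colored_tree_white ct.
pose P B W := exists S e h H F, #|S| = #|B| + k /\
  [/\ symmetric e, irreflexive e, ktree_on k e S & codes_on S B W e x h H F].
have : P setT setT; last first.
  move=> [S [e [h [H [F [cS [h1 h2 h3 h4]]]]]]]; exists e, h, H, F.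
  have ST : S = setT by apply/eqP; rewrite eqEcard subsetT cS !cardsT cT leqnn.
  by rewrite ST in h3 h4.
have tree : is_tree (tadj x.1) by case: ct.
apply: (tree_growth tree (w0 := w0) (B0 := set0) (W0 := [set w0])).
- by rewrite inE.
- exact: subtree_white.
- have /card_gt0P[S] : 0 < #|[set S : {set T} | S \subset setT & #|S| == k]|.
    by rewrite cards_draws cardsT bin_gt0 cT leq_addl.
  rewrite inE => /andP[_ /eqP cS]; have [e [h [H [F st]]]] := codes_on_start x w0 cS.
  by exists S, e, h, H, F; rewrite cards0.
move=> B W u w [cl _] [S [e [h [H [F [cS [h1 h2 h3 h4]]]]]]] uB wW uw uniqw.
have /card_gt0P[a0] : 0 < #|~: S|.
  have := cardsC S; rewrite cT cS; have := cardsC B.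
  by have : 0 < #|~: B| by [apply/card_gt0P; exists u; rewrite inE]; lia.
rewrite inE => a0S.
have [e' [h' [H' [F' st]]]] := codes_on_attach ct cl uB wW uw uniqw h1 h2 h3 h4 a0S.
by exists (a0 |: S), e', h', H', F'; rewrite !cardsU1 a0S uB cS addnA.
Qed.

End Construction.

(** * Counting orbits *)

Section Orbits.
Local Open Scope nat_scope.

(** On D the value of one map determines that of the other, which gives surjections between the
    images in both directions. *)
Lemma card_imset_kernel (A B C : finType) (F : A -> B) (G : A -> C) (D : {set A}) :
  {in D &, forall x y, (F x == F y) = (G x == G y)} -> #|F @: D| = #|G @: D|.
Proof.
have half (B' C' : finType) (F' : A -> B') (G' : A -> C') :
    {in D &, forall x y, (F' x == F' y) = (G' x == G' y)} -> #|G' @: D| <= #|F' @: D|.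
  move=> FG; pose phi b := omap G' [pick x in D | F' x == b].
  have Some_inj : injective (@Some C') by move=> ? ? [].
  rewrite -(card_imset _ Some_inj); apply: leq_trans (leq_imset_card phi _).
  apply: subset_leq_card; apply/subsetP=> _ /imsetP[_ /imsetP[x xD ->] ->].
  apply/imsetP; exists (F' x); first exact: imset_f.
  rewrite /phi; case: pickP => [y /andP[yD]|/(_ x)]; last by rewrite xD eqxx.
  by rewrite FG // => /eqP <-.
move=> FG; apply/eqP; rewrite eqn_leq !half // => x y xD yD; first by rewrite FG.
Qed.

Lemma card_equivalence_partition (A C : finType) (r : rel A) (G : A -> C) (D : {set A}) :
  {in D &, forall x y, r x y = (G x == G y)} -> #|equivalence_partition r D| = #|G @: D|.
Proof.
move=> rG; apply: card_imset_kernel => x y xD yD.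
apply/eqP/eqP => [/setP/(_ y)|Gxy]; first by rewrite !inE yD !rG // eqxx => /eqP.
by apply/setP=> z; rewrite !inE; case zD: (z \in D) => //=; rewrite !rG // Gxy.
Qed.

Section Action.
Variables (k : nat) (U V : finType).
Notation colored := ({set U * V} * {ffun V -> 'I_k.+1})%type.

Definition recolor_by (x : colored) (a : {perm U} * {perm V} * 'S_k.+1) :=
  recolor a.1.1 a.1.2 a.2 x.

Lemma recolor_by1 x : recolor_by x 1%g = x.
Proof. exact: recolor1. Qed.

Lemma recolor_byM x : act_morph recolor_by x.
Proof. by move=> a b; rewrite /recolor_by recolorM. Qed.

Definition recolor_action := TotalAction recolor_by1 recolor_byM.

Lemma burnside_colored :
  \sum_(a : {perm U} * {perm V} * 'S_k.+1) #|fixed_colored a.1.1 a.1.2 a.2|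
  = #|orbit recolor_action setT @: [set x | `[< colored_tree x >]]|
    * ((#|U|)`! * (#|V|)`! * k.+1`!).
Proof.
set X := [set x | _].
have acts : [acts [set: {perm U} * {perm V} * 'S_k.+1], on X | recolor_action].
  apply/subsetP=> a _; rewrite !inE; apply/subsetP=> x; rewrite !inE => /asboolP ct.
  by apply/asboolP; apply: recolor_tree.
have := Frobenius_Cauchy acts; rewrite cardsT !card_prod card_Sn => FC.
have cP (I : finType) : #|{: {perm I}}| = (#|I|)`!.
  rewrite -(cardsT I) -(card_perm [set: I]); apply: eq_card => s.
  by rewrite inE [RHS]inE; apply/esym/subsetP => i; rewrite inE.
rewrite !cP in FC; rewrite -FC; apply: eq_big => [a|a _]; first by rewrite inE.
apply: eq_card => x; rewrite !inE andbC; apply/andP/andP.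
  by move=> [fx ct]; split=> //; rewrite sub1set inE.
by rewrite sub1set inE => -[ct fx].
Qed.

End Action.

Section Classes.
Variables (k n : nat).
Hypothesis k_gt0 : 0 < k.
Notation N := (k * n).+1.
Notation colored := ({set 'I_n * 'I_N} * {ffun 'I_N -> 'I_k.+1})%type.

Lemma hedraE (T : finType) (e : rel T) : hedra k e = cliques_in e setT k.+1.
Proof. by apply/setP=> A; rewrite !inE subsetT. Qed.

Lemma ktree_codes (T : finType) (e : rel T) :
  symmetric e -> irreflexive e -> ktree_on k e setT -> #|hedra k e| = n ->
  exists x : colored, exists h H F, codes e x h H F.
Proof.
rewrite hedraE => e_sym e_irr kt ch.
suff cf : #|cliques_in e setT k| = N.
  by apply: codes_exists; rewrite ?card_ord.
(* The number of fronts is obtained by naming them with a type of exactly that size and applying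
   [colored_tree_card] to the resulting tree. *)
have [||x [h [H [F cd]]]] :=
  @codes_exists k T 'I_n 'I_#|cliques_in e setT k| e e_sym e_irr kt.
- by rewrite card_ord.
- by rewrite card_ord.
have ct := codes_colored_tree e_sym kt cd.
by have := colored_tree_card ct (colored_tree_white ct); rewrite !card_ord.
Qed.

(** The number of hedra determines the number of vertices, so the sum over m in [ktree_ogf] has at
    most one nonzero term. *)
Lemma unlabeled_ktrees_size m : m <> n + k -> unlabeled_ktrees_on k m n = 0.
Proof.
move=> mnk; apply/eqP; rewrite cards_eq0 /equivalence_partition.
apply/eqP/setP => C; rewrite [RHS]inE; apply/negbTE/imsetP => -[g].
rewrite inE => /andP[/asboolP[e_sym e_irr kt] /eqP ch] _; apply: mnk.
by have := ktree_card_hedra e_sym kt; rewrite cardsT card_ord -hedraE ch.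
Qed.

(** Each k-tree gets one code by choice. Two k-trees are isomorphic exactly when their codes share
    an orbit, and every orbit is reached because each colored tree codes some k-tree. *)
Lemma unlabeled_ktrees_orbits :
  unlabeled_ktrees_on k (n + k) n =
  #|orbit (@recolor_action k 'I_n 'I_N) setT @: [set x | `[< colored_tree x >]]|.
Proof.
rewrite /unlabeled_ktrees_on; set D := [set g | _ & _]; set X := [set x | _].
pose coded (g : {set 'I_(n + k) * 'I_(n + k)}) (x : colored) :=
  exists h H F, codes (edge_rel g) x h H F.
have DP g : g \in D -> [/\ symmetric (edge_rel g), irreflexive (edge_rel g),
    ktree_on k (edge_rel g) setT & #|hedra k (edge_rel g)| = n].
  by rewrite inE => /andP[/asboolP[? ? ?] /eqP].
have /boolp.choice[f fP] g : exists x, g \in D -> coded g x.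
  have [gD|gD] := boolP (g \in D); last first.
    by exists (finset.set0, [ffun=> ord0]).
  have [e_sym e_irr kt ch] := DP g gD.
  by have [x cx] := ktree_codes e_sym e_irr kt ch; exists x.
have iso g g' : g \in D -> g' \in D ->
    `[< graph_iso g g' >] = (f g' \in orbit (@recolor_action k 'I_n 'I_N) setT (f g)).
  move=> gD g'D; have [e_sym e_irr kt ch] := DP g gD.
  have [e_sym' e_irr' kt' ch'] := DP g' g'D.
  have [h [H [F cd]]] := fP g gD; have [h' [H' [F' cd']]] := fP g' g'D.
  apply/asboolP/orbitP => [[p pe]|[a _ fa]].
    by have [s [t [c ->]]] := codes_colored_iso e_sym kt cd cd' pe; exists (s, t, c).
  apply: (codes_graph_iso k_gt0 e_sym e_irr kt e_sym' e_irr' kt' cd cd' (esym fa)).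
have fX g : g \in D -> f g \in X.
  move=> gD; have [e_sym e_irr kt ch] := DP g gD; have [h [H [F cd]]] := fP g gD.
  by rewrite inE; apply/asboolP; apply: codes_colored_tree cd.
have surj x : x \in X -> exists2 g, g \in D &
    f g \in orbit (@recolor_action k 'I_n 'I_N) setT x.
  rewrite inE => /asboolP ct.
  have [|e [h [H [F [e_sym e_irr kt cd]]]]] := ktree_of_colored_tree (T := 'I_(n + k)) _ ct.
    by rewrite !card_ord.
  pose g := [set p : 'I_(n + k) * 'I_(n + k) | e p.1 p.2].
  have ge : edge_rel g = e by apply: funext => a; apply: funext => b; rewrite /edge_rel inE.
  have gD : g \in D.
    rewrite inE ge; apply/andP; split; first exact/asboolP.
    have := ktree_card_hedra e_sym kt; rewrite cardsT card_ord -hedraE.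
    by move=> /addIn cn; apply/eqP.
  exists g => //; have [h' [H' [F' cd']]] := fP g gD; rewrite ge in cd'.
  (* Both x and the chosen code of g code the same graph, so the identity isomorphism puts them in
     one orbit. *)
  have [s [t [c ->]]] := codes_colored_iso (p := 1%g) e_sym kt cd cd' (fun a b => etrans (congr2 e (perm1 a) (perm1 b)) erefl).
  by apply/orbitP; exists (s, t, c).
have -> : orbit (@recolor_action k 'I_n 'I_N) setT @: X
    = (fun g => orbit (@recolor_action k 'I_n 'I_N) setT (f g)) @: D.
  apply/setP=> O; apply/imsetP/imsetP => [[x xX ->]|[g gD ->]].
    by have [g gD gx] := surj x xX; exists g => //; apply/esym/orbit_eqP.
  by exists (f g) => //; apply: fX.
apply: card_equivalence_partition => g g' gD g'D.
by rewrite iso // orbit_sym; apply/idP/eqP => /orbit_eqP.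
Qed.

End Classes.
End Orbits.

(** * The dissymmetry identity summed over all permutations *)

Section RootedCounts.
Local Open Scope nat_scope.
Variables (k n : nat).
Notation N := (k * n).+1.
Notation colored := ({set 'I_n * 'I_N} * {ffun 'I_N -> 'I_k.+1})%type.
Implicit Types (s : 'S_n) (t : 'S_N) (g : 'S_k.+1).

Definition rooted_black g : nat :=
  \sum_s \sum_t \sum_(x in @fixed_colored k 'I_n 'I_N s t g) #|[set v | s v == v]|.

Definition rooted_white g (i : 'I_k.+1) : nat :=
  \sum_s \sum_t \sum_(x in @fixed_colored k 'I_n 'I_N s t g) #|[set w | (t w == w) && (x.2 w == i)]|.

Definition rooted_edge g (i : 'I_k.+1) : nat :=
  \sum_s \sum_t \sum_(x in @fixed_colored k 'I_n 'I_N s t g)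
    #|[set e in x.1 | (s e.1 == e.1) && (t e.2 == e.2) && (x.2 e.2 == i)]|.

Lemma rooted_blackJ g p : rooted_black (g ^ p)%g = rooted_black g.
Proof. by apply: eq_bigr => s _; apply: eq_bigr => t _; apply: sum_fixed_conj. Qed.

Lemma rooted_whiteJ g p i : rooted_white (g ^ p)%g (p i) = rooted_white g i.
Proof.
apply: eq_bigr => s _; apply: eq_bigr => t _; apply: sum_fixed_conj => x.
by apply: eq_card => w; rewrite !inE recolor1_color (inj_eq perm_inj).
Qed.

Lemma rooted_edgeJ g p i : rooted_edge (g ^ p)%g (p i) = rooted_edge g i.
Proof.
apply: eq_bigr => s _; apply: eq_bigr => t _; apply: sum_fixed_conj => x.
by apply: eq_card => e; rewrite !inE recolor1_edges recolor1_color (inj_eq perm_inj).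
Qed.

Lemma rooted_white0 g i : g i != i -> rooted_white g i = 0.
Proof.
move=> gi; apply: big1 => s _; apply: big1 => t _; apply: big1 => x /fixed_coloredP[_ fx].
apply: eq_card0 => w; rewrite !inE; apply/negbTE/negP => /andP[/eqP tw /eqP cw].
by move: gi; rewrite -cw -(fixed_color _ fx) tw eqxx.
Qed.

Lemma rooted_edge0 g i : g i != i -> rooted_edge g i = 0.
Proof.
move=> gi; apply: big1 => s _; apply: big1 => t _; apply: big1 => x /fixed_coloredP[_ fx].
apply: eq_card0 => e; rewrite !inE; apply/negbTE/negP.
move=> /andP[_ /andP[/andP[_ /eqP tw] /eqP cw]].
by move: gi; rewrite -cw -(fixed_color _ fx) tw eqxx.
Qed.

(** This is [fixed_colored_euler] summed over s, t and g: the sums over colors collapse by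
    [sum_over_colors], and the constant 1 becomes the Burnside sum. *)
Lemma dissymmetry :
  \sum_g rooted_black g + k.+1 * \sum_(g : 'S_k) rooted_white (lift_perm ord0 ord0 g) ord0
  = \sum_(a : 'S_n * 'S_N * 'S_k.+1) #|@fixed_colored k 'I_n 'I_N a.1.1 a.1.2 a.2|
    + k.+1 * \sum_(g : 'S_k) rooted_edge (lift_perm ord0 ord0 g) ord0.
Proof.
rewrite -(sum_over_colors rooted_whiteJ rooted_white0) -(sum_over_colors rooted_edgeJ rooted_edge0).
have -> : \sum_(a : 'S_n * 'S_N * 'S_k.+1) #|@fixed_colored k 'I_n 'I_N a.1.1 a.1.2 a.2|
    = \sum_(g : 'S_k.+1) \sum_s \sum_t #|@fixed_colored k 'I_n 'I_N s t g|.
  rewrite [RHS]exchange_big /=; under [RHS]eq_bigr do rewrite exchange_big.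
  by rewrite pair_bigA pair_bigA.
rewrite -!big_split /=; apply: eq_bigr => g _.
have sum_in (D : 'S_n -> 'S_N -> colored -> 'I_k.+1 -> nat) :
    \sum_i \sum_s \sum_t \sum_(x in fixed_colored s t g) D s t x i
    = \sum_s \sum_t \sum_(x in fixed_colored s t g) \sum_i D s t x i.
  rewrite exchange_big; apply: eq_bigr => s _; rewrite exchange_big.
  by apply: eq_bigr => t _; rewrite exchange_big.
rewrite /rooted_white /rooted_edge !sum_in /rooted_black -!big_split /=.
apply: eq_bigr => s _; rewrite -!big_split /=; apply: eq_bigr => t _.
rewrite -[X in _ = (X + _)%N]sum1_card -!big_split /=; apply: eq_bigr => x; exact: fixed_colored_euler.
Qed.

End RootedCounts.

(** * Coefficients of the generating functions *)

Section GeneratingFunctions.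

Lemma sum_ncycles m (s : 'S_m) : (\sum_(1 <= j < m.+1) j * ncycles s j)%N = m.
Proof.
transitivity (\sum_(j < m.+1) j * ncycles s j)%N.
  by rewrite -(big_mkord xpredT (fun j => j * ncycles s j)%N) [RHS]big_ltn.
rewrite -[RHS]card_ord -[RHS]sum1_card.
rewrite [RHS](partition_big (fun x => inord #|porbit s x| : 'I_m.+1) xpredT) //=.
apply: eq_bigr => j _; rewrite sum1_card.
transitivity #|[set x | #|porbit s x| == j]|.
  rewrite -cycle_type_card cycle_typeE; congr (_ * _)%N.
  by apply: eq_card => C; rewrite !inE subsetT.
apply: eq_card => x; rewrite inE -[RHS]/(val (inord #|porbit s x| : 'I_m.+1) == j) /= inordK //.
by rewrite ltnS -[X in (_ <= X)%N](card_ord m) max_card.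
Qed.

Lemma prod_ncycles m (s : 'S_m) :
  \prod_(1 <= j < m.+1) ('X^j : {poly rat}) ^+ ncycles s j = 'X^m.
Proof.
under eq_bigr do rewrite -exprM.
by rewrite prodrXr sum_ncycles.
Qed.

(** The cycle lengths of s add up to m, so every monomial is X^m and the part with m black labels
    contributes to that coefficient only. *)
Lemma coef_cycle_index (G : Type) (F : gspecies G) (g : G) m n N :
  (cycle_index_part F (fun j => 'X^j : {poly rat}) (fun=> 1) g m n)`_N =
  if N == m then (m`! * n`!)%N%:R^-1 * (\sum_(s : 'S_m) \sum_(t : 'S_n) gs_fix F g s t)%N%:R
  else 0.
Proof.
rewrite /cycle_index_part coefZ coef_sum.
have -> : \sum_(s : 'S_m) (\sum_(t : 'S_n) (gs_fix F g s t)%:R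
    * (\prod_(1 <= j < m.+1) ('X^j : {poly rat}) ^+ ncycles s j)
    * (\prod_(1 <= j < n.+1) 1 ^+ ncycles t j))`_N
  = (\sum_(s : 'S_m) \sum_(t : 'S_n) gs_fix F g s t)%N%:R * (N == m)%:R :> rat.
  rewrite natr_sum mulr_suml; apply: eq_bigr => s _.
  rewrite coef_sum natr_sum mulr_suml; apply: eq_bigr => t _.
  rewrite prod_ncycles big1 ?mulr1; last by move=> j _; rewrite expr1n.
  by rewrite mulr_natl coefMn coefXn [RHS]mulr_natl.
by case: eqP => _; rewrite ?mulr1 // !mulr0.
Qed.

Lemma sum_cycle_type_const m (s : 'S_m) (c : rat) :
  \sum_(t : 'S_m | cycle_type t == cycle_type s) c = m`!%:R * (z_part (cycle_type s))%:R^-1 * c.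
Proof.
rewrite (eq_bigl (mem [set t : 'S_m | cycle_type t == cycle_type s])) => [|t]; last by rewrite /= inE.
rewrite sumr_const -(card_cycle_type s) natrM mulfK ?mulr_natl //.
by rewrite pnatr_eq0 -lt0n z_part_gt0.
Qed.

End GeneratingFunctions.

(* Imported only here because classical_sets shadows names of finset. *)
From mathcomp Require Import classical_sets fsbigop.

Section Sums.

Lemma gs_ogfE (G : Type) (F : gspecies G) (g : G) (n N : nat) :
  (forall (m : nat) (s : 'S_n) (t : 'S_m), m != N -> gs_fix F g s t = 0%N) ->
  gs_ogf F g n = (n`! * N`!)%N%:R^-1 * (\sum_(s : 'S_n) \sum_(t : 'S_N) gs_fix F g s t)%N%:R.
Proof.
move=> F0; rewrite /gs_ogf (fsbigE [:: (n, N)]) //.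
  by rewrite big_mkcond big_seq1 ifT ?inE // coef_cycle_index eqxx.
move=> [m p] _; rewrite inE coef_cycle_index xpair_eqE negb_and /=.
case: (eqVneq n m) => [<-|//] /= pN.
rewrite big1 ?mulr0 // => s _; rewrite big1 // => t _; exact: F0.
Qed.

(** Weighting cycle types by 1/z is averaging over the group, since a class has n!/z elements. The
    second hypothesis matches the default value 0 of [gs_ogf_type]. *)
Lemma sum_partitions (n : nat) (f : 'S_n -> rat) (f' : {mset nat} -> rat) :
  (forall s, f' (cycle_type s) = f s) ->
  (forall la, (forall s : 'S_n, cycle_type s <> la) -> f' la = 0) ->
  \sum_(la \in partitions n) (z_part la)%:R^-1 * f' la = n`!%:R^-1 * \sum_s f s.
Proof.
move=> ff' f'0; pose r := undup [seq cycle_type s | s <- enum 'S_n].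
have rP la : reflect (exists s : 'S_n, la = cycle_type s) (la \in r).
  rewrite mem_undup; apply: (iffP mapP) => [[s _ ->]|[s ->]]; first by exists s.
  by exists s; rewrite // mem_enum.
rewrite (fsbigE r) ?undup_uniq //; first last.
- move=> la _ lar; rewrite f'0 ?mulr0 // => s sla.
  by case/rP: lar; exists s.
- by move=> la /= /rP[s ->]; apply: cycle_type_partition.
have -> : \sum_s f s = \sum_(la <- r) \sum_(s : 'S_n | cycle_type s == la) f' la.
  rewrite (exchange_big_dep xpredT) //=; apply: eq_bigr => s _.
  have sr : cycle_type s \in r by apply/rP; exists s.
  rewrite big_mkcond (bigD1_seq _ sr (undup_uniq _)) /= eqxx ff' big1 ?addr0 // => la.
  by rewrite eq_sym => /negPf->.
rewrite big_seq_cond (eq_bigl (mem r)) => [|la]; last first.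
  rewrite /= andbC; case: (boolP (la \in r)) => [/rP[s ->]|_]; last by rewrite andbF.
  by rewrite andbT; apply/mem_set/cycle_type_partition.
rewrite -big_seq mulr_sumr; apply: eq_big_seq => la /rP[s ->].
rewrite sum_cycle_type_const !mulrA mulVf ?mul1r //.
by rewrite pnatr_eq0 -lt0n fact_gt0.
Qed.

(** Here b, w and e are the sums over black, white and edge roots, u is the number of orbits, K is k
    + 1 and fk is k!. *)
Lemma dissymmetry_average (u b w e fn fN fk K : rat) :
  fn != 0 -> fN != 0 -> fk != 0 -> K != 0 ->
  b + K * w = u * (fn * fN * (K * fk)) + K * e ->
  u = (K * fk)^-1 * ((fn * fN)^-1 * b) + fk^-1 * ((fn * fN)^-1 * w)
      - fk^-1 * ((fn * fN)^-1 * e).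
Proof.
move=> fn0 fN0 fk0 K0 dis.
have -> : b = u * (fn * fN * (K * fk)) + K * e - K * w by rewrite -dis addrK.
by field; rewrite fn0 fN0 fk0.
Qed.

End Sums.

Theorem mainTheorem3 (k : nat) (hk : (1 <= k)%N) (n : nat) :
  ktree_ogf k n =
    \sum_(la \in partitions k.+1)
       (z_part la)%:R^-1 * gs_ogf_type (CT_XY k) la n
  + \sum_(la \in partitions k)
       (z_part la)%:R^-1 * gs_ogf_type (CT_Y k) la n
  - \sum_(la \in partitions k)
       (z_part la)%:R^-1 * gs_ogf_type (CT_XY k) (la `+` [mset 1%N])%mset n.
Proof.
pose N := (k * n).+1; pose c : rat := (n`! * N`!)%N%:R^-1.
have no_fixed m (s : 'S_n) (t : 'S_m) (g : 'S_k.+1) (F : _ -> nat) : m != N ->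
    (\sum_(x in @fixed_colored k 'I_n 'I_m s t g) F x)%N = 0%N.
  move=> mN; rewrite big_pred0 // => x; apply/negP => /fixed_coloredP[ct _].
  have := colored_tree_card ct (colored_tree_white ct).
  by rewrite !card_ord; apply/eqP.
have XY g : gs_ogf (CT_XY k) g n = c * (rooted_black n g)%:R.
  rewrite (@gs_ogfE _ _ _ _ N) => [|m s t mN]; last first.
    by rewrite [LHS]fix_XY_colored no_fixed.
  congr (_ * _%:R); apply: eq_bigr => s _; apply: eq_bigr => t _.
  exact: fix_XY_colored.
(* The edge-rooted series is read a second time, now as a count of fixed edges of color 0. *)
have XY_lift g : gs_ogf (CT_XY k) (lift_perm ord0 ord0 g) n
    = c * (rooted_edge n (lift_perm ord0 ord0 g) ord0)%:R.
  rewrite (@gs_ogfE _ _ _ _ N) => [|m s t mN]; last first.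
    by rewrite [LHS]fix_XY_colored no_fixed.
  congr (_ * _%:R); apply: eq_bigr => s _; apply: eq_bigr => t _.
  exact: fix_XY_lift.
have Y g : gs_ogf (CT_Y k) g n = c * (rooted_white n (lift_perm ord0 ord0 g) ord0)%:R.
  rewrite (@gs_ogfE _ _ _ _ N) => [|m s t mN]; last first.
    by rewrite [LHS]fix_Y_colored no_fixed.
  congr (_ * _%:R); apply: eq_bigr => s _; apply: eq_bigr => t _.
  exact: fix_Y_colored.
have typeE m (F : gspecies 'S_m) (s : 'S_m) :
    (forall p : 'S_m, gs_ogf F (s ^ p)%g n = gs_ogf F s n) ->
    gs_ogf_type F (cycle_type s) n = gs_ogf F s n.
  move=> FJ; rewrite /gs_ogf_type; case: pickP => [t /eqP ts|/(_ s)]; last by rewrite eqxx.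
  by have [p ->] := cycle_type_conj (esym ts).
have type0 m (F : gspecies 'S_m) la :
    (forall s : 'S_m, cycle_type s <> la) -> gs_ogf_type F la n = 0.
  by move=> nla; rewrite /gs_ogf_type; case: pickP => // s /eqP /nla.
have XYJ (g p : 'S_k.+1) : gs_ogf (CT_XY k) (g ^ p)%g n = gs_ogf (CT_XY k) g n.
  by rewrite !XY rooted_blackJ.
rewrite (sum_partitions (f := fun g => gs_ogf (CT_XY k) g n)); first last.
- by move=> la; apply: type0.
- by move=> s; apply: typeE.
rewrite (sum_partitions (f := fun g => gs_ogf (CT_Y k) g n)); first last.
- by move=> la; apply: type0.
- move=> s; apply: typeE => p; rewrite !Y.
  (* Conjugation in S_k lifts to conjugation by a permutation fixing 0, so [rooted_whiteJ] keeps the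
     root at color 0. *)
  have -> : lift_perm ord0 ord0 (s ^ p)%g = ((lift_perm ord0 ord0 s) ^ (lift_perm ord0 ord0 p))%g.
    by rewrite !conjgE lift_permV !lift_permM.
  have := rooted_whiteJ n (lift_perm ord0 ord0 s) (lift_perm ord0 ord0 p) ord0.
  by rewrite lift_perm_id => ->.
rewrite (sum_partitions (f := fun g : 'S_k => gs_ogf (CT_XY k) (lift_perm ord0 ord0 g) n)); first last.
- move=> la nla; apply: type0 => s sla; have [t tla] := cycle_type_lift_inv sla.
  exact: nla tla.
- by move=> s; rewrite -cycle_type_lift; apply: typeE.
rewrite (eq_bigr _ (fun g _ => XY g)) (eq_bigr _ (fun g _ => Y g)).
rewrite (eq_bigr _ (fun g _ => XY_lift g)) -!mulr_sumr -!natr_sum.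
have -> : ktree_ogf k n = (unlabeled_ktrees_on k (n + k) n)%:R.
  rewrite /ktree_ogf (fsbigE [:: (n + k)%N]) //.
    by rewrite big_mkcond big_seq1 ifT ?inE.
  by move=> m _; rewrite inE => /eqP mnk; rewrite unlabeled_ktrees_size.
have := dissymmetry k n; rewrite burnside_colored -unlabeled_ktrees_orbits // !card_ord.
move=> /(congr1 (fun i => i%:R : rat)) dis.
have nf m : m`!%:R != 0 :> rat by rewrite pnatr_eq0 -lt0n fact_gt0.
have k1 : k.+1%:R != 0 :> rat by rewrite pnatr_eq0.
have {}dis : (\sum_(g : 'S_k.+1) rooted_black n g)%N%:R
    + k.+1%:R * (\sum_(g : 'S_k) rooted_white n (lift_perm ord0 ord0 g) ord0)%N%:R
  = (unlabeled_ktrees_on k (n + k) n)%:R * (n`!%:R * N`!%:R * (k.+1%:R * k`!%:R))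
    + k.+1%:R * (\sum_(g : 'S_k) rooted_edge n (lift_perm ord0 ord0 g) ord0)%N%:R :> rat.
  by rewrite -!natrM -!natrD.
rewrite (_ : k.+1`!%:R = k.+1%:R * k`!%:R); last by rewrite -natrM.
rewrite (_ : c = (n`!%:R * N`!%:R)^-1); last by rewrite /c natrM.
exact: dissymmetry_average (nf n) (nf N) (nf k) k1 dis.
Qed.
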